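(* Let $n\ge 3$ and let $g=e^{2\rho}g_0$ be a conformal metric on a domain $\Omega\subset\mathbb{S}^n$, where $g_0$ is the standard metric of the unit sphere $\mathbb{S}^n$, such that all the eigenvalues of its Schouten tensor are constant on $\Omega$. Then, after possibly a dilation of $g$ (replacing $g$ by $e^{t}g$ with $t\ge0$ such that all eigenvalues of the Schouten tensor of $e^tg$ are less than $1/2$), the hypersurface $\phi:\Omega\to\mathbb{H}^{n+1}$ associated with the (dilated) metric is an isoparametric hypersurface of $\mathbb{H}^{n+1}$ (all its principal curvatures are constant); thus it is a piece of either a totally umbilical hypersurface (hypersphere, horosphere, totally geodesic hyperplane or equidistant hypersurface) or a standard product $\mathbb{S}^k\times\mathbb{H}^{n-k}$ in $\mathbb{H}^{n+1}$.
   Context: Schouten tensor: ${\rm Sch}_g=\frac{1}{n-2}\left({\rm Ric}_g-\frac{S(g)}{2(n-1)}g\right)$, with ${\rm Ric}_g$ the Ricci tensor and $S(g)$ the scalar curvature; its eigenvalues are those of $g^{-1}{\rm Sch}_g$. Replacing $g$ by $e^tg$ multiplies these eigenvalues by $e^{-t}$. Let $\mathbb{L}^{n+2}$ be $\mathbb{R}^{n+2}$ with coordinates $(x_0,\ldots,x_{n+1})$ and the Lorentzian metric $\langle x,x\rangle=-x_0^2+\sum_{i=1}^{n+1}x_i^2$, and $\mathbb{H}^{n+1}=\{\langle x,x\rangle=-1,\ x_0>0\}$. For a conformal metric $e^{2\rho}g_0$ on $\Omega\subset\mathbb{S}^n\subset\mathbb{R}^{n+1}$ whose Schouten tensor has all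 eigenvalues less than $1/2$, the associated hypersurface is the map $\phi:\Omega\to\mathbb{H}^{n+1}\subset\mathbb{L}^{n+2}$, $$\phi(x)=\frac{e^{\rho}}{2}\left(1+e^{-2\rho}\left(1+\|\nabla^{g_0}\rho\|_{g_0}^2\right)\right)(1,x)+e^{-\rho}\left(0,-x+\nabla^{g_0}\rho\right),$$ which is an immersed hypersurface, oriented by the unit normal $\eta=e^{\rho}(1,x)-\phi$. A standard product $\mathbb{S}^{k}\times\mathbb{H}^{n-k}$ is, up to isometry of $\mathbb{H}^{n+1}$, the hypersurface of points $(u,w)\in\mathbb{L}^{n-k+1}\times\mathbb{R}^{k+1}=\mathbb{L}^{n+2}$ with $u_0>0$, $\langle u,u\rangle=-(1+r^2)$ and $|w|^2=r^2$ for some $r>0$, where $1\le k\le n-1$. Metrics are smooth. *)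

(* Defs.v *)
(* Points and vectors are row vectors; linear maps act by right
   multiplication. *)
From mathcomp Require Import all_boot all_order all_algebra.
From mathcomp Require Import all_classical all_reals all_analysis.
Set Implicit Arguments.
Unset Strict Implicit.
Unset Printing Implicit Defensive.
Import Order.TTheory GRing.Theory Num.Theory.
Import numFieldNormedType.Exports.
Local Open Scope classical_set_scope.
Local Open Scope ring_scope.

Section Calculus.
Variables (R : realType) (n : nat).
Implicit Types (U : set 'rV[R]_n) (f : 'rV[R]_n -> R).

Definition partial (i : 'I_n) f (u : 'rV[R]_n) : R := 'D_(delta_mx 0 i) f u.

Fixpoint Ck (k : nat) U f : Prop :=
  match k with
  | 0%N => forall u, U u -> {for u, continuous f}
  | k'.+1 => (forall u, U u -> differentiable f u)
             /\ forall i : 'I_n, Ck k' U (partial i f)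
  end.

(* Meant for open U. *)
Definition smooth_on U f : Prop := forall k, Ck k U f.

(* Row i is the i-th partial derivative of the vector-valued map F. *)
Definition jac m (F : 'rV[R]_n -> 'rV[R]_m) (u : 'rV[R]_n) : 'M[R]_(n, m) :=
  \matrix_(i, j) partial i (fun w => F w 0 j) u.

Definition dotv m (p q : 'rV[R]_m) : R := \sum_(j < m) p 0 j * q 0 j.

End Calculus.
Arguments dotv {R m} p q.

(* Curvature of a Riemannian metric given, in local coordinates, by its Gram
   matrix G u = (g_ij(u)). *)
Section CoordinateCurvature.
Variables (R : realType) (n : nat) (G : 'rV[R]_n -> 'M[R]_n).

(* Gamma^k_ij *)
Definition christoffel (k i j : 'I_n) (u : 'rV[R]_n) : R :=
  2^-1 * \sum_(l < n) invmx (G u) k l *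
    (partial i (fun w => G w j l) u + partial j (fun w => G w i l) u
     - partial l (fun w => G w i j) u).

(* R(d_i, d_j) d_k = sum_l (riemann l k i j) d_l,
   where R(X, Y) = [nabla_X, nabla_Y] - nabla_[X, Y]. *)
Definition riemann (l k i j : 'I_n) (u : 'rV[R]_n) : R :=
  partial i (christoffel l j k) u - partial j (christoffel l i k) u
  + \sum_(m < n) (christoffel l i m u * christoffel m j k u
                  - christoffel l j m u * christoffel m i k u).

(* Ric(Y, Z) = tr (X |-> R(X, Y) Z); positive on round spheres. *)
Definition ricci (u : 'rV[R]_n) : 'M[R]_n :=
  \matrix_(j, k) \sum_(l < n) riemann l k l j u.

Definition scalar_curv (u : 'rV[R]_n) : R := \tr (invmx (G u) *m ricci u).

Definition schouten (u : 'rV[R]_n) : 'M[R]_n :=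
  (n%:R - 2)^-1 *:
    (ricci u - (scalar_curv u / (2 * (n%:R - 1))) *: G u).

Definition schouten_op (u : 'rV[R]_n) : 'M[R]_n := invmx (G u) *m schouten u.

End CoordinateCurvature.

Section Sphere.
Variables (R : realType) (n : nat).

Definition sphere : set 'rV[R]_n.+1 := [set x | dotv x x = 1].

Definition sphere_domain (Omega : set 'rV[R]_n.+1) : Prop :=
  [/\ exists2 O : set 'rV[R]_n.+1, open O & Omega = sphere `&` O,
      connected Omega & Omega !=set0].

(* The two inverse stereographic projections; [stereo s] is a diffeomorphism
   from R^n onto the sphere minus the pole ((-1)^s, 0, ..., 0).  All local
   notions on the sphere are expressed in this atlas. *)
Definition stereo (s : bool) (u : 'rV[R]_n) : 'rV[R]_n.+1 :=
  (1 + dotv u u)^-1 *: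
    row_mx (((-1) ^+ s * (dotv u u - 1))%:M : 'rV[R]_1) (2 *: u).

Definition sphere_smooth (Omega : set 'rV[R]_n.+1) (f : 'rV[R]_n.+1 -> R) :=
  forall s, smooth_on (stereo s @^-1` Omega) (f \o stereo s).

Definition round_metric (s : bool) (u : 'rV[R]_n) : 'M[R]_n :=
  jac (stereo s) u *m (jac (stereo s) u)^T.

(* The metric e^(2 rho) g_0. *)
Definition conf_metric (rho : 'rV[R]_n.+1 -> R) (s : bool) (u : 'rV[R]_n) :
    'M[R]_n :=
  expR (2 * rho (stereo s u)) *: round_metric s u.

(* e^t e^(2 rho) g_0 = e^(2 (rho + t/2)) g_0 *)
Definition dilate (t : R) (rho : 'rV[R]_n.+1 -> R) : 'rV[R]_n.+1 -> R :=
  fun x => rho x + t / 2.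

(* The g_0-gradient at x, as a vector of R^(n+1): the unique v tangent to the
   sphere at x such that g_0(v, X) = d rho (X) for all coordinate fields X. *)
Definition sphere_grad (rho : 'rV[R]_n.+1 -> R) (x : 'rV[R]_n.+1) :
    'rV[R]_n.+1 :=
  xget 0 [set v | dotv v x = 0 /\
    forall s u, stereo s u = x ->
      forall i, dotv v (row i (jac (stereo s) u))
                = partial i (rho \o stereo s) u].

(* a lists the eigenvalues of A, repeated according to multiplicity. *)
Definition eigenvalues_of (A : 'M[R]_n) (a : 'I_n -> R) : Prop :=
  char_poly A = \prod_(i < n) ('X - (a i)%:P).

Definition schouten_constant (Omega : set 'rV[R]_n.+1)
    (rho : 'rV[R]_n.+1 -> R) : Prop :=
  exists a : 'I_n -> R, forall s u, Omega (stereo s u) ->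
    eigenvalues_of (schouten_op (conf_metric rho s) u) a.

Definition schouten_lt_half (Omega : set 'rV[R]_n.+1)
    (rho : 'rV[R]_n.+1 -> R) : Prop :=
  forall s u, Omega (stereo s u) ->
    forall a, eigenvalue (schouten_op (conf_metric rho s) u) a -> a < 2^-1.

End Sphere.
Arguments sphere_grad {R n} rho x.

Section Hyperbolic.
Variables (R : realType) (n : nat).

Definition lor (p q : 'rV[R]_n.+2) : R :=
  - (p 0 0 * q 0 0) + \sum_(i < n.+1) p 0 (lift ord0 i) * q 0 (lift ord0 i).

Definition hyp : set 'rV[R]_n.+2 := [set p | lor p p = -1 /\ 0 < p 0 0].

Definition lcons (c : R) (x : 'rV[R]_n.+1) : 'rV[R]_n.+2 :=
  row_mx (c%:M : 'rV[R]_1) x.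

Definition assoc_hyp (rho : 'rV[R]_n.+1 -> R) (x : 'rV[R]_n.+1) :
    'rV[R]_n.+2 :=
  let grad := sphere_grad rho x in
  (expR (rho x) / 2 * (1 + expR (- (2 * rho x)) * (1 + dotv grad grad)))
    *: lcons 1 x
  + expR (- rho x) *: lcons 0 (- x + grad).

Definition assoc_normal (rho : 'rV[R]_n.+1 -> R) (x : 'rV[R]_n.+1) :
    'rV[R]_n.+2 :=
  expR (rho x) *: lcons 1 x - assoc_hyp rho x.

(* phi : Omega -> hyp is a smooth immersion with unit normal field eta. *)
Definition oriented_hypersurface (Omega : set 'rV[R]_n.+1)
    (phi eta : 'rV[R]_n.+1 -> 'rV[R]_n.+2) : Prop :=
  [/\ forall j, sphere_smooth Omega (fun x => phi x 0 j),
      forall j, sphere_smooth Omega (fun x => eta x 0 j),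
      forall x, Omega x ->
        [/\ hyp (phi x), lor (eta x) (eta x) = 1 & lor (eta x) (phi x) = 0]
    & forall s u, Omega (stereo s u) ->
        row_free (jac (phi \o stereo s) u) /\
        forall i, lor (eta (stereo s u)) (row i (jac (phi \o stereo s) u)) = 0].

Definition first_form (phi : 'rV[R]_n.+1 -> 'rV[R]_n.+2) (s : bool)
    (u : 'rV[R]_n) : 'M[R]_n :=
  \matrix_(i, j) lor (row i (jac (phi \o stereo s) u))
                     (row j (jac (phi \o stereo s) u)).

Definition second_form (phi eta : 'rV[R]_n.+1 -> 'rV[R]_n.+2) (s : bool)
    (u : 'rV[R]_n) : 'M[R]_n :=
  \matrix_(i, j) - lor (row i (jac (eta \o stereo s) u))
                       (row j (jac (phi \o stereo s) u)).

(* Matrix of the shape operator -d eta; its eigenvalues are the principal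
   curvatures.  Since eta is a unit normal field tangent to hyp, its
   derivative in R^(n+2) is the covariant one. *)
Definition shape_op (phi eta : 'rV[R]_n.+1 -> 'rV[R]_n.+2) (s : bool)
    (u : 'rV[R]_n) : 'M[R]_n :=
  invmx (first_form phi s u) *m second_form phi eta s u.

Definition isoparametric (Omega : set 'rV[R]_n.+1)
    (phi eta : 'rV[R]_n.+1 -> 'rV[R]_n.+2) : Prop :=
  oriented_hypersurface Omega phi eta /\
  exists kappa : 'I_n -> R, forall s u, Omega (stereo s u) ->
    eigenvalues_of (shape_op phi eta s u) kappa.

(* The hyperbolic distance satisfies cosh d(p, q) = - lor p q, so this is the
   sphere of centre a and radius r. *)
Definition hypersphere (M : set 'rV[R]_n.+2) : Prop :=
  exists a r, [/\ hyp a, 0 < r &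
    M = [set p | hyp p /\ lor p a = - ((expR r + expR (- r)) / 2)]].

(* Centred at the ideal point spanned by the null vector a, whose scale selects
   the leaf. *)
Definition horosphere (M : set 'rV[R]_n.+2) : Prop :=
  exists a, [/\ lor a a = 0, 0 < a 0 0 & M = [set p | hyp p /\ lor p a = -1]].

Definition geodesic_hyperplane (M : set 'rV[R]_n.+2) : Prop :=
  exists a, lor a a = 1 /\ M = [set p | hyp p /\ lor p a = 0].

(* c is sinh of the signed distance to the hyperplane orthogonal to a. *)
Definition equidistant_hypersurface (M : set 'rV[R]_n.+2) : Prop :=
  exists a c, [/\ lor a a = 1, c != 0 & M = [set p | hyp p /\ lor p a = c]].

Definition totally_umbilical (M : set 'rV[R]_n.+2) : Prop :=
  [\/ hypersphere M, horosphere M, geodesic_hyperplane M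
    | equidistant_hypersurface M].

(* Isometries of hyp are the restrictions of the linear Lorentz isometries
   preserving it. *)
Definition hyp_isometry (L : 'M[R]_n.+2) : Prop :=
  (forall p q, lor (p *m L) (q *m L) = lor p q) /\
  (forall p, hyp p -> hyp (p *m L)).

(* p = (u, w) with u = (p_0, ..., p_(n-k)) and w = (p_(n-k+1), ..., p_(n+1)). *)
Definition model_product (k : nat) (r : R) : set 'rV[R]_n.+2 :=
  [set p | [/\ 0 < p 0 0,
     - (p 0 0) ^+ 2 + \sum_(i < n.+2 | (0 < i <= n - k)%N) p 0 i ^+ 2
       = - (1 + r ^+ 2)
   & \sum_(i < n.+2 | (n - k < i)%N) p 0 i ^+ 2 = r ^+ 2]].

Definition standard_product (k : nat) (M : set 'rV[R]_n.+2) : Prop :=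
  exists r L, [/\ 0 < r, hyp_isometry L &
    M = (fun p => p *m L) @` model_product k r].

Definition piece_of (Omega : set 'rV[R]_n.+1)
    (phi : 'rV[R]_n.+1 -> 'rV[R]_n.+2) (M : set 'rV[R]_n.+2) : Prop :=
  phi @` Omega `<=` M.

End Hyperbolic.

(* Main.v *)
(* In a stereographic chart the metric is e^(2 sigma) times the flat one.  Let A
   be the matrix of its Schouten operator, psi = e^rho (1, x) the null lift of
   the sphere and phi the associated hypersurface.  Then d phi = (1/2 - A) d psi
   and d eta = (1/2 + A) d psi, so the principal curvatures are the numbers
   - (1/2 + a_i) / (1/2 - a_i), which are constant.

   The metric is conformally flat, hence A satisfies the Codazzi equation.
   Comparing the first and second variations of its constant eigenvalues, as in
   Cartan's formula for isoparametric hypersurfaces, shows for eigenvectors v and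
   w with eigenvalues lambda <> mu that lambda + mu, the curvature of the plane
   (v, w), has the sign of a quadratic form in (mu - A) (lambda - A).  Extremal
   choices of lambda and mu leave only two cases: A = lambda, or the eigenvalues
   are lambda and - lambda, both attained.

   Put X_lambda = phi - (1/2 - lambda) psi, so that d X_lambda = (lambda - A) d psi,
   <X_lambda, X_mu> = - (lambda + mu) and <phi, X_lambda> = - (1/2 + lambda).  If
   A = lambda, then X_lambda is constant and phi lies in an umbilical level set of
   <., X_lambda>.  Otherwise A^2 = lambda^2, which forces A to be parallel; then
   the span of X_lambda and its derivatives is a constant Lorentzian subspace, the
   span of X_(- lambda) and its derivatives is its orthogonal complement, and
   2 lambda phi = (1/2 + lambda) X_lambda - (1/2 - lambda) X_(- lambda) exhibits phi
   as a point of a product of a hyperbolic space and a sphere. *)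
From HB Require Import structures.
Require Import Defs.
From mathcomp Require Import all_boot all_order all_algebra.
From mathcomp Require Import all_classical all_reals all_analysis.
From mathcomp Require Import ring lra.
Set Implicit Arguments.
Unset Strict Implicit.
Unset Printing Implicit Defensive.
Import Order.TTheory GRing.Theory Num.Theory.
Import numFieldNormedType.Exports.
Local Open Scope classical_set_scope.
Local Open Scope ring_scope.


(** * Partial derivatives and smooth functions *)

(** No eigenvector fields are chosen in Cartan's comparison. Since the eigenvalues are constant,
    projectors onto the eigenspaces are polynomials in A with constant coefficients, smooth whatever
    the multiplicities, and their derivatives carry the first and second variations. For the largest
    and the smallest eigenvalue all coefficients of the quadratic form are nonpositive, for the two
    smallest distinct values they are nonnegative; together the two inequalities leave no room for a
    third value.

    Differentiation takes place inside one stereographic chart, and a vanishing derivative gives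
    constancy only near a point, whereas the domain is merely connected and may contain both poles.
    Global statements are therefore put as predicates on the sphere that are locally constant in
    each chart. In the product case this is why orthogonality to a fixed vector is followed rather
    than a basis of the span: it means first-order vanishing of a function on the sphere, which
    survives a change of chart.

    The dilation keeps 1/2 - a_i positive: this makes d phi injective and, in the product case, the
    radius of the spherical factor positive. *)

Section SmoothFunctions.
Variables (R : realType) (n : nat).
Implicit Types (U : set 'rV[R]_n) (f g : 'rV[R]_n -> R) (u : 'rV[R]_n).

Lemma near_eq_differentiable f g u :
  (\near u, f u = g u) -> differentiable f u -> differentiable g u.
Proof.
move=> fg df.
have fgu : f u = g u := nbhs_singleton fg.
have E : g \o shift u = cst (g u) + 'd f u +o_ (0 : 'rV[R]_n) id.
  apply/eqaddoP => _/posnumP[e].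
  have /eqaddoP/(_ e%:num (gt0 e)) := diff_locally df.
  have : \forall h \near (0 : 'rV[R]_n), f (h + u) = g (h + u).
    by have := fg; rewrite (near_shift 0) subr0; apply.
  move=> H1; apply: filterS2 H1 => h e1.
  rewrite -fgu (_ : (g \o _ - _) h = (f \o shift u - (cst (f u) + 'd f u)) h)//.
  by rewrite !fctE /= e1.
have dE : 'd g u = 'd f u :> (_ -> _).
  by apply: diff_unique (diff_continuous df) _; exact: E.
apply/(diff_locallyP u g); rewrite dE; split=> //; exact: diff_continuous.
Qed.

Lemma open_near U (P : 'rV[R]_n -> Prop) u :
  open U -> U u -> (forall w, U w -> P w) -> \near u, P u.
Proof. by move=> oU Uu H; near=> w; apply: H; near: w; exact: open_nbhs_nbhs.
Unshelve. all: by end_near. Qed.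

Lemma eq_partial_on U f g u i : open U -> U u -> (forall w, U w -> f w = g w) ->
  partial i f u = partial i g u.
Proof. by move=> oU Uu fg; apply: near_eq_derive; exact: open_near oU Uu _. Qed.

Lemma eq_Ck k U f g : open U -> (forall u, U u -> f u = g u) ->
  Ck k U f -> Ck k U g.
Proof.
move=> oU; elim: k f g => [|k IH] f g fg /=.
  move=> cf u Uu; have := cf u Uu; rewrite /prop_for /continuous_at fg// => H.
  exact: cvg_trans (near_eq_cvg (F := nbhs u) (open_near oU Uu fg)) H.
case=> df Cf; split=> [u Uu|i].
  by apply: near_eq_differentiable (df u Uu); exact: open_near oU Uu _.
apply: IH (Cf i) => u Uu; exact: eq_partial_on fg.
Qed.

Lemma CkS k U f : Ck k.+1 U f -> Ck k U f.
Proof.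
elim: k f => [|k IH] f [df Cf].
  by move=> u Uu; exact/differentiable_continuous/df.
by split=> // i; exact: IH.
Qed.

Lemma partial_cst (a : R) i u : partial i (fun=> a) u = 0.
Proof. exact: derive_cst. Qed.

Lemma partialD f g i u : differentiable f u -> differentiable g u ->
  partial i (fun w => f w + g w) u = partial i f u + partial i g u.
Proof. by move=> df dg; rewrite /partial (deriveD (f := f) (g := g))//; exact: diff_derivable. Qed.

Lemma partialN f i u : differentiable f u ->
  partial i (fun w => - f w) u = - partial i f u.
Proof. by move=> df; rewrite /partial (deriveN (f := f))//; exact: diff_derivable. Qed.

Lemma partialM f g i u : differentiable f u -> differentiable g u ->
  partial i (fun w => f w * g w) u = partial i f u * g u + f u * partial i g u.
Proof.
move=> df dg; rewrite /partial (deriveM (f := f) (g := g)); try exact: diff_derivable.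
by rewrite addrC /= /GRing.scale /= (mulrC (g u)).
Qed.

Lemma partial_coord j i u : partial i (fun w => w 0 j) u = (i == j)%:R.
Proof.
rewrite /partial deriveE; last exact: differentiable_coord.
have @f : {linear 'rV[R]_n -> R}.
  by exists (fun N : 'rV[R]_n => N 0 j); do 2![eexists]; do ?[constructor];
     rewrite ?mxE// => ? *; rewrite ?mxE//; move=> ?; rewrite !mxE.
rewrite (_ : (fun w : 'rV[R]_n => _) = f) // diff_lin; last exact: coord_continuous.
by rewrite /= mxE eqxx eq_sym.
Qed.

Lemma differentiable_sumf m (F : 'I_m -> 'rV[R]_n -> R) u :
  (forall i, differentiable (F i) u) ->
  differentiable (fun w => \sum_(i < m) F i w) u.
Proof.
move=> dF; rewrite (_ : (fun w => _) = \sum_(i < m) F i); last first.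
  by apply/funext => w; rewrite fct_sumE.
exact: differentiable_sum.
Qed.

Lemma partial_sum m (F : 'I_m -> 'rV[R]_n -> R) i u :
  (forall j, differentiable (F j) u) ->
  partial i (fun w => \sum_(j < m) F j w) u = \sum_(j < m) partial i (F j) u.
Proof.
move=> dF; rewrite /partial -derive_sum.
  by congr ('D_ _ _ _); apply/funext => w; rewrite fct_sumE.
by move=> j; exact: diff_derivable.
Qed.

Lemma differentiable_comp1 (h : R -> R) f u : differentiable f u ->
  derivable h (f u) 1 -> differentiable (fun w => h (f w)) u.
Proof.
move=> df dh; apply: (differentiable_comp (f := f) (g := h)) => //.
exact/derivable1_diffP.
Qed.

Lemma partial_comp1 (h : R -> R) f i u : differentiable f u ->
  derivable h (f u) 1 ->
  partial i (fun w => h (f w)) u = 'D_1 h (f u) * partial i f u.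
Proof.
move=> df dh; rewrite /partial [LHS]deriveE; last exact: differentiable_comp1.
move/derivable1_diffP: (dh) => dh'.
rewrite (@diff_comp _ _ _ _ f h u df dh') /= (deriveE _ df) [in RHS]deriveE//.
by rewrite -[X in 'd h (f u) X]mulr1 [LHS]linearZ mulrC.
Qed.

Lemma Ck_cst k U (a : R) : Ck k U (fun=> a).
Proof.
elim: k a => [|k IH] a /=; first by move=> u _; exact: cst_continuous.
split=> [u _|i]; first exact: differentiable_cst.
rewrite (_ : partial i _ = fun=> 0) //; apply/funext => u.
exact: partial_cst.
Qed.

Lemma Ck_coord k U j : Ck k U (fun w => w 0 j).
Proof.
case: k => [|k] /=; first by move=> u _; exact/differentiable_continuous/differentiable_coord.
split=> [u _|i]; first exact: differentiable_coord.
rewrite (_ : partial i _ = fun=> (i == j)%:R); first exact: Ck_cst.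
by apply/funext => u; exact: partial_coord.
Qed.

Lemma CkD k U f g : open U -> Ck k U f -> Ck k U g -> Ck k U (fun w => f w + g w).
Proof.
move=> oU; elim: k f g => [|k IH] f g /=.
  by move=> cf cg u Uu; exact: (cvgD (cf u Uu) (cg u Uu)).
case=> df Cf [dg Cg]; split=> [u Uu|i].
  by apply: differentiableD; [exact: df|exact: dg].
apply: eq_Ck (IH _ _ (Cf i) (Cg i)) => // u Uu.
by rewrite partialD; [|exact: df|exact: dg].
Qed.

Lemma CkM k U f g : open U -> Ck k U f -> Ck k U g -> Ck k U (fun w => f w * g w).
Proof.
move=> oU; elim: k f g => [|k IH] f g /=.
  by move=> cf cg u Uu; exact: (cvgM (cf u Uu) (cg u Uu)).
move=> Cf1 Cg1; have Cf0 := CkS Cf1; have Cg0 := CkS Cg1.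
move: Cf1 Cg1; case=> df Cf [dg Cg]; split=> [u Uu|i].
  by apply: differentiableM; [exact: df|exact: dg].
apply: eq_Ck (CkD oU (IH _ _ (Cf i) Cg0) (IH _ _ Cf0 (Cg i))) => // u Uu.
by rewrite partialM; [|exact: df|exact: dg].
Qed.

(** The hypothesis on [h'] lets the induction on the order close without a theory of smooth
    functions of one variable: for [expR] the derivative is the function itself, for the inverse it
    is a polynomial in it, and for [ln] it is the inverse, already known to be smooth. *)
Lemma Ck_comp1 k U f (h h' : R -> R) (Q : R -> R -> R): open U ->
  (forall u, U u -> derivable h (f u) 1 /\ 'D_1 h (f u) = h' (f u)) ->
  (forall k, Ck k U f -> Ck k U (fun w => h (f w)) -> Ck k U (fun w => h' (f w))) ->
  Ck k U f -> Ck k U (fun w => h (f w)).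
Proof.
move=> oU dh Ch'; elim: k => [|k IH] /=.
  move=> cf u Uu; apply: (continuous_comp (f := f) (g := h)); first exact: cf.
  by apply/differentiable_continuous/derivable1_diffP; case: (dh u Uu).
move=> Cf1; have Cf0 := CkS Cf1; case: Cf1 => df Cf.
split=> [u Uu|i].
  by apply: differentiable_comp1; [exact: df|case: (dh u Uu)].
apply: eq_Ck (CkM oU (Ch' k Cf0 (IH Cf0)) (Cf i)) => // u Uu.
by have [d1 <-] := dh u Uu; rewrite partial_comp1//; exact: df.
Qed.

End SmoothFunctions.

(** * Mean value theorem along lines, symmetry of second derivatives, vector chain rule *)

Section DirectionalDerivatives.
Variables (R : realType) (n : nat).
Implicit Types (U : set 'rV[R]_n) (f g : 'rV[R]_n -> R) (u v : 'rV[R]_n).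

Lemma derive_partial f u v : differentiable f u ->
  'D_v f u = \sum_i v 0 i * partial i f u.
Proof.
move=> df; rewrite deriveE// {1}(row_sum_delta v) linear_sum.
by apply: eq_bigr => i _; rewrite linearZ /partial deriveE.
Qed.

Lemma derive_translate f u v w :
  'D_v (fun x => f (x + w)) u = 'D_v f (u + w).
Proof.
rewrite /derive; suff -> : (fun x => f (x + w)) \o shift u = f \o shift (u + w) by [].
by apply/funext => h; rewrite /= addrA.
Qed.

Lemma is_derive_line f u v (a : R) : differentiable f (u + a *: v) ->
  is_derive a 1 (fun b : R => f (u + b *: v)) ('D_v f (u + a *: v)).
Proof.
pose l : R -> 'rV[R]_n := cst u + *:%R^~ v.
have dl : is_diff a l (0 + *:%R^~ v) by exact: is_diffD.
move=> df; have dl' : differentiable l a := @ex_diff _ _ _ _ _ _ _ dl.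
rewrite -[fun b : R => _]/(f \o l).
apply: DeriveDef; first by apply/derivable1_diffP/differentiable_comp.
rewrite deriveE; last exact: differentiable_comp.
rewrite (diff_comp dl') //= diff_val.
by rewrite fctE /= add0r scale1r deriveE.
Qed.

Lemma MVT_line f u v (s : R) : 0 < s ->
  (forall a, 0 <= a <= s -> differentiable f (u + a *: v)) ->
  exists2 a, 0 <= a <= s & f (u + s *: v) - f u = 'D_v f (u + a *: v) * s.
Proof.
move=> s0 df; have D a : 0 <= a <= s -> _ := fun h => is_derive_line (df a h).
have [||c] := @MVT R (fun a => f (u + a *: v)) (fun a => 'D_v f (u + a *: v)) 0 s s0.
- by move=> a; rewrite in_itv /= => /andP[a1 a2]; apply: D; rewrite !ltW.
- apply: derivable_within_continuous => a; rewrite in_itv /= => h.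
  by have [] := D a h.
rewrite in_itv /= => /andP[c1 c2]; rewrite scale0r addr0 subr0 => e.
by exists c => //; rewrite !ltW.
Qed.

Lemma near_ball u (P : 'rV[R]_n -> Prop) : (\near u, P u) ->
  exists2 e, 0 < e & forall w, `|w| < e -> P (u + w).
Proof.
move=> /nbhs_normP[e /= e0 H]; exists e => // w we; apply: H => /=.
by rewrite opprD addrA subrr add0r normrN.
Qed.


(** The mean value theorem applies on the segments of a ball inside [U]. The conclusion stays local;
    connectedness enters later, on the sphere. *)
Lemma locally_constant U f u : open U -> U u ->
  (forall w, U w -> differentiable f w /\ forall i, partial i f w = 0) ->
  \forall w \near u, f w = f u.
Proof.
move=> oU Uu H; have [e e0 He] := near_ball (open_nbhs_nbhs (conj oU Uu)).
apply/nbhs_normP; exists e => //= w; rewrite /= distrC => we.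
have [a /andP[a0 a1]] : exists2 a, 0 <= a <= 1 &
    f (u + 1 *: (w - u)) - f u = 'D_(w - u) f (u + a *: (w - u)) * 1.
  apply: MVT_line => // a /andP[a0 a1]; apply: (H _ _).1; apply: He.
  by rewrite normrZ ger0_norm// (le_lt_trans _ we)// ler_piMl.
have [d p0] : differentiable f (u + a *: (w - u)) /\
    forall i, partial i f (u + a *: (w - u)) = 0.
  apply: H; apply: He.
  by rewrite normrZ ger0_norm// (le_lt_trans _ we)// ler_piMl.
rewrite derive_partial// big1 ?mul0r => [|i _]; last by rewrite p0 mulr0.
by rewrite scale1r addrCA subrr addr0 => /eqP; rewrite subr_eq0 => /eqP.
Qed.

(* Schwarz: the second difference of f along both directions equals s^2 times
   either mixed derivative at some point of the box. *)
Lemma second_difference f u (i j : 'I_n) (s : R) : 0 < s ->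
  (forall a b, 0 <= a <= s -> 0 <= b <= s ->
    differentiable f (u + a *: 'e_i + b *: 'e_j) /\
    differentiable (partial i f) (u + a *: 'e_i + b *: 'e_j)) ->
  exists a b, [/\ 0 <= a <= s, 0 <= b <= s &
   f (u + s *: 'e_i + s *: 'e_j) - f (u + s *: 'e_i) - f (u + s *: 'e_j) + f u =
   partial j (partial i f) (u + a *: 'e_i + b *: 'e_j) * s * s].
Proof.
move=> s0 H; have ss : 0 <= s <= s by rewrite lexx ltW.
have zs : 0 <= (0 : R) <= s by rewrite lexx ltW.
pose g w := f (w + s *: 'e_j) - f w.
have dsh w : differentiable f (w + s *: 'e_j) ->
    differentiable (fun w => f (w + s *: 'e_j)) w.
  move=> df; apply: (differentiable_comp (f := fun w => w + s *: 'e_j) (g := f)) => //.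
have dg a : 0 <= a <= s -> differentiable g (u + a *: 'e_i).
  move=> ha; apply: differentiableB; first by apply: dsh; case: (H a s ha ss).
  by have [+ _] := H a 0 ha zs; rewrite scale0r addr0.
have [a ha ea] := MVT_line s0 dg.
have [b hb eb] : exists2 b, 0 <= b <= s &
    partial i f (u + a *: 'e_i + s *: 'e_j) - partial i f (u + a *: 'e_i)
    = 'D_('e_j) (partial i f) (u + a *: 'e_i + b *: 'e_j) * s.
  by apply: MVT_line => // b hb; case: (H a b ha hb).
exists a, b; split=> //.
rewrite /partial -/(partial i f) -eb.
transitivity (g (u + s *: 'e_i) - g u); first by rewrite /g; ring.
rewrite ea; congr (_ * _); rewrite -[LHS]/(partial i g _) partialD; first last.
- apply: differentiableN; have [+ _] := H a 0 ha zs; by rewrite scale0r addr0.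
- by apply: dsh; case: (H a s ha ss).
rewrite partialN; last by have [+ _] := H a 0 ha zs; rewrite scale0r addr0.
congr (_ - _); rewrite /partial.
exact: (derive_translate f).
Qed.

(** The second difference is symmetric in the two directions, so the two mixed derivatives take a
    common value at two points of an arbitrarily small box; their continuity at [u], obtained from
    differentiability, concludes. *)
Lemma partialC U f i j u : open U -> U u -> Ck 3 U f ->
  partial i (partial j f) u = partial j (partial i f) u.
Proof.
move=> oU Uu [df Cf].
have dp k w : U w -> differentiable (partial k f) w by case: (Cf k) => d _; exact: d.
have cp k l : {for u, continuous (partial k (partial l f))}.
  by case: (Cf l) => _ /(_ k)[d _]; exact/differentiable_continuous/d.
apply/eqP; rewrite -subr_eq0 -normr_le0; apply/ler_addgt0Pr => e e0.
rewrite add0r.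
have e2 : 0 < e / 2 by rewrite divr_gt0.
have /cvgrPdist_lt/(_ _ e2) N1 := cp i j.
have /cvgrPdist_lt/(_ _ e2) N2 := cp j i.
have [r r0 Hr] := near_ball (filterI (filterI N1 N2) (open_nbhs_nbhs (conj oU Uu))).
(* The side [s] satisfies [s * K = r / 2], so the whole box lies in the ball of radius [r]; the
   summand 1 makes [K] visibly positive. *)
pose K := `|'e_i : 'rV[R]_n| + `|'e_j : 'rV[R]_n| + 1.
have K0 : 0 < K by rewrite ltr_wpDl// addr_ge0.
pose s := r / (2 * K).
have s0 : 0 < s by rewrite divr_gt0// mulr_gt0.
have box a b k l : (k, l) = (i, j) \/ (k, l) = (j, i) ->
    0 <= a <= s -> 0 <= b <= s -> `|a *: 'e_k + b *: 'e_l : 'rV[R]_n| < r.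
  move=> kl /andP[a0 a1] /andP[b0 b1].
  rewrite (le_lt_trans (ler_normD _ _))// !normrZ !ger0_norm//.
  have : s * K < r.
    rewrite /s -[X in _ < X]mulr1 -mulrA ltr_pM2l// invfM -mulrA mulVf ?gt_eqF//.
    by rewrite mulr1 invf_lt1// ltr1n.
  apply: le_lt_trans.
  have : a * `|'e_k : 'rV[R]_n| + b * `|'e_l : 'rV[R]_n| <=
      s * `|'e_k : 'rV[R]_n| + s * `|'e_l : 'rV[R]_n|.
    by rewrite lerD// ler_wpM2r.
  move/le_trans; apply; rewrite -mulrDr; apply: ler_wpM2l; first exact: ltW.
  by case: kl => -[-> ->]; last rewrite [X in X <= _]addrC; rewrite /K lerDl.
have box' k l : (k, l) = (i, j) \/ (k, l) = (j, i) ->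
  forall a b, 0 <= a <= s -> 0 <= b <= s ->
    differentiable f (u + a *: 'e_k + b *: 'e_l) /\
    differentiable (partial k f) (u + a *: 'e_k + b *: 'e_l).
  move=> kl a b ha hb.
  have [_ Ub] := Hr _ (box a b k l kl ha hb).
  by rewrite addrA in Ub; split; [exact: df|exact: dp].
have [a [b [ha hb e1]]] := second_difference s0 (box' i j (or_introl erefl)).
have [c [d [hc hd e3]]] := second_difference s0 (box' j i (or_intror erefl)).
have E : partial j (partial i f) (u + a *: 'e_i + b *: 'e_j) =
         partial i (partial j f) (u + c *: 'e_j + d *: 'e_i).
  have ss0 : s * s != 0 by rewrite mulf_neq0// gt_eqF.
  move: e1 e3; set X := partial j _ _; set Y := partial i (partial j f) _.
  move: X Y => X Y; rewrite [u + s *: 'e_j + _]addrAC => e1 e3.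
  apply: (mulIf ss0); rewrite [LHS]mulrA [RHS]mulrA -[LHS]e1 -[RHS]e3.
  by ring.
have [[_ h2] _] := Hr _ (box a b i j (or_introl erefl) ha hb).
have [[h1 _] _] := Hr _ (box c d j i (or_intror erefl) hc hd).
rewrite addrA -E in h1; rewrite addrA in h2.
move: h1 h2; set x := partial j _ (_ + _ + _).
move: x (partial i (partial j f) u) (partial j (partial i f) u) => x y z h1 h2.
have h3 : `|y - z| <= `|y - x| + `|x - z| := ler_distD x y z.
apply: (le_trans h3); rewrite (splitr e) [X in _ + X]distrC; apply: lerD; exact: ltW.
Qed.

End DirectionalDerivatives.

Section VectorChainRule.
Variables (R : realType) (m n : nat).

Lemma differentiable_rV (tau : 'rV[R]_n -> 'rV[R]_m) u :
  (forall j, differentiable (fun w => tau w 0 j) u) -> differentiable tau u.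
Proof.
move=> dt; rewrite (_ : tau = \sum_(j < m) (fun w => tau w 0 j *: 'e_j)).
  by apply: differentiable_sum => j; exact: differentiableZl.
by apply/funext => w; rewrite fct_sumE -row_sum_delta.
Qed.

Lemma partial_comp (tau : 'rV[R]_n -> 'rV[R]_m) (f : 'rV[R]_m -> R) i u :
  (forall j, differentiable (fun w => tau w 0 j) u) ->
  differentiable f (tau u) ->
  partial i (fun w => f (tau w)) u =
  \sum_j partial i (fun w => tau w 0 j) u * partial j f (tau u).
Proof.
move=> dt df; have dtau := differentiable_rV dt.
rewrite /partial deriveE; last exact: differentiable_comp.
rewrite (diff_comp (f := tau)) //= -deriveE// derive_partial//.
have -> : 'd tau u 'e_i = 'D_('e_i) tau u by rewrite deriveE.
rewrite derive_mx; last exact: diff_derivable.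
by apply: eq_bigr => j _; rewrite mxE.
Qed.

End VectorChainRule.

(* [pd] and [dmx] are sealed because conversion tests between distinct
   derivatives would otherwise unfold the underlying limits. *)
HB.lock Definition pd (R : realType) n (i : 'I_n) (f : 'rV[R]_n -> R) u :=
  partial i f u.

Section SealedPartial.
Variables (R : realType) (n : nat).
Implicit Types (U : set 'rV[R]_n) (f g : 'rV[R]_n -> R) (u : 'rV[R]_n).

Lemma partialE : @partial R n = @pd R n.
Proof. by apply/funext => i; apply/funext => f; apply/funext => u; rewrite pd.unlock. Qed.

Lemma eq_pd f g i u : f =1 g -> pd i f u = pd i g u.
Proof. by move/funext => ->. Qed.

Lemma eq_pd_on U f g u i : open U -> U u -> (forall w, U w -> f w = g w) ->
  pd i f u = pd i g u.
Proof. by move=> oU Uu fg; rewrite -partialE; exact: eq_partial_on fg. Qed.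

Lemma pd_cst (a : R) i u : pd i (fun=> a) u = 0.
Proof. by rewrite -partialE; exact: partial_cst. Qed.

Lemma pd_coord j i u : pd i (fun w => w 0 j) u = (i == j)%:R.
Proof. by rewrite -partialE; exact: partial_coord. Qed.

Lemma pdD f g i u : differentiable f u -> differentiable g u ->
  pd i (fun w => f w + g w) u = pd i f u + pd i g u.
Proof. by rewrite -partialE; exact: partialD. Qed.

Lemma pdN f i u : differentiable f u ->
  pd i (fun w => - f w) u = - pd i f u.
Proof. by rewrite -partialE; exact: partialN. Qed.

Lemma pdM f g i u : differentiable f u -> differentiable g u ->
  pd i (fun w => f w * g w) u = pd i f u * g u + f u * pd i g u.
Proof. by rewrite -partialE; exact: partialM. Qed.

Lemma pd_sum m (F : 'I_m -> 'rV[R]_n -> R) i u :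
  (forall j, differentiable (F j) u) ->
  pd i (fun w => \sum_(j < m) F j w) u = \sum_(j < m) pd i (F j) u.
Proof. by rewrite -partialE; exact: partial_sum. Qed.

Lemma pd_expR f i u : differentiable f u ->
  pd i (fun w => expR (f w)) u = expR (f u) * pd i f u.
Proof.
move=> df; have [d1 d2] := is_derive_expR (f u).
by rewrite -partialE (partial_comp1 (h := expR) _ df)// d2.
Qed.

Lemma pd_ln f i u : differentiable f u -> 0 < f u ->
  pd i (fun w => ln (f w)) u = (f u)^-1 * pd i f u.
Proof.
move=> df f0; have [d1 d2] := is_derive1_ln f0.
by rewrite -partialE (partial_comp1 (h := ln (R:=R)) _ df)// d2.
Qed.

End SealedPartial.

Lemma pd_comp (R : realType) m n (tau : 'rV[R]_n -> 'rV[R]_m)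
    (f : 'rV[R]_m -> R) i u :
  (forall j, differentiable (fun w => tau w 0 j) u) ->
  differentiable f (tau u) ->
  pd i (fun w => f (tau w)) u =
  \sum_j pd i (fun w => tau w 0 j) u * pd j f (tau u).
Proof. by rewrite -!partialE; exact: partial_comp. Qed.

Section SmoothOn.
Variables (R : realType) (n : nat) (U : set 'rV[R]_n).
Hypothesis oU : open U.
Implicit Types (f g : 'rV[R]_n -> R) (u : 'rV[R]_n).

Lemma smooth_diff f u : U u -> smooth_on U f -> differentiable f u.
Proof. by move=> Uu /(_ 1%N)[+ _]; exact. Qed.

Lemma smooth_pd f i : smooth_on U f -> smooth_on U (pd i f).
Proof. by rewrite -partialE; move=> sf k; have [_] := sf k.+1; apply. Qed.

Lemma eq_smooth f g : (forall u, U u -> f u = g u) ->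
  smooth_on U f -> smooth_on U g.
Proof. by move=> fg sf k; exact: eq_Ck (sf k). Qed.

Lemma smooth_cst (a : R) : smooth_on U (fun=> a).
Proof. by move=> k; exact: Ck_cst. Qed.

Lemma smooth_coord j : smooth_on U (fun w => w 0 j).
Proof. by move=> k; exact: Ck_coord. Qed.

Lemma smoothD f g : smooth_on U f -> smooth_on U g ->
  smooth_on U (fun w => f w + g w).
Proof. by move=> sf sg k; exact: CkD. Qed.

Lemma smoothM f g : smooth_on U f -> smooth_on U g ->
  smooth_on U (fun w => f w * g w).
Proof. by move=> sf sg k; exact: CkM. Qed.

Lemma smoothN f : smooth_on U f -> smooth_on U (fun w => - f w).
Proof.
move=> sf; apply: eq_smooth (smoothM (smooth_cst (-1)) sf) => u _.
by rewrite mulN1r.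
Qed.

Lemma smoothB f g : smooth_on U f -> smooth_on U g ->
  smooth_on U (fun w => f w - g w).
Proof. by move=> sf sg; apply: smoothD => //; exact: smoothN. Qed.

Lemma smooth_sum (I : Type) (r : seq I) (P : pred I) (F : I -> 'rV[R]_n -> R) :
  (forall i, smooth_on U (F i)) ->
  smooth_on U (fun w => \sum_(i <- r | P i) F i w).
Proof.
move=> sF; elim: r => [|i r IH].
  by apply: eq_smooth (smooth_cst 0) => u _; rewrite big_nil.
case Pi : (P i); last by apply: eq_smooth IH => u _; rewrite big_cons Pi.
by apply: eq_smooth (smoothD (sF i) IH) => u _; rewrite big_cons Pi.
Qed.

Lemma smooth_expR f : smooth_on U f -> smooth_on U (fun w => expR (f w)).
Proof.
move=> sf k; apply: (Ck_comp1 (h' := expR)) (sf k) => // u Uu.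
by have [d1 d2] := is_derive_expR (f u).
Qed.

Lemma smoothV f : (forall u, U u -> f u != 0) -> smooth_on U f ->
  smooth_on U (fun w => (f w)^-1).
Proof.
move=> f0 sf k.
apply: (Ck_comp1 (h := GRing.inv) (h' := fun x => -1 * (x^-1 * x^-1))) (sf k) => //.
  move=> u Uu; split; first exact: derivableV (f0 u Uu) (@derivable_id _ _ _ _).
  rewrite (deriveV (f := id)) //; last exact: f0.
  by rewrite derive_id /= /GRing.scale /= mulr1 mulN1r -invfM -expr2.
move=> l _ Ci; apply: CkM => //; last exact: CkM.
exact: Ck_cst.
Qed.

Lemma smooth_ln f : (forall u, U u -> 0 < f u) -> smooth_on U f ->
  smooth_on U (fun w => ln (f w)).
Proof.
move=> f0 sf k.
apply: (Ck_comp1 (h := ln (R := R)) (h' := GRing.inv)) (sf k) => //.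
  by move=> u Uu; have [d1 d2] := is_derive1_ln (f0 u Uu).
move=> l _ _; apply: smoothV => // u Uu; rewrite gt_eqF//; exact: f0.
Qed.

Lemma smooth_pdC f i j u : U u -> smooth_on U f ->
  pd i (pd j f) u = pd j (pd i f) u.
Proof. rewrite -partialE; move=> Uu sf; exact: (partialC _ _ _ _ (sf 3%N)). Qed.

Definition smooth_mx p q (F : 'rV[R]_n -> 'M[R]_(p, q)) :=
  forall i j, smooth_on U (fun u => F u i j).

End SmoothOn.

(** * Derivatives of matrix-valued fields *)

HB.lock Definition dmx (R : realType) n p q (k : 'I_n)
    (F : 'rV[R]_n -> 'M[R]_(p, q)) u : 'M[R]_(p, q) :=
  \matrix_(a, b) pd k (fun w => F w a b) u.

Section MatrixFields.
Variables (R : realType) (n : nat).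

Lemma dmxE p q k (F : 'rV[R]_n -> 'M[R]_(p, q)) u a b :
  dmx k F u a b = pd k (fun w => F w a b) u.
Proof. by rewrite dmx.unlock mxE. Qed.

Lemma row_jac m (F : 'rV[R]_n -> 'rV[R]_m) k u : row k (jac F u) = dmx k F u.
Proof. by apply/rowP => j; rewrite !(mxE, dmxE) partialE; apply: eq_pd => w; rewrite ?ord1. Qed.

Variable U : set 'rV[R]_n.
Hypothesis oU : open U.
Implicit Type u : 'rV[R]_n.

Lemma eq_smooth_mx p q (F G : 'rV[R]_n -> 'M[R]_(p, q)) :
  (forall u, U u -> F u = G u) -> smooth_mx U F -> smooth_mx U G.
Proof. by move=> FG sF i j; apply: eq_smooth (sF i j) => // u Uu; rewrite FG. Qed.

Lemma eq_dmx p q (F G : 'rV[R]_n -> 'M[R]_(p, q)) k u : U u ->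
  (forall u, U u -> F u = G u) -> dmx k F u = dmx k G u.
Proof.
by move=> Uu FG; apply/matrixP => a b; rewrite !(mxE, dmxE);
  apply: (eq_pd_on _ oU Uu) => w Uw; rewrite FG.
Qed.

Lemma smooth_dmx p q k (F : 'rV[R]_n -> 'M[R]_(p, q)) :
  smooth_mx U F -> smooth_mx U (dmx k F).
Proof.
move=> sF i j; apply: eq_smooth (smooth_pd k (sF i j)) => // u _.
by rewrite dmxE.
Qed.

Lemma smooth_mx_cst p q (M : 'M[R]_(p, q)) : smooth_mx U (fun=> M).
Proof. by move=> i j; exact: smooth_cst. Qed.

Lemma smooth_mxD p q (F G : 'rV[R]_n -> 'M[R]_(p, q)) :
  smooth_mx U F -> smooth_mx U G -> smooth_mx U (fun w => F w + G w).
Proof.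
by move=> sF sG i j; apply: eq_smooth (smoothD oU (sF i j) (sG i j)) => // u _; rewrite mxE.
Qed.

Lemma smooth_mxN p q (F : 'rV[R]_n -> 'M[R]_(p, q)) :
  smooth_mx U F -> smooth_mx U (fun w => - F w).
Proof.
by move=> sF i j; apply: eq_smooth (smoothN oU (sF i j)) => // u _; rewrite mxE.
Qed.

Lemma smooth_mxB p q (F G : 'rV[R]_n -> 'M[R]_(p, q)) :
  smooth_mx U F -> smooth_mx U G -> smooth_mx U (fun w => F w - G w).
Proof. by move=> sF sG; apply: smooth_mxD => //; exact: smooth_mxN. Qed.

Lemma smooth_mxM p q r (F : 'rV[R]_n -> 'M[R]_(p, q)) (G : 'rV[R]_n -> 'M[R]_(q, r)) :
  smooth_mx U F -> smooth_mx U G -> smooth_mx U (fun w => F w *m G w).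
Proof.
move=> sF sG i j; apply: (eq_smooth oU (f := fun w => \sum_k F w i k * G w k j)).
  by move=> u _; rewrite mxE.
by apply: smooth_sum => // k; exact: smoothM.
Qed.

Lemma smooth_mxZ p q (f : 'rV[R]_n -> R) (F : 'rV[R]_n -> 'M[R]_(p, q)) :
  smooth_on U f -> smooth_mx U F -> smooth_mx U (fun w => f w *: F w).
Proof.
by move=> sf sF i j; apply: eq_smooth (smoothM oU sf (sF i j)) => // u _; rewrite mxE.
Qed.

Lemma smooth_mx_tr p q (F : 'rV[R]_n -> 'M[R]_(p, q)) :
  smooth_mx U F -> smooth_mx U (fun w => (F w)^T).
Proof. by move=> sF i j; apply: eq_smooth (sF j i) => // u _; rewrite mxE. Qed.

Lemma smooth_mx_scalar p (f : 'rV[R]_n -> R) :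
  smooth_on U f -> smooth_mx U (fun w => (f w)%:M : 'M[R]_p).
Proof.
move=> sf i j; apply: eq_smooth (smoothM oU sf (smooth_cst _ (i == j)%:R)) => // u _.
by rewrite mxE mulr_natr.
Qed.

Lemma dmx_cst p q k (M : 'M[R]_(p, q)) u : dmx k (fun=> M) u = 0.
Proof. by apply/matrixP => a b; rewrite !(mxE, dmxE) pd_cst. Qed.

Lemma dmxD p q k (F G : 'rV[R]_n -> 'M[R]_(p, q)) u : U u ->
  smooth_mx U F -> smooth_mx U G ->
  dmx k (fun w => F w + G w) u = dmx k F u + dmx k G u.
Proof.
move=> Uu sF sG; apply/matrixP => a b; rewrite !(mxE, dmxE) -pdD; first last.
- exact: smooth_diff (sG a b).
- exact: smooth_diff (sF a b).
by apply: eq_pd => w; rewrite mxE.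
Qed.

Lemma dmxN p q k (F : 'rV[R]_n -> 'M[R]_(p, q)) u : U u ->
  smooth_mx U F -> dmx k (fun w => - F w) u = - dmx k F u.
Proof.
move=> Uu sF; apply/matrixP => a b; rewrite !(mxE, dmxE) -pdN; last exact: smooth_diff (sF a b).
by apply: eq_pd => w; rewrite mxE.
Qed.

Lemma dmxM p q r k (F : 'rV[R]_n -> 'M[R]_(p, q)) (G : 'rV[R]_n -> 'M[R]_(q, r)) u :
  U u -> smooth_mx U F -> smooth_mx U G ->
  dmx k (fun w => F w *m G w) u = dmx k F u *m G u + F u *m dmx k G u.
Proof.
move=> Uu sF sG; apply/matrixP => a b; rewrite !(mxE, dmxE) -big_split /=.
rewrite (_ : (fun w => _) = fun w => \sum_j F w a j * G w j b); last first.
  by apply/funext => w; rewrite mxE.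
rewrite pd_sum => [|j]; last first.
  by apply: differentiableM; [exact: smooth_diff (sF _ _)|exact: smooth_diff (sG _ _)].
apply: eq_bigr => j _; rewrite !(mxE, dmxE) pdM//.
  exact: smooth_diff (sF _ _).
exact: smooth_diff (sG _ _).
Qed.

Lemma dmxZ p q k (f : 'rV[R]_n -> R) (F : 'rV[R]_n -> 'M[R]_(p, q)) u : U u ->
  smooth_on U f -> smooth_mx U F ->
  dmx k (fun w => f w *: F w) u = pd k f u *: F u + f u *: dmx k F u.
Proof.
move=> Uu sf sF; apply/matrixP => a b; rewrite !(mxE, dmxE) -pdM; first last.
- exact: smooth_diff (sF a b).
- exact: smooth_diff sf.
by apply: eq_pd => w; rewrite mxE.
Qed.

Lemma dmx_tr p q k (F : 'rV[R]_n -> 'M[R]_(p, q)) u :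
  dmx k (fun w => (F w)^T) u = (dmx k F u)^T.
Proof.
apply/matrixP => a b; rewrite !(mxE, dmxE).
by apply: eq_pd => w; rewrite mxE.
Qed.

Lemma dmx_scalar p k (f : 'rV[R]_n -> R) u : U u -> smooth_on U f ->
  dmx k (fun w => (f w)%:M : 'M[R]_p) u = (pd k f u)%:M.
Proof.
move=> Uu sf; rewrite (_ : (fun w => _) = fun w => f w *: (1%:M : 'M[R]_p)); last first.
  by apply/funext => w; rewrite scale_scalar_mx mulr1.
rewrite dmxZ//; last exact: smooth_mx_cst.
by rewrite dmx_cst scaler0 addr0 scale_scalar_mx mulr1.
Qed.

Lemma dmxC p q k l (F : 'rV[R]_n -> 'M[R]_(p, q)) u : U u -> smooth_mx U F ->
  dmx k (dmx l F) u = dmx l (dmx k F) u.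
Proof.
move=> Uu sF; apply/matrixP => a b.
have E i j : dmx i (dmx j F) u a b = pd i (pd j (fun w => F w a b)) u.
  by rewrite dmxE; apply: eq_pd => w; rewrite dmxE.
rewrite (E k l) (E l k); exact: (smooth_pdC oU k l Uu (sF a b)).
Qed.

End MatrixFields.

(** * Conformally flat metrics *)

Definition grad_at (R : realType) n (sigma : 'rV[R]_n -> R) u : 'rV[R]_n :=
  \row_i pd i sigma u.

Definition hess_at (R : realType) n (sigma : 'rV[R]_n -> R) u : 'M[R]_n :=
  \matrix_(i, j) pd i (pd j sigma) u.

(* The Schouten tensor of the metric e^(2 sigma) times the flat one. *)
HB.lock Definition flat_schouten (R : realType) n (sigma : 'rV[R]_n -> R) u : 'M[R]_n :=
  (grad_at sigma u)^T *m grad_at sigma u - hess_at sigma u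
  - (dotv (grad_at sigma u) (grad_at sigma u) / 2)%:M.

Definition flat_schouten_op (R : realType) n (sigma : 'rV[R]_n -> R) u : 'M[R]_n :=
  expR (- (2 * sigma u)) *: flat_schouten sigma u.

Lemma flat_schoutenE (R : realType) n (sigma : 'rV[R]_n -> R) :
  flat_schouten sigma = fun u => (grad_at sigma u)^T *m grad_at sigma u
    - hess_at sigma u - (dotv (grad_at sigma u) (grad_at sigma u) / 2)%:M.
Proof. by apply/funext => u; rewrite flat_schouten.unlock. Qed.

Section ConformallyFlat.
Variables (R : realType) (n : nat) (U : set 'rV[R]_n) (sigma : 'rV[R]_n -> R).
Hypothesis oU : open U.
Hypothesis ssig : smooth_on U sigma.
Implicit Types u : 'rV[R]_n.

Let G := fun u : 'rV[R]_n => (expR (2 * sigma u))%:M : 'M[R]_n.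


Lemma smooth_grad : smooth_mx U (grad_at sigma).
Proof.
move=> i j; apply: eq_smooth (smooth_pd j ssig) => // u _.
by rewrite mxE.
Qed.

Lemma smooth_hess : smooth_mx U (hess_at sigma).
Proof.
move=> i j; apply: eq_smooth (smooth_pd i (smooth_pd j ssig)) => // u _.
by rewrite mxE.
Qed.

Lemma smooth_dotv m (p q : 'rV[R]_n -> 'rV[R]_m) :
  smooth_mx U p -> smooth_mx U q -> smooth_on U (fun u => dotv (p u) (q u)).
Proof. by move=> sp sq; apply: smooth_sum => // j; exact: smoothM. Qed.

Lemma hessC u i j : U u -> hess_at sigma u i j = hess_at sigma u j i.
Proof. by move=> Uu; rewrite !mxE; exact: (smooth_pdC oU). Qed.

Lemma flat_schouten_sym u : U u -> (flat_schouten sigma u)^T = flat_schouten sigma u.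
Proof.
move=> Uu; rewrite flat_schoutenE.
apply/matrixP => i j; rewrite !mxE (eq_sym j) (smooth_pdC oU j i Uu ssig).
by congr (_ - _ - _); apply: eq_bigr => k _; rewrite !mxE mulrC.
Qed.

Lemma smooth_flat_schouten : smooth_mx U (flat_schouten sigma).
Proof.
rewrite flat_schoutenE; apply: smooth_mxB => //; last first.
  apply: smooth_mx_scalar => //; apply: smoothM => //; last exact: smooth_cst.
  by apply: smooth_dotv; exact: smooth_grad.
apply: smooth_mxB => //; last exact: smooth_hess.
apply: smooth_mxM => //; last exact: smooth_grad.
by apply: smooth_mx_tr => //; exact: smooth_grad.
Qed.

Lemma smooth_flat_schouten_op : smooth_mx U (flat_schouten_op sigma).
Proof.
apply: smooth_mxZ => //; last exact: smooth_flat_schouten.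
apply: smooth_expR => //; apply: smoothN => //; apply: smoothM => //.
exact: smooth_cst.
Qed.

Let s u i := pd i sigma u.

Lemma sum_delta (I : finType) (a : I) (f : I -> R) :
  \sum_l (a == l)%:R * f l = f a.
Proof.
rewrite (bigD1 a) //= eqxx mul1r big1 ?addr0 // => l la.
by rewrite eq_sym (negbTE la) mul0r.
Qed.

Lemma pd_conf_metric u i j k : U u ->
  pd i (fun w => G w j k) u = (j == k)%:R * (2 * expR (2 * sigma u) * s u i).
Proof.
move=> Uu; have ds := smooth_diff Uu ssig.
rewrite (@eq_pd _ _ _ (fun w => (j == k)%:R * expR (2 * sigma w))); last first.
  by move=> w; rewrite /G mxE -[LHS]mulr_natr mulrC.
have d2 : differentiable (fun w => 2 * sigma w) u.
  by apply: differentiableM; [exact: differentiable_cst|exact: ds].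
rewrite (pdM (f := fun=> (j == k)%:R)) ?pd_cst ?mul0r ?add0r; first last.
- exact: (differentiable_comp1 (h := expR) d2 (@derivable_expR _ _)).
- exact: differentiable_cst.
rewrite pd_expR// (pdM (f := fun=> 2)); [|exact: differentiable_cst|exact: ds].
by rewrite pd_cst /s; ring.
Qed.

Lemma invmx_scalar m (a : R) : a != 0 -> invmx (a%:M : 'M[R]_m) = (a^-1)%:M.
Proof.
move=> a0; have ua : (a%:M : 'M[R]_m) \in unitmx.
  by rewrite unitmxE det_scalar unitrX// unitfE.
apply: (can_inj (mulKmx ua)); rewrite mulmxV//.
by rewrite -scalar_mxM mulfV.
Qed.

Lemma christoffel_conf u k i j : U u ->
  christoffel G k i j u =
  (k == j)%:R * s u i + (k == i)%:R * s u j - (i == j)%:R * s u k.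
Proof.
move=> Uu; have E0 : expR (2 * sigma u) != 0 by rewrite gt_eqF ?expR_gt0.
rewrite /christoffel !partialE (invmx_scalar _ E0).
rewrite (eq_bigr (fun l => (k == l)%:R * ((expR (2 * sigma u))^-1 *
    (pd i (fun w => G w j l) u + pd j (fun w => G w i l) u
     - pd l (fun w => G w i j) u)))); last first.
  by move=> l _; rewrite mxE mulrA; congr (_ * _); rewrite -[LHS]mulr_natr mulrC.
rewrite sum_delta !pd_conf_metric// (eq_sym j k) (eq_sym i k).
move: E0; move: (expR _) => e e0; field.
exact: e0.
Qed.

Lemma pd_christoffel_conf u l i j k : U u ->
  pd i (christoffel G l j k) u =
  (l == k)%:R * hess_at sigma u i j + (l == j)%:R * hess_at sigma u i k
  - (j == k)%:R * hess_at sigma u i l.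
Proof.
move=> Uu; have dp m : differentiable (pd m sigma) u.
  exact: smooth_diff Uu (smooth_pd m ssig).
have dc (b : bool) m : differentiable (fun w => b%:R * pd m sigma w) u.
  by apply: differentiableM; [exact: differentiable_cst|exact: dp].
have pc (b : bool) m : pd i (fun w => b%:R * pd m sigma w) u
    = b%:R * pd i (pd m sigma) u.
  rewrite (pdM (f := fun=> b%:R)); [|exact: differentiable_cst|exact: dp].
  by rewrite pd_cst mul0r add0r.
rewrite (eq_pd_on i oU Uu (fun w Uw => @christoffel_conf w l j k Uw)) /s.
have dcN : differentiable (fun w => - ((j == k)%:R * pd l sigma w)) u.
  exact: differentiableN.
rewrite (pdD (f := fun w => (l == k)%:R * pd j sigma w + (l == j)%:R * pd k sigma w) _ _ dcN).
  by rewrite pdD// pdN// !pc !mxE.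
by apply: differentiableD; [exact: dc|exact: dc].
Qed.

Let ns u := dotv (grad_at sigma u) (grad_at sigma u).

Lemma christoffel_contract u l i (X : 'I_n -> R) : U u ->
  \sum_m christoffel G l i m u * X m =
  X l * s u i + (l == i)%:R * (\sum_m s u m * X m) - s u l * X i.
Proof.
move=> Uu; under eq_bigr => m _.
  rewrite christoffel_conf// mulrBl mulrDl -!mulrA.
  over.
rewrite sumrB big_split /= !sum_delta -mulr_sumr mulrC.
by congr (_ * _ + _ - _ * _).
Qed.

Lemma ricci_conf u j k : U u ->
  ricci G u j k = - (n%:R - 2) * hess_at sigma u j k + (n%:R - 2) * s u j * s u k
    - (j == k)%:R * (\tr (hess_at sigma u) + (n%:R - 2) * ns u).
Proof.
move=> Uu.
have sX l i : \sum_m s u m * christoffel G m l i u =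
    2 * s u l * s u i - (l == i)%:R * ns u.
  under eq_bigr => m _.
    rewrite christoffel_conf// (_ : s u m * _ =
      (i == m)%:R * (s u m * s u l) + (l == m)%:R * (s u m * s u i)
      - (l == i)%:R * (s u m * s u m)); last first.
      by rewrite (eq_sym m i) (eq_sym m l); ring.
    over.
  rewrite sumrB big_split /= !sum_delta -mulr_sumr.
  rewrite (_ : ns u = \sum_i s u i * s u i); first by ring.
  by apply: eq_bigr => m _; rewrite !mxE.
have nE : ns u = \sum_i s u i * s u i.
  by apply: eq_bigr => m _; rewrite !mxE.
(* [S1] to [S4] are the four sums of the contracted curvature: divergence of the Christoffel
   symbols, derivative of their trace, and the two quadratic terms. All index sums collapse through
   Kronecker deltas. *)
have S1 : \sum_l pd l (christoffel G l j k) u =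
    2 * hess_at sigma u j k - (j == k)%:R * \tr (hess_at sigma u).
  under eq_bigr => l _.
    rewrite pd_christoffel_conf// (eq_sym l k) (eq_sym l j).
    over.
  rewrite sumrB big_split /= !sum_delta -mulr_sumr (hessC k)//.
  by congr (_ - _); ring.
have S2 : \sum_l pd j (christoffel G l l k) u = n%:R * hess_at sigma u j k.
  under eq_bigr => l _.
    rewrite pd_christoffel_conf// eqxx mul1r addrAC subrr add0r.
    over.
  by rewrite sumr_const card_ord -[LHS]mulr_natl.
have S3 : \sum_l \sum_m christoffel G l l m u * christoffel G m j k u =
    n%:R * (2 * s u j * s u k - (j == k)%:R * ns u).
  under eq_bigr => l _.
    rewrite christoffel_contract// eqxx mul1r sX mulrC addrAC subrr add0r.
    over.
  by rewrite sumr_const card_ord -[LHS]mulr_natl.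
have S4 : \sum_l \sum_m christoffel G l j m u * christoffel G m l k u =
    (n%:R + 2) * s u j * s u k - 2 * (j == k)%:R * ns u.
  rewrite (eq_bigr (fun l => s u j * s u k
      + (j == l)%:R * (2 * s u l * s u k - (l == k)%:R * ns u)
      - ((j == k)%:R * (s u l * s u l) + (j == l)%:R * (s u l * s u k)
         - (k == l)%:R * (s u l * s u j)))); last first.
    move=> l _; rewrite christoffel_contract// sX !christoffel_conf// eqxx mul1r.
    by rewrite (eq_sym l j) (eq_sym l k); ring.
  rewrite sumrB big_split /= sumrB big_split /= !sum_delta -!mulr_sumr -nE sumr_const card_ord.
  by rewrite -mulr_natl; ring.
rewrite mxE /riemann !partialE.
rewrite (eq_bigr (fun l => pd l (christoffel G l j k) u - pd j (christoffel G l l k) u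
  + (\sum_m christoffel G l l m u * christoffel G m j k u
     - \sum_m christoffel G l j m u * christoffel G m l k u))); last first.
  by move=> l _; rewrite sumrB.
rewrite big_split !sumrB /= S1 S2 S3 S4.
by ring.
Qed.

(** Subtracting the scalar curvature term removes the trace of the Hessian and leaves half of the
    squared gradient. As the Gram matrix is scalar, the operator is symmetric in these coordinates,
    so orthogonal diagonalisation applies to it directly. *)
Lemma schouten_op_conf u : (3 <= n)%N -> U u ->
  schouten_op G u = flat_schouten_op sigma u.
Proof.
move=> n3 Uu; rewrite /schouten_op /schouten /scalar_curv.
have n2 : n%:R - 2 != 0 :> R by rewrite subr_eq0 eqr_nat gtn_eqF.
have n1 : n%:R - 1 != 0 :> R by rewrite subr_eq0 pnatr_eq1 gtn_eqF// (ltn_trans _ n3).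
have E0 : expR (2 * sigma u) != 0 by rewrite gt_eqF ?expR_gt0.
rewrite invmx_scalar// !mul_scalar_mx mxtraceZ /flat_schouten_op flat_schoutenE expRN.
congr (_ *: _).
have trE : \tr (ricci G u) = - 2 * (n%:R - 1) * \tr (hess_at sigma u)
    - (n%:R - 1) * (n%:R - 2) * ns u.
  rewrite {1}/mxtrace (eq_bigr (fun j => - (n%:R - 2) * hess_at sigma u j j
     + (n%:R - 2) * (s u j * s u j)
     - (\tr (hess_at sigma u) + (n%:R - 2) * ns u))); last first.
    by move=> j _; rewrite ricci_conf// eqxx mul1r; ring.
  rewrite sumrB big_split /= -!mulr_sumr sumr_const card_ord -/(mxtrace _).
  rewrite (_ : \sum_i s u i * s u i = ns u); last first.
    by apply: eq_bigr => m _; rewrite !mxE.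
  by rewrite -mulr_natl; ring.
apply/matrixP => j k; rewrite trE [LHS]mxE [in LHS]mxE ricci_conf//.
rewrite [in RHS]mxE [in RHS]mxE [in RHS]mxE big_ord1 !mxE -/(s u j) -/(s u k) -/(ns u).
move: E0 (pd j _ u) (s u j) (s u k) (ns u) (\tr _) => + h a b m t.
move: (expR _) n2 n1; move: (n%:R : R) => N e n2 n1 e0.
case: (j == k); rewrite ?(mulr1n, mulr0n, mul1r, mul0r, subr0, mulr0).
  by field; rewrite e0 n1 n2.
by field.
Qed.

End ConformallyFlat.

(** * Symmetric matrices *)

Section DotProduct.
Variables (R : realType) (m : nat).
Implicit Types (p q r : 'rV[R]_m).

Lemma dotvE p q : dotv p q = (p *m q^T) 0 0.
Proof. by rewrite mxE; apply: eq_bigr => j _; rewrite mxE. Qed.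

Lemma mulmx_dotv p q : p *m q^T = (dotv p q)%:M.
Proof. by rewrite [LHS]mx11_scalar dotvE. Qed.

Lemma dotvC p q : dotv p q = dotv q p.
Proof. by apply: eq_bigr => j _; rewrite mulrC. Qed.

Lemma dotvDl p q r : dotv (p + q) r = dotv p r + dotv q r.
Proof. by rewrite !dotvE mulmxDl mxE. Qed.

Lemma dotvNl p r : dotv (- p) r = - dotv p r.
Proof. by rewrite !dotvE mulNmx mxE. Qed.

Lemma dotvBl p q r : dotv (p - q) r = dotv p r - dotv q r.
Proof. by rewrite dotvDl dotvNl. Qed.

Lemma dotvZl (a : R) p r : dotv (a *: p) r = a * dotv p r.
Proof. by rewrite !dotvE -scalemxAl mxE. Qed.

Lemma dot0v r : dotv 0 r = 0.
Proof. by rewrite dotvE mul0mx mxE. Qed.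

Lemma dotvDr r p q : dotv r (p + q) = dotv r p + dotv r q.
Proof. by rewrite dotvC dotvDl !(dotvC r). Qed.

Lemma dotvNr r p : dotv r (- p) = - dotv r p.
Proof. by rewrite dotvC dotvNl (dotvC r). Qed.

Lemma dotvBr r p q : dotv r (p - q) = dotv r p - dotv r q.
Proof. by rewrite dotvDr dotvNr. Qed.

Lemma dotvZr (a : R) r p : dotv r (a *: p) = a * dotv r p.
Proof. by rewrite dotvC dotvZl dotvC. Qed.

Lemma dotv_mulmx p q (A : 'M[R]_m) : dotv (p *m A) q = dotv p (q *m A^T).
Proof. by rewrite !dotvE trmx_mul trmxK mulmxA. Qed.

Lemma mulmx_tr_row k p q (r : 'rV[R]_k) : p *m (q^T *m r) = dotv p q *: r.
Proof. by rewrite mulmxA mulmx_dotv mul_scalar_mx. Qed.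

Lemma dotv_ge0 p : 0 <= dotv p p.
Proof. by apply: sumr_ge0 => j _; rewrite -expr2 sqr_ge0. Qed.

Lemma dotv_eq0 p : (dotv p p == 0) = (p == 0).
Proof.
apply/idP/idP => [|/eqP->]; last by rewrite dot0v.
rewrite /dotv psumr_eq0 => [/allP h|j _]; last by rewrite -expr2 sqr_ge0.
apply/eqP/rowP => j; rewrite mxE; apply/eqP.
by have := h j (mem_index_enum _); rewrite /= mulf_eq0 orbb.
Qed.

Lemma dotv_gt0 p : (0 < dotv p p) = (p != 0).
Proof. by rewrite lt_def dotv_ge0 andbT dotv_eq0. Qed.

End DotProduct.

Lemma dotv_delta (R : realType) m (p : 'rV[R]_m) i : dotv p 'e_i = p 0 i.
Proof.
rewrite /dotv (bigD1 i)//= big1 ?addr0 => [|j ji]; first by rewrite mxE !eqxx mulr1.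
by rewrite mxE eqxx (negbTE ji) mulr0.
Qed.

Section RealSpectral.
Variable R : realType.

Lemma char_poly_similar n (A Q Q' : 'M[R]_n) : Q *m Q' = 1%:M ->
  char_poly (Q *m A *m Q') = char_poly A.
Proof.
move=> QQ; rewrite /char_poly.
have -> : char_poly_mx (Q *m A *m Q') =
    map_mx polyC Q *m char_poly_mx A *m map_mx polyC Q'.
  rewrite /char_poly_mx mulmxBr mulmxBl -!map_mxM; congr (_ - _).
  rewrite scalar_mxC -mulmxA -map_mxM QQ.
  by rewrite map_scalar_mx /= mulmx1.
rewrite !det_mulmx mulrAC -det_mulmx -map_mxM QQ.
by rewrite map_scalar_mx det1 mul1r.
Qed.

Lemma char_poly_diag n (a : 'I_n -> R) :
  char_poly (diag_mx (\row_i a i)) = \prod_i ('X - (a i)%:P).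
Proof.
rewrite char_poly_trig ?diag_mx_is_trig//.
by apply: eq_bigr => i _; rewrite !mxE eqxx.
Qed.

(** The reflection in the hyperplane orthogonal to [v - 'e_0] exchanges these two unit vectors; if
    they coincide there is no mirror and the identity serves. *)
Lemma householder n (v : 'rV[R]_n.+1) : dotv v v = 1 ->
  exists H : 'M[R]_n.+1, [/\ H^T = H, H *m H = 1%:M & 'e_0 *m H = v].
Proof.
move=> v1; set e : 'rV[R]_n.+1 := 'e_0.
have [w wE] : exists w, w = v - e by exists (v - e).
have ee : dotv e e = 1 by rewrite dotv_delta mxE !eqxx.
have [w0|w0] := eqVneq w 0.
  exists 1%:M; rewrite trmx1 mulmx1; split=> //; rewrite mulmx1.
  by apply/esym/eqP; rewrite -subr_eq0 -wE w0.
have ww : dotv w w != 0 by rewrite dotv_eq0.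
pose c := 2 / dotv w w; exists (1%:M - c *: (w^T *m w)); split.
- by rewrite linearB /= trmx1 linearZ /= trmx_mul trmxK.
- rewrite mulmxBl mul1mx. rewrite mulmxBr mulmx1 -scalemxAl -scalemxAr.
  rewrite -mulmxA mulmx_tr_row -scalemxAr opprB !scalerA.
  rewrite (_ : c * (c * dotv w w) = c + c); last by rewrite /c; field.
  by rewrite scalerDl addrK subrK.
- rewrite mulmxBr mulmx1 -scalemxAr mulmx_tr_row scalerA.
  have -> : dotv e w = - (dotv w w / 2).
    by rewrite wE !dotvBl !dotvBr v1 ee (dotvC v e); field.
  rewrite (_ : c * _ = -1); last by rewrite /c; field.
  by rewrite scaleN1r opprK wE addrC subrK.
Qed.

(** The characteristic polynomial is split by assumption, so a real eigenvector for [a ord0] exists;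
    a Householder reflection moves it to the first axis and symmetry splits off a smaller symmetric
    block. The diagonal comes in the order prescribed by [a], which allows the eigenvalues to be
    sorted in the product case. *)
Lemma spectral_sym n (A : 'M[R]_n) (a : 'I_n -> R) : A^T = A ->
  char_poly A = \prod_i ('X - (a i)%:P) ->
  exists2 O : 'M[R]_n, O *m O^T = 1%:M & O *m A *m O^T = diag_mx (\row_i a i).
Proof.
elim: n A a => [|n IH] A a sA cA.
  by exists 1%:M; apply/matrixP => -[].
have /eigenvalueP[v0 v0A v0n] : eigenvalue A (a ord0).
  by rewrite eigenvalue_root_char cA big_ord_recl rootM root_XsubC eqxx.
have d0 : 0 < dotv v0 v0 by rewrite dotv_gt0.
pose v := (Num.sqrt (dotv v0 v0))^-1 *: v0.
have vv : dotv v v = 1.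
  rewrite dotvZl dotvZr mulrA -invfM -expr2 sqr_sqrtr ?dotv_ge0//.
  by rewrite mulVf// gt_eqF.
have vA : v *m A = a ord0 *: v by rewrite -scalemxAl v0A !scalerA mulrC.
have [H [sH HH eH]] := householder vv.
have eB : ('e_0 : 'rV[R]_n.+1) *m (H *m A *m H) = a ord0 *: 'e_0.
  rewrite !mulmxA eH vA -scalemxAl; congr (_ *: _).
  by rewrite -eH -mulmxA HH mulmx1.
have [B BE] : exists B : 'M[R]_(1 + n), B = H *m A *m H by exists (H *m A *m H).
have sB : B^T = B by rewrite BE !trmx_mul sH sA mulmxA.
have B0 j : B 0 j = a ord0 * (j == 0)%:R.
  by move/rowP: eB => /(_ j); rewrite -rowE -BE !mxE eqxx.
have Bblock : B = block_mx (a ord0)%:M 0 0 (drsubmx B).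
  rewrite -[LHS]submxK; congr block_mx.
  - by apply/matrixP => i j; rewrite !ord1 !mxE lshift0 B0 eqxx mulr1.
  - apply/matrixP => i j; rewrite !ord1 !mxE lshift0 B0.
    by rewrite (_ : _ == _ = false) ?mulr0.
  - apply/matrixP => i j; rewrite !ord1 !mxE lshift0 -sB mxE B0.
    by rewrite (_ : _ == _ = false) ?mulr0.
have sB' : (drsubmx B)^T = drsubmx B by rewrite trmx_drsub sB.
have cB : char_poly (drsubmx B) = \prod_i ('X - (a (lift ord0 i))%:P).
  have : char_poly B = char_poly A by rewrite BE; exact: char_poly_similar.
  rewrite cA {1}Bblock /char_poly char_block_diag_mx det_ublock big_ord_recl.
  rewrite (_ : \det (char_poly_mx (a ord0)%:M) = 'X - (a ord0)%:P); last first.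
    by rewrite det_mx11 !mxE eqxx.
  have h : 'X - (a ord0)%:P != 0 by rewrite polyXsubC_eq0.
  by move=> e; exact: (mulfI h e).
have [Q QQ OB] := IH _ _ sB' cB.
pose K : 'M[R]_(1 + n) := block_mx 1%:M 0 0 Q.
have KK : K *m K^T = 1%:M.
  rewrite /K tr_block_mx trmx1 !trmx0 mulmx_block !mulmx0 !mul0mx !addr0 add0r mulmx1.
  by rewrite QQ -scalar_mx_block.
have KB : K *m B *m K^T = diag_mx (\row_i a i).
  rewrite Bblock /K tr_block_mx trmx1 !trmx0 !mulmx_block.
  rewrite !(mulmx0, mul0mx, addr0, add0r, mulmx1, mul1mx) OB.
  have z0 (x : 'I_1) : x = 0%N :> nat by case: x => -[].
  apply/matrixP => i j; rewrite !mxE.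
  case: splitP => i' ei; rewrite !mxE; case: splitP => j' ej; rewrite !mxE.
  - have -> : i = ord0 by apply: val_inj; rewrite /= ei z0.
    have -> : j = ord0 by apply: val_inj; rewrite /= ej z0.
    have -> : i' = j' by apply: val_inj; rewrite /= !z0.
    by rewrite !eqxx.
  - have -> // : (i == j) = false.
    by apply/eqP => ij; move: ei; rewrite ij ej z0.
  - have -> // : (i == j) = false.
    by apply/eqP => ij; move: ei; rewrite ij ej z0.
  - rewrite (_ : i = lift ord0 i'); last exact: val_inj.
    by rewrite (_ : j = lift ord0 j'); last exact: val_inj.
exists (K *m H).
  rewrite trmx_mul sH mulmxA -(mulmxA K) HH mulmx1; exact: KK.
by rewrite trmx_mul sH !mulmxA -(mulmxA K H A) -(mulmxA K (H *m A) H) -BE; exact: KB.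
Qed.

End RealSpectral.

(** * Covariant derivatives and the Codazzi equation *)

Lemma addmxE (R : nmodType) m n (A B : 'M[R]_(m, n)) i j :
  (A + B) i j = A i j + B i j.
Proof. by rewrite mxE. Qed.

Lemma oppmxE (R : zmodType) m n (A : 'M[R]_(m, n)) i j : (- A) i j = - A i j.
Proof. by rewrite mxE. Qed.

Lemma scalemxE (R : realType) m n (a : R) (A : 'M[R]_(m, n)) i j :
  (a *: A) i j = a * A i j.
Proof. by rewrite mxE. Qed.

Ltac mx_linear := apply/matrixP => ? ?; rewrite !(addmxE, oppmxE, scalemxE); ring.

HB.lock Definition wedge (R : realType) m (a b : 'rV[R]_m) : 'M[R]_m :=
  a^T *m b - b^T *m a.

Section Wedge.
Variables (R : realType) (m : nat).
Implicit Types a b x : 'rV[R]_m.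

Lemma wedgeE a b : wedge a b = a^T *m b - b^T *m a.
Proof. by rewrite wedge.unlock. Qed.

Lemma row_wedge x a b : x *m wedge a b = dotv x a *: b - dotv x b *: a.
Proof. by rewrite wedgeE mulmxBr !mulmx_tr_row. Qed.

Lemma tr_wedge a b : (wedge a b)^T = - wedge a b.
Proof. by rewrite !wedgeE linearB /= !trmx_mul !trmxK opprB. Qed.

End Wedge.

Section DirectionalMx.
Variables (R : realType) (n : nat) (U : set 'rV[R]_n).
Hypothesis oU : open U.
Implicit Types u v w : 'rV[R]_n.

Definition ddx p q v (F : 'rV[R]_n -> 'M[R]_(p, q)) u : 'M[R]_(p, q) :=
  \sum_k v 0 k *: dmx k F u.

Lemma smooth_ddx p q v (F : 'rV[R]_n -> 'M[R]_(p, q)) :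
  smooth_mx U F -> smooth_mx U (ddx v F).
Proof.
move=> sF i j; apply: (eq_smooth oU (f := fun u => \sum_k v 0 k * dmx k F u i j)).
  by move=> u _; rewrite summxE; apply: eq_bigr => k _; rewrite mxE.
apply: smooth_sum => // k; apply: smoothM => //; first exact: smooth_cst.
exact: smooth_dmx.
Qed.

Lemma ddx_cst p q v (M : 'M[R]_(p, q)) u : ddx v (fun=> M) u = 0.
Proof. by apply: big1 => k _; rewrite dmx_cst scaler0. Qed.

Lemma eq_ddx p q v (F G : 'rV[R]_n -> 'M[R]_(p, q)) u : U u ->
  (forall u, U u -> F u = G u) -> ddx v F u = ddx v G u.
Proof. by move=> Uu FG; apply: eq_bigr => k _; rewrite (eq_dmx oU k Uu FG). Qed.

Lemma ddxD p q v (F G : 'rV[R]_n -> 'M[R]_(p, q)) u : U u ->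
  smooth_mx U F -> smooth_mx U G ->
  ddx v (fun w => F w + G w) u = ddx v F u + ddx v G u.
Proof.
move=> Uu sF sG; rewrite -big_split /=; apply: eq_bigr => k _.
by rewrite (dmxD _ Uu)// scalerDr.
Qed.

Lemma ddxN p q v (F : 'rV[R]_n -> 'M[R]_(p, q)) u : U u ->
  smooth_mx U F -> ddx v (fun w => - F w) u = - ddx v F u.
Proof.
move=> Uu sF; rewrite -sumrN; apply: eq_bigr => k _.
by rewrite (dmxN _ Uu)// scalerN.
Qed.

Lemma ddxB p q v (F G : 'rV[R]_n -> 'M[R]_(p, q)) u : U u ->
  smooth_mx U F -> smooth_mx U G ->
  ddx v (fun w => F w - G w) u = ddx v F u - ddx v G u.
Proof. by move=> Uu sF sG; rewrite ddxD// ?ddxN//; exact: smooth_mxN. Qed.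

Lemma ddxM p q r v (F : 'rV[R]_n -> 'M[R]_(p, q)) (G : 'rV[R]_n -> 'M[R]_(q, r)) u :
  U u -> smooth_mx U F -> smooth_mx U G ->
  ddx v (fun w => F w *m G w) u = ddx v F u *m G u + F u *m ddx v G u.
Proof.
move=> Uu sF sG; rewrite mulmx_suml mulmx_sumr -big_split /=; apply: eq_bigr => k _.
by rewrite (dmxM _ Uu)// scalerDr -scalemxAl -scalemxAr.
Qed.

Lemma ddxZ p q v (f : 'rV[R]_n -> R) (F : 'rV[R]_n -> 'M[R]_(p, q)) u : U u ->
  smooth_on U f -> smooth_mx U F ->
  ddx v (fun w => f w *: F w) u =
  (\sum_k v 0 k * pd k f u) *: F u + f u *: ddx v F u.
Proof.
move=> Uu sf sF; rewrite scaler_suml scaler_sumr -big_split /=; apply: eq_bigr => k _.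
by rewrite (dmxZ _ Uu)// scalerDr !scalerA (mulrC _ (f u)).
Qed.

Lemma ddx_tr p q v (F : 'rV[R]_n -> 'M[R]_(p, q)) u :
  ddx v (fun w => (F w)^T) u = (ddx v F u)^T.
Proof.
by rewrite linear_sum; apply: eq_bigr => k _; rewrite dmx_tr linearZ.
Qed.

Lemma ddxC p q v w (F : 'rV[R]_n -> 'M[R]_(p, q)) u : U u -> smooth_mx U F ->
  ddx v (ddx w F) u = ddx w (ddx v F) u.
Proof.
move=> Uu sF.
have E x y : ddx x (ddx y F) u =
    \sum_k \sum_l (x 0 k * y 0 l) *: dmx k (dmx l F) u.
  apply: eq_bigr => k _; apply/matrixP => a b.
  rewrite mxE dmxE summxE.
  rewrite (@eq_pd _ _ _ (fun z => \sum_l y 0 l * dmx l F z a b)); last first.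
    by move=> z; rewrite summxE; apply: eq_bigr => l _; rewrite mxE.
  rewrite pd_sum => [|l]; last first.
    apply: differentiableM; first exact: differentiable_cst.
    exact: smooth_diff Uu (smooth_dmx oU l sF a b).
  rewrite mulr_sumr; apply: eq_bigr => l _.
  rewrite (pdM (f := fun=> y 0 l)); [|exact: differentiable_cst|]; last first.
    exact: smooth_diff Uu (smooth_dmx oU l sF a b).
  by rewrite pd_cst mul0r add0r mxE dmxE mulrA.
rewrite !E exchange_big /=; apply: eq_bigr => k _; apply: eq_bigr => l _.
by rewrite mulrC (dmxC oU l k Uu sF).
Qed.

End DirectionalMx.

(* The Levi-Civita connection of e^(2 sigma) times the flat metric, written in
   the orthonormal frame e^(-sigma) d_i: the covariant derivative of an
   endomorphism field along v differs from the flat one by the commutator with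
   the skew matrix [conn v]. *)
Definition conn (R : realType) n (sigma : 'rV[R]_n -> R) v u :=
  wedge v (grad_at sigma u).

HB.lock Definition cd (R : realType) n (sigma : 'rV[R]_n -> R) v
    (X : 'rV[R]_n -> 'M[R]_n) u : 'M[R]_n :=
  ddx v X u + conn sigma v u *m X u - X u *m conn sigma v u.

(** The curvature form of [conn]. There is no bracket term because [v] and [w] are constant
    coordinate fields. *)
HB.lock Definition curv (R : realType) n (sigma : 'rV[R]_n -> R) v w u : 'M[R]_n :=
  ddx v (conn sigma w) u - ddx w (conn sigma v) u
  + conn sigma v u *m conn sigma w u - conn sigma w u *m conn sigma v u.

Section ConformalConnection.
Variables (R : realType) (n : nat) (U : set 'rV[R]_n) (sigma : 'rV[R]_n -> R).
Hypothesis oU : open U.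
Hypothesis ssig : smooth_on U sigma.
Implicit Types u v w x y : 'rV[R]_n.

Let s := grad_at sigma.
Let H := hess_at sigma.
Let S := flat_schouten sigma.
Let A := flat_schouten_op sigma.
Let ss : smooth_mx U s := smooth_grad oU ssig.
Let sH : smooth_mx U H := smooth_hess oU ssig.
Let sS : smooth_mx U S := smooth_flat_schouten oU ssig.
Let sA : smooth_mx U A := smooth_flat_schouten_op oU ssig.

Local Notation conn := (conn sigma).
Local Notation cd := (cd sigma).
Local Notation curv := (curv sigma).

Lemma cdE v X u : cd v X u = ddx v X u + conn v u *m X u - X u *m conn v u.
Proof. by rewrite cd.unlock. Qed.

Lemma curvE v w u : curv v w u =
  ddx v (conn w) u - ddx w (conn v) u + conn v u *m conn w u - conn w u *m conn v u.
Proof. by rewrite curv.unlock. Qed.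

Lemma connE v u : conn v u = wedge v (s u).
Proof. by []. Qed.

Lemma smooth_conn v : smooth_mx U (conn v).
Proof.
apply: (eq_smooth_mx oU (F := fun u => v^T *m s u - (s u)^T *m v)).
  by move=> u _; rewrite connE wedgeE.
apply: smooth_mxB => //; apply: smooth_mxM => //; try exact: smooth_mx_cst.
by apply: smooth_mx_tr.
Qed.

Lemma smooth_cd v X : smooth_mx U X -> smooth_mx U (cd v X).
Proof.
move=> sX; have sW := smooth_conn v.
apply: (eq_smooth_mx oU (F := fun u => ddx v X u + conn v u *m X u - X u *m conn v u)).
  by move=> u _; rewrite cdE.
apply: smooth_mxB => //.
  by apply: smooth_mxD => //; [exact: smooth_ddx|exact: smooth_mxM].
exact: smooth_mxM.
Qed.

Lemma eq_cd v X Y u : U u -> (forall u, U u -> X u = Y u) -> cd v X u = cd v Y u.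
Proof. by move=> Uu XY; rewrite !cdE (eq_ddx oU v Uu XY) XY. Qed.

Lemma cdM v X Y u : U u -> smooth_mx U X -> smooth_mx U Y ->
  cd v (fun w => X w *m Y w) u = cd v X u *m Y u + X u *m cd v Y u.
Proof.
move=> Uu sX sY; rewrite !cdE (ddxM _ Uu)//.
rewrite !(mulmxBl, mulmxBr, mulmxDl, mulmxDr) !mulmxA.
by mx_linear.
Qed.

Lemma cdB v X Y u : U u -> smooth_mx U X -> smooth_mx U Y ->
  cd v (fun w => X w - Y w) u = cd v X u - cd v Y u.
Proof.
move=> Uu sX sY; rewrite !cdE (ddxB oU _ Uu)// mulmxBl mulmxBr.
by mx_linear.
Qed.

Lemma cd_scalar v (c : R) u : cd v (fun=> c%:M) u = 0.
Proof. by rewrite !cdE ddx_cst add0r scalar_mxC subrr. Qed.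

Lemma cd_sym v X u : U u -> (forall u, U u -> (X u)^T = X u) ->
  (cd v X u)^T = cd v X u.
Proof.
move=> Uu sX; rewrite !cdE linearB linearD /= -ddx_tr (eq_ddx oU v Uu sX).
rewrite !trmx_mul sX// connE tr_wedge mulNmx mulmxN opprK.
by rewrite addrAC.
Qed.

Lemma cd_curv v w X u : U u -> smooth_mx U X ->
  cd v (cd w X) u - cd w (cd v X) u = curv v w u *m X u - X u *m curv v w u.
Proof.
move=> Uu sX.
have sWv := smooth_conn v; have sWw := smooth_conn w.
have E x y : ddx x (cd y X) u = ddx x (ddx y X) u
    + (ddx x (conn y) u *m X u + conn y u *m ddx x X u)
    - (ddx x X u *m conn y u + X u *m ddx x (conn y) u).
  have sWy := smooth_conn y.
  have sd : smooth_mx U (ddx y X) by exact: smooth_ddx.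
  rewrite (eq_ddx oU x Uu (fun z _ => cdE y X z)) (ddxB oU _ Uu)//; first last.
  - exact: smooth_mxM.
  - by apply: smooth_mxD => //; exact: smooth_mxM.
  rewrite (ddxD _ Uu)//; last exact: smooth_mxM.
  by rewrite !(ddxM _ Uu).
rewrite (cdE v (cd w X)) (cdE w (cd v X)) !E !cdE.
rewrite curvE (ddxC oU w v Uu sX).
rewrite !(mulmxBl, mulmxBr, mulmxDl, mulmxDr) !mulmxA.
by mx_linear.
Qed.

Lemma ddx_grad v u : ddx v s u = v *m H u.
Proof.
apply/rowP => j; rewrite summxE mxE; apply: eq_bigr => k _.
rewrite !mxE dmxE; congr (_ * _); apply: eq_pd => w; by rewrite mxE.
Qed.

Lemma ddx_conn v w u : U u -> ddx v (conn w) u = wedge w (v *m H u).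
Proof.
move=> Uu; have cw : smooth_mx U (fun=> w) by exact: smooth_mx_cst.
have cwt : smooth_mx U (fun=> w^T) by exact: smooth_mx_cst.
have st : smooth_mx U (fun u => (s u)^T) by exact: smooth_mx_tr.
rewrite (eq_ddx oU v Uu (G := fun u => w^T *m s u - (s u)^T *m w)); last first.
  by move=> x _; rewrite connE wedgeE.
rewrite wedgeE (ddxB oU _ Uu)//; try exact: smooth_mxM.
rewrite !(ddxM _ Uu)// !ddx_cst mul0mx mulmx0 add0r addr0.
by rewrite ddx_tr ddx_grad.
Qed.

Lemma row_schouten w u : w *m S u =
  dotv w (s u) *: s u - w *m H u - (dotv (s u) (s u) / 2) *: w.
Proof. by rewrite /S flat_schoutenE !mulmxBr mulmx_tr_row mul_mx_scalar. Qed.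

Lemma dot_hess v w u : U u -> dotv (v *m H u) w = dotv (w *m H u) v.
Proof.
move=> Uu; rewrite dotv_mulmx dotvC; congr (dotv (_ *m _) _).
by apply/matrixP => i j; rewrite mxE; exact: hessC oU ssig _ _ _ Uu.
Qed.

(** For a conformally flat metric the curvature is the Kulkarni-Nomizu product of the Schouten
    tensor and the metric; orthogonality of [v] and [w] removes the mixed terms. *)
Lemma curv_sectional v w u : U u -> dotv v w = 0 ->
  dotv (v *m curv v w u) w =
  dotv (w *m S u) w * dotv v v + dotv (v *m S u) v * dotv w w.
Proof.
move=> Uu vw; have wv : dotv w v = 0 by rewrite dotvC.
rewrite curvE !ddx_conn// mulmxBr mulmxDr mulmxBr !mulmxA !row_wedge.
rewrite !row_schouten.
rewrite !(dotvBl, dotvDl, dotvZl, dotvNl) !(dotvC (s u)) vw wv.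
rewrite !(dotvC _ (_ *m H u)) (dot_hess w v)//.
by field.
Qed.

Lemma ddx_schouten v u : U u -> ddx v S u =
  (v *m H u)^T *m s u + (s u)^T *m (v *m H u) - ddx v H u
  - (dotv (v *m H u) (s u))%:M.
Proof.
move=> Uu; have st : smooth_mx U (fun u => (s u)^T) by exact: smooth_mx_tr.
have sq : smooth_on U (fun u => dotv (s u) (s u) / 2).
  by apply: smoothM => //; [exact: smooth_dotv|exact: smooth_cst].
rewrite /S flat_schoutenE (ddxB oU _ Uu)//; first last.
- exact: smooth_mx_scalar.
- by apply: smooth_mxB => //; exact: smooth_mxM.
rewrite (ddxB oU _ Uu)//; last exact: smooth_mxM.
rewrite (ddxM _ Uu)// ddx_tr !ddx_grad; congr (_ - _).
rewrite /ddx (eq_bigr (fun k => (v 0 k * \sum_j H u k j * s u 0 j)%:M)); last first.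
  move=> k _; rewrite (dmx_scalar _ k Uu)// scale_scalar_mx; congr (_ * _)%:M.
  have dj j : differentiable (fun w => s w 0 j) u by exact: smooth_diff Uu (ss 0 j).
  rewrite (pdM (g := fun=> 2^-1)) ?pd_cst ?mulr0 ?addr0; first last.
  - exact: differentiable_cst.
  - by apply: differentiable_sumf => j; apply: differentiableM.
  rewrite pd_sum => [|j]; last by apply: differentiableM.
  rewrite mulr_suml; apply: eq_bigr => j _; rewrite pdM// (@eq_pd _ _ _ (pd j sigma)).
    by rewrite !mxE; field.
  by move=> w; rewrite mxE.
rewrite -[LHS](raddf_sum (scalar_mx : R -> 'M[R]_n)); congr _%:M.
rewrite /dotv; under [RHS]eq_bigr do rewrite mxE mulr_suml.
rewrite exchange_big /=; apply: eq_bigr => k _; rewrite mulr_sumr.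
by apply: eq_bigr => j _; rewrite mulrA.
Qed.

Lemma ddx_hessC v w u : U u -> w *m ddx v H u = v *m ddx w H u.
Proof.
move=> Uu; have E x y j : (x *m ddx y H u) 0 j =
    \sum_k \sum_l (y 0 l * x 0 k) * pd l (pd k (pd j sigma)) u.
  rewrite mxE; apply: eq_bigr => k _; rewrite summxE mulr_sumr; apply: eq_bigr => l _.
  rewrite mxE dmxE mulrCA mulrA; congr (_ * _); apply: eq_pd => z; by rewrite mxE.
apply/rowP => j; rewrite !E exchange_big; apply: eq_bigr => k _; apply: eq_bigr => l _.
congr (_ * _); [exact: mulrC|exact: (smooth_pdC oU _ _ Uu (smooth_pd _ ssig))].
Qed.

(** This is the vanishing of the Cotton tensor. Third derivatives of [sigma] enter only through the
    derivative of the Hessian, which is symmetric by [ddx_hessC]; the remaining terms match by the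
    symmetry of the Hessian. *)
Lemma codazzi v w u : U u -> w *m cd v A u = v *m cd w A u.
Proof.
move=> Uu.
have sE : smooth_on U (fun u => expR (- (2 * sigma u))).
  apply: smooth_expR => //; apply: smoothN => //; apply: smoothM => //.
  exact: smooth_cst.
have dE k : pd k (fun u => expR (- (2 * sigma u))) u
    = - 2 * expR (- (2 * sigma u)) * s u 0 k.
  have d1 : differentiable (fun u => 2 * sigma u) u.
    apply: differentiableM; [exact: differentiable_cst|exact: smooth_diff Uu ssig].
  rewrite (pd_expR (f := fun u => - (2 * sigma u))); last exact: differentiableN.
  rewrite pdN// (pdM (f := fun=> 2)); first last.
  - exact: smooth_diff Uu ssig.
  - exact: differentiable_cst.
  by rewrite pd_cst mxE; ring.
(* The lines are, in order: the derivative of the factor e^(-2 sigma), the derivative of the flat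
   Schouten tensor (two lines), and the two terms of the commutator with [conn]. *)
have E x y : y *m cd x A u = expR (- (2 * sigma u)) *:
   (- (2 * dotv x (s u)) *: (y *m S u)
    + (dotv y (x *m H u) *: s u + dotv y (s u) *: (x *m H u) - y *m ddx x H u
       - dotv (x *m H u) (s u) *: y)
    + (dotv y x *: (s u *m S u) - dotv y (s u) *: (x *m S u))
    - (dotv (y *m S u) x *: s u - dotv (y *m S u) (s u) *: x)).
  rewrite !cdE (ddxZ _ Uu)// (eq_bigr (fun k => - 2 * expR (- (2 * sigma u)) *
    (x 0 k * s u 0 k))); last by move=> k _; rewrite dE; ring.
  rewrite -mulr_sumr -/(dotv x (s u)) ddx_schouten//.
  rewrite /A /flat_schouten_op -/(S u) -scalemxAr -scalemxAl.
  rewrite mulmxBr mulmxDr mulmxDr -!scalemxAr !mulmxA !row_wedge.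
  rewrite !mulmxBr mulmxDr !mulmx_tr_row mul_mx_scalar !mulmxBl -!scalemxAl.
  rewrite -(mulmxA (s u)^T) mulmx_tr_row; by mx_linear.
rewrite !E; congr (_ *: _).
rewrite (ddx_hessC v w Uu) !row_schouten !(dotvBl, dotvZl).
rewrite !(dotvC (s u)) !(dotvC _ (_ *m H u)) (dot_hess w v)// (dotvC w v).
by apply/matrixP => i j; rewrite !(addmxE, oppmxE, scalemxE); field.
Qed.

End ConformalConnection.

(** * Cartan's formula *)

Section MatrixProducts.
Variables (R : realType) (n : nat).
Implicit Types (M : 'M[R]_n) (s : seq R).

Definition prod_shift s M : 'M[R]_n :=
  foldr (fun c N => (M - c%:M) *m N) 1%:M s.

Lemma row_prod_shift s M (w : 'rV[R]_n) a : w *m M = a *: w ->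
  w *m prod_shift s M = (\prod_(c <- s) (a - c)) *: w.
Proof.
move=> wM; elim: s => [|c s IH] /=; first by rewrite big_nil mulmx1 scale1r.
rewrite mulmxA mulmxBr wM mul_mx_scalar -scalerBl -scalemxAl IH scalerA big_cons.
by [].
Qed.

Lemma col_prod_shift s M (w : 'cV[R]_n) a : M *m w = a *: w ->
  prod_shift s M *m w = (\prod_(c <- s) (a - c)) *: w.
Proof.
move=> wM; elim: s => [|c s IH] /=; first by rewrite big_nil mul1mx scale1r.
rewrite -mulmxA IH -scalemxAr mulmxBl wM mul_scalar_mx -scalerBl scalerA big_cons.
by rewrite mulrC.
Qed.

Lemma smooth_prod_shift (U : set 'rV[R]_n) s (F : 'rV[R]_n -> 'M[R]_n) :
  open U -> smooth_mx U F -> smooth_mx U (fun u => prod_shift s (F u)).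
Proof.
move=> oU sF; elim: s => [|c s IH] /=; first exact: smooth_mx_cst.
apply: smooth_mxM => //; apply: smooth_mxB => //; exact: smooth_mx_cst.
Qed.

(** Sharper than Cayley-Hamilton: an eigenvalue need occur only once in [s], whatever its
    multiplicity, because a symmetric matrix has a basis of eigenvectors, here the rows of [Q]. *)
Lemma prod_shift_annihilates s M (a : 'I_n -> R) : M^T = M ->
  char_poly M = \prod_i ('X - (a i)%:P) -> (forall i, a i \in s) ->
  prod_shift s M = 0.
Proof.
move=> sM cM as_; have [Q QQ QM] := spectral_sym sM cM.
have QM' : Q *m M = diag_mx (\row_i a i) *m Q.
  by rewrite -QM -mulmxA (mulmx1C QQ) mulmx1.
have E : Q *m prod_shift s M = 0.
  apply/row_matrixP => i; rewrite row_mul row0.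
  have wM : row i Q *m M = a i *: row i Q.
    by rewrite -row_mul QM' row_mul row_diag_mx mxE -scalemxAl -rowE.
  rewrite (row_prod_shift _ wM).
  have /eqP -> : \prod_(c <- s) (a i - c) == 0.
    by rewrite prodf_seq_eq0; apply/hasP; exists (a i) => //=; rewrite subrr eqxx.
  by rewrite scale0r.
by rewrite -[LHS]mul1mx -(mulmx1C QQ) -mulmxA E mulmx0.
Qed.

End MatrixProducts.

Section CartanFormula.
Variables (R : realType) (n : nat) (U : set 'rV[R]_n) (sigma : 'rV[R]_n -> R).
Variable a : 'I_n -> R.
Hypothesis oU : open U.
Hypothesis ssig : smooth_on U sigma.
Let A := flat_schouten_op sigma.
Hypothesis eigA : forall u, U u -> char_poly (A u) = \prod_i ('X - (a i)%:P).
Implicit Types u v w x y : 'rV[R]_n.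

Local Notation D := (cd sigma).
Let sA : smooth_mx U A := smooth_flat_schouten_op oU ssig.

Lemma flat_schouten_op_sym u : U u -> (A u)^T = A u.
Proof. by move=> Uu; rewrite linearZ /= (flat_schouten_sym oU ssig Uu). Qed.

Let Asym := flat_schouten_op_sym.

(** [P] is the product of the (A - a_i) / (c - a_i) over the indices with a_i <> c. Its coefficients
    are constant because the eigenvalues are, hence it is smooth, and it replaces a smooth choice of
    eigenvectors. *)
Lemma eigenprojector u0 (c : R) : U u0 -> exists P : 'rV[R]_n -> 'M[R]_n,
  [/\ smooth_mx U P, forall u, U u -> (c%:M - A u) *m P u = 0
    & forall w, w *m A u0 = c *: w -> P u0 *m w^T = w^T].
Proof.
move=> Uu0; pose s := [seq a i | i <- enum 'I_n & a i != c].
pose k := \prod_(d <- s) (c - d).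
have k0 : k != 0.
  rewrite prodf_seq_neq0; apply/allP => d /mapP[i].
  by rewrite mem_filter => /andP[ic _] ->; rewrite subr_eq0 eq_sym.
exists (fun u => k^-1 *: prod_shift s (A u)); split.
- apply: smooth_mxZ => //; first exact: smooth_cst.
  exact: smooth_prod_shift.
- move=> u Uu; rewrite -scalemxAr.
  have : prod_shift (c :: s) (A u) = 0.
    apply: prod_shift_annihilates (Asym Uu) (eigA Uu) _ => i.
    rewrite inE; have [//|ic] := eqVneq (a i) c.
    by apply/mapP; exists i => //; rewrite mem_filter ic mem_enum.
  rewrite /= -opprB mulNmx => /eqP; rewrite oppr_eq0 => /eqP ->.
  by rewrite scaler0.
- move=> w wA; have Aw : A u0 *m w^T = c *: w^T.
    by rewrite -[A u0]Asym// -trmx_mul wA linearZ.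
  by rewrite -scalemxAl (col_prod_shift _ Aw) scalerA mulVf// scale1r.
Qed.

(** The identity (c - A) P = 0 is differentiated once and twice. Testing with the eigenvector [w] on
    the left kills every term that begins with c - A, and [P] fixes [w] on the right. *)
Lemma eigenvalue_variation u v w (c : R) : U u -> w *m A u = c *: w ->
  dotv (w *m D v A u) w = 0 /\
  exists2 z, z *m (c%:M - A u) = w *m D v A u &
    dotv (w *m D v (D v A) u) w = - 2 * dotv (w *m D v A u) z.
Proof.
move=> Uu wA; have [P [sP AP Pw]] := eigenprojector c Uu.
have {}Pw := Pw w wA.
pose B u := c%:M - A u.
have sB : smooth_mx U B by apply: smooth_mxB => //; exact: smooth_mx_cst.
have sT : smooth_mx U (D v A) := smooth_cd oU ssig v sA.
have sP' : smooth_mx U (D v P) := smooth_cd oU ssig v sP.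
have wB : w *m B u = 0 by rewrite mulmxBr wA mul_mx_scalar subrr.
have Bsym : (B u)^T = B u by rewrite linearB /= tr_scalar_mx Asym.
have dB x : U x -> D v B x = - D v A x.
  move=> Ux; have -> : D v B x = D v (fun=> c%:M) x - D v A x.
    by apply: cdB Ux _ sA => //; exact: smooth_mx_cst.
  by rewrite cd_scalar sub0r.
have BP x : U x -> B x *m P x = 0 := AP x.
have BuE : B u = c%:M - A u by [].
clearbody B.
have d0 x : D v (fun=> 0) x = 0.
  have -> : (fun=> 0) = (fun=> (0 : R)%:M) :> ('rV[R]_n -> 'M[R]_n).
    by apply/funext => y; apply/matrixP => i j; rewrite !mxE mul0rn.
  exact: cd_scalar.
have E1 x : U x -> D v A x *m P x = B x *m D v P x.
  move=> Ux; have := eq_cd sigma oU v Ux BP.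
  rewrite d0 (cdM _ v Ux sB sP) dB// mulNmx.
  by move/eqP; rewrite addrC subr_eq0 => /eqP.
have E2 : D v (D v A) u *m P u =
    B u *m D v (D v P) u - D v A u *m D v P u - D v A u *m D v P u.
  have := eq_cd sigma oU v Uu E1.
  rewrite (cdM _ v Uu sT sP) (cdM _ v Uu sB sP') dB// mulNmx.
  move=> e; rewrite -[LHS](addrK (D v A u *m D v P u)) e.
  by mx_linear.
(* The derivative of the projector applied to [w] is the first-order correction of the
   eigenvector. *)
pose z := (D v P u *m w^T)^T.
have zB : z *m B u = w *m D v A u.
  rewrite /z -{1}Bsym -trmx_mul mulmxA -E1// -mulmxA Pw trmx_mul trmxK.
  by rewrite (cd_sym sigma oU _ Uu Asym).
split.
  rewrite dotvE -mulmxA -[in X in _ *m X]Pw (mulmxA (D v A u)) E1//.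
  by rewrite !mulmxA wB !mul0mx mxE.
exists z; first by rewrite -BuE.
rewrite !dotvE -mulmxA -[in X in _ *m X]Pw (mulmxA (D v (D v A) u)) E2.
rewrite !mulmxBl !mulmxBr !mulmxA wB !mul0mx /z trmxK !mulmxA.
by rewrite !(addmxE, oppmxE, mxE); ring.
Qed.

(** The Codazzi equation is differentiated along [v]. The two connection terms appear because the
    constant fields [w] and [x] are not parallel. *)
Lemma codazzi_derived u v w x : U u ->
  x *m D v (D w A) u = w *m D v (D x A) u
   - (w *m conn sigma v u) *m D x A u + (x *m conn sigma v u) *m D w A u.
Proof.
move=> Uu.
have sW := smooth_cd oU ssig w sA; have sX := smooth_cd oU ssig x sA.
have cst m (y : 'rV[R]_m) : smooth_mx U (fun=> y) by exact: smooth_mx_cst.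
have dM y (X : 'rV[R]_n -> 'M[R]_n) : smooth_mx U X ->
    ddx v (fun u => y *m X u) u = y *m ddx v X u.
  by move=> sX'; rewrite (ddxM _ Uu)// ddx_cst mul0mx add0r.
have e : x *m ddx v (D w A) u = w *m ddx v (D x A) u.
  rewrite -!dM//; apply: (eq_ddx oU v Uu) => y Uy.
  exact: (codazzi oU ssig).
have e2 : x *m (D w A u *m conn sigma v u) = w *m (D x A u *m conn sigma v u).
  by rewrite !mulmxA; congr (_ *m _); exact: (codazzi oU ssig).
have CD X : D v X u = ddx v X u + conn sigma v u *m X u - X u *m conn sigma v u by rewrite cdE.
rewrite (CD (D w A)) (CD (D x A)) !mulmxBr !mulmxDr e e2 !mulmxA.
by mx_linear.
Qed.

(* lam + mu is the sectional curvature of the plane spanned by v and w: the Weyl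
   tensor vanishes, so the Schouten tensor determines the curvature. *)
Lemma cartan_pair u v w (lam mu : R) : U u -> lam != mu ->
  v *m A u = lam *: v -> w *m A u = mu *: w ->
  exists x, 2 * dotv (x *m (mu%:M - A u) *m (lam%:M - A u)) x =
    expR (2 * sigma u) * (lam + mu) * dotv v v * dotv w w.
Proof.
move=> Uu lm vA wA.
have wv : dotv v w = 0.
  have : (lam - mu) * dotv v w = 0.
    rewrite mulrBl -dotvZl -vA -dotvZr -wA dotv_mulmx Asym// subrr.
    by [].
  by move/eqP; rewrite mulf_eq0 subr_eq0 (negbTE lm) => /eqP.
have Tsym y : (D y A u)^T = D y A u by exact: (cd_sym sigma oU _ Uu Asym).
pose y := v *m D w A u.
have yE : w *m D v A u = y by exact: (codazzi oU ssig).
have [v1 [zv zvE v2]] := eigenvalue_variation w Uu vA.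
have [w1 [zw zwE w2]] := eigenvalue_variation v Uu wA.
rewrite -/y in zvE v2; rewrite yE in zwE w2.
have ww0 x : dotv (w *m D x A u) w = 0 by case: (eigenvalue_variation x Uu wA).
have vv0 x : dotv (v *m D x A u) v = 0 by case: (eigenvalue_variation x Uu vA).
(* The second variation along [v'] tested on [w'] twice is traded for a mixed second derivative
   tested on [v'] and [w']. Both connection terms vanish, by orthogonality and the first variations.
   The claim is used for both orders of the pair; the difference of the two mixed derivatives is
   then a commutator with the curvature. *)
have Q v' w' z' : dotv v' w' = 0 -> w' *m D v' A u = v' *m D w' A u ->
    (forall x, dotv (w' *m D x A u) w' = 0) ->
    dotv (v' *m D w' A u) v' = 0 ->
    dotv (w' *m D v' (D v' A) u) w' = - 2 * dotv (v' *m D w' A u) z' ->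
    dotv (v' *m D v' (D w' A) u) w' = - 2 * dotv (v' *m D w' A u) z'.
  move=> vw' yy w0 v0 <-; rewrite (codazzi_derived v' w' v' Uu) dotvDl dotvBl.
  have -> : dotv (w' *m conn sigma v' u *m D v' A u) w' = 0.
    rewrite connE row_wedge (dotvC w' v') vw' scale0r sub0r mulNmx -scalemxAl dotvNl dotvZl.
    by rewrite dotv_mulmx Tsym yy (dotvC v' (_ *m _)) v0 mulr0 oppr0.
  by rewrite (codazzi oU ssig _ _ Uu) w0 subr0 addr0.
have Q1 : dotv (v *m D v (D w A) u) w = - 2 * dotv y zw.
  by apply: Q => //; exact: vv0.
have Q2 : dotv (v *m D w (D v A) u) w = - 2 * dotv y zv.
  have sT : (D w (D v A) u)^T = D w (D v A) u.
    by apply: (cd_sym sigma oU _ Uu) => z Uz; exact: (cd_sym sigma oU _ Uz Asym).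
  rewrite dotv_mulmx sT dotvC -yE; apply: Q => //; first by rewrite dotvC.
  by rewrite yE.
have F : dotv (v *m D v (D w A) u) w - dotv (v *m D w (D v A) u) w =
    (mu - lam) * dotv (v *m curv sigma v w u) w.
  rewrite -dotvBl -mulmxBr (cd_curv oU ssig _ _ Uu sA) mulmxBr dotvBl !mulmxA.
  rewrite vA -scalemxAl dotvZl [dotv (_ *m A u) w]dotv_mulmx Asym// wA dotvZr.
  by rewrite mulrBl.
have ml0 : mu - lam != 0 by rewrite subr_eq0 eq_sym.
(* Chosen so that applying mu - A gives [zv], and then applying lam - A gives [y]: the quadratic
   form becomes the product of [y] and [x]. *)
pose x := (mu - lam)^-1 *: (zv - zw); exists x.
have xmu : x *m (mu%:M - A u) = zv.
  have zvmu : zv *m (mu%:M - A u) = y + (mu - lam) *: zv.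
    rewrite -zvE !mulmxBr !mul_mx_scalar scalerBl.
    by mx_linear.
  rewrite /x -scalemxAl mulmxBl zvmu zwE addrAC subrr add0r scalerA mulVf//.
  by rewrite scale1r.
have SA z : z *m flat_schouten sigma u = expR (2 * sigma u) *: (z *m A u).
  by rewrite -scalemxAr scalerA -expRD subrr expR0 scale1r.
rewrite xmu zvE; apply: (mulfI ml0).
rewrite (_ : _ * (_ * dotv y x) = - 2 * dotv y zw - - 2 * dotv y zv).
  rewrite -Q1 -Q2 F; congr (_ * _); rewrite (curv_sectional oU ssig Uu)//.
  by rewrite !SA vA wA !dotvZl; ring.
by rewrite /x dotvZr dotvBr; field.
Qed.

Lemma quadratic_form_diag (M Q : 'M[R]_n) (b : 'I_n -> R) c d x :
  Q *m Q^T = 1%:M -> Q *m M *m Q^T = diag_mx (\row_i b i) ->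
  dotv (x *m (c%:M - M) *m (d%:M - M)) x =
  \sum_i (c - b i) * (d - b i) * (x *m Q^T) 0 i ^+ 2.
Proof.
move=> QQ QM; pose y := x *m Q^T.
have xE : x = y *m Q by rewrite /y -mulmxA (mulmx1C QQ) mulmx1.
have yM k z : z *m Q *m (k%:M - M) = (\row_i ((k - b i) * z 0 i)) *m Q.
  rewrite mulmxBr mul_mx_scalar.
  have -> : z *m Q *m M = z *m diag_mx (\row_i b i) *m Q.
    by rewrite -QM !mulmxA -(mulmxA _ Q^T) (mulmx1C QQ) mulmx1.
  rewrite scalemxAl -mulmxBl; congr (_ *m _).
  by apply/rowP => i; rewrite mul_mx_diag !mxE mulrBl [b i * _]mulrC.
rewrite -/y; clearbody y; rewrite xE !yM dotvE trmx_mul mulmxA -(mulmxA _ Q) QQ.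
rewrite mulmx1 mxE.
by apply: eq_bigr => i _; rewrite !mxE; ring.
Qed.

(** Let a_p be the largest value, a_q the smallest and a_r the smallest one above a_q. The signs of
    the quadratic forms give a_p + a_q <= 0 <= a_r + a_q, hence a_r >= a_p, and no value lies
    strictly between a_q and a_p. *)
Lemma eigenvalues_opposite u : U u -> (0 < n)%N ->
  (exists lam : R, forall i, a i = lam) \/
  (exists lam : R, [/\ 0 < lam, forall i, a i = lam \/ a i = - lam,
     exists i, a i = lam & exists i, a i = - lam]).
Proof.
move=> Uu n0; have [Q QQ QA] := spectral_sym (Asym Uu) (eigA Uu).
have QA' : Q *m A u = diag_mx (\row_i a i) *m Q.
  by rewrite -QA -mulmxA (mulmx1C QQ) mulmx1.
have rowA i : row i Q *m A u = a i *: row i Q.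
  by rewrite -row_mul QA' row_mul row_diag_mx mxE -scalemxAl -rowE.
have row1 i : dotv (row i Q) (row i Q) = 1.
  have e : (Q *m Q^T) i i = 1 by rewrite QQ mxE eqxx.
  by rewrite -e mxE; apply: eq_bigr => j _; rewrite !mxE.
have sign i j : a i != a j -> exists y : 'rV[R]_n,
    2 * \sum_k (a j - a k) * (a i - a k) * y 0 k ^+ 2 =
    expR (2 * sigma u) * (a i + a j).
  move=> ij; have [x xE] := cartan_pair Uu ij (rowA i) (rowA j).
  exists (x *m Q^T); rewrite -(quadratic_form_diag _ _ _ QQ QA) xE !row1.
  by rewrite !mulr1.
pose i0 := Ordinal n0.
have [p _ pm] := arg_maxP a (isT : xpredT i0).
have pmax i : a i <= a p := pm i isT.
have [q _ qm] := arg_minP a (isT : xpredT i0).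
have qmin i : a q <= a i := qm i isT.
have [pq|pq] := eqVneq (a p) (a q).
  left; exists (a p) => i; apply/eqP; rewrite eq_le pmax pq.
  by rewrite qmin.
(* Every a_k lies between a_q and a_p, so each coefficient (a_q - a_k)(a_p - a_k) is nonpositive. *)
right; have le_pq : a p + a q <= 0.
  have [y e] := sign p q pq.
  rewrite -(pmulr_rle0 _ (expR_gt0 (2 * sigma u))) -e pmulr_rle0//.
  apply: sumr_le0 => k _; rewrite mulr_le0_ge0 ?sqr_ge0//.
  by rewrite mulr_le0_ge0 ?subr_ge0 ?subr_le0 ?pmax ?qmin.
(* No a_k lies strictly between a_q and a_r, so now each coefficient is nonnegative. *)
have [r /= rq rm] := arg_minP (P := fun i => a i != a q) a (i0 := p) pq.
have rmin i : a i != a q -> a r <= a i := rm i.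
have le_qr : 0 <= a r + a q.
  have [y e] := sign r q rq.
  rewrite -(pmulr_rge0 _ (expR_gt0 (2 * sigma u))) -e pmulr_rge0//.
  apply: sumr_ge0 => k _; rewrite mulr_ge0 ?sqr_ge0//.
  have [->|kq] := eqVneq (a k) (a q); first by rewrite subrr mul0r.
  by rewrite mulr_le0 ?subr_le0 ?qmin ?rmin.
have rp : a r = a p.
  apply/eqP; rewrite eq_le pmax; lra.
have qp : a q = - a p by apply/eqP; rewrite -addr_eq0 addrC eq_le le_pq -rp le_qr.
exists (a p); split.
- have : a q < a p by rewrite lt_def pq qmin.
  rewrite qp; lra.
- move=> i; have [iq|iq] := eqVneq (a i) (a q); first by right; rewrite iq.
  by left; apply/eqP; rewrite eq_le pmax -rp rmin.
- by exists p.
- by exists q.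
Qed.

End CartanFormula.

(** * The Lorentz product and the charts of the sphere *)

Lemma row_consE0 (R : realType) m c (x : 'rV[R]_m) :
  @fun_of_matrix R 1 m.+1 (row_mx (c%:M : 'rV[R]_1) x) 0 0 = c.
Proof.
have e : (c%:M : 'rV[R]_1) 0 0 = c by rewrite mxE eqxx.
rewrite -[RHS]e -(row_mxEl (c%:M : 'rV[R]_1) x 0 0).
by congr (fun_of_matrix _ _ _); exact: val_inj.
Qed.

Lemma row_consES (R : realType) m c (x : 'rV[R]_m) i :
  @fun_of_matrix R 1 m.+1 (row_mx (c%:M : 'rV[R]_1) x) 0 (lift ord0 i) = x 0 i.
Proof.
rewrite -(row_mxEr (c%:M : 'rV[R]_1) x 0 i).
by congr (fun_of_matrix _ _ _); exact: val_inj.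
Qed.

Section LorentzProduct.
Variables (R : realType) (n : nat).
Implicit Types p q r : 'rV[R]_n.+2.

Definition lorentz_form : 'M[R]_n.+2 := diag_mx (\row_i (if i == 0 then -1 else 1)).

Lemma lorE p q : lor p q = (p *m lorentz_form *m q^T) 0 0.
Proof.
rewrite mxE big_ord_recl mul_mx_diag !mxE eqxx mulrN1 mulNr; congr (_ + _).
by apply: eq_bigr => i _; rewrite !mxE mulr1.
Qed.

Lemma lorC p q : lor p q = lor q p.
Proof.
by rewrite /lor (mulrC (p 0 0)); congr (_ + _); apply: eq_bigr => i _; rewrite mulrC.
Qed.

Lemma lorDl p q r : lor (p + q) r = lor p r + lor q r.
Proof. by rewrite !lorE !mulmxDl mxE. Qed.

Lemma lorNl p r : lor (- p) r = - lor p r.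
Proof. by rewrite !lorE !mulNmx mxE. Qed.

Lemma lorBl p q r : lor (p - q) r = lor p r - lor q r.
Proof. by rewrite lorDl lorNl. Qed.

Lemma lorZl (a : R) p r : lor (a *: p) r = a * lor p r.
Proof. by rewrite !lorE -!scalemxAl mxE. Qed.

Lemma lor0l r : lor 0 r = 0.
Proof. by rewrite lorE !mul0mx mxE. Qed.

Lemma lorDr r p q : lor r (p + q) = lor r p + lor r q.
Proof. by rewrite lorC lorDl !(lorC r). Qed.

Lemma lorNr r p : lor r (- p) = - lor r p.
Proof. by rewrite lorC lorNl (lorC r). Qed.

Lemma lorBr r p q : lor r (p - q) = lor r p - lor r q.
Proof. by rewrite lorDr lorNr. Qed.

Lemma lorZr (a : R) r p : lor r (a *: p) = a * lor r p.
Proof. by rewrite lorC lorZl lorC. Qed.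

Lemma dotv_row_mx m1 m2 (x x' : 'rV[R]_m1) (y y' : 'rV[R]_m2) :
  dotv (row_mx x y) (row_mx x' y') = dotv x x' + dotv y y'.
Proof. by rewrite !dotvE tr_row_mx mul_row_col mxE. Qed.

Lemma dotv_scalar (a b : R) : dotv (a%:M : 'rV_1) b%:M = a * b.
Proof. by rewrite /dotv big_ord1 !mxE eqxx !mulr1n. Qed.

Lemma dotv_cons (a b : R) (x y : 'rV[R]_n) :
  @dotv R n.+1 (row_mx (a%:M : 'rV_1) x) (row_mx (b%:M : 'rV_1) y) = a * b + dotv x y.
Proof. exact: etrans (dotv_row_mx _ _ _ _) (congr1 (+%R^~ _) (dotv_scalar _ _)). Qed.

Lemma dotv0 m (x : 'rV[R]_m) : dotv x 0 = 0.
Proof. by rewrite dotvC dot0v. Qed.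

Lemma lor_lcons (a b : R) (x y : 'rV[R]_n.+1) :
  lor (lcons a x) (lcons b y) = - (a * b) + dotv x y.
Proof.
rewrite /lor /lcons !row_consE0; congr (_ + _).
by apply: eq_bigr => i _; rewrite !row_consES.
Qed.

End LorentzProduct.

Section BlockDerivatives.
Variables (R : realType) (n : nat) (U : set 'rV[R]_n).

Lemma smooth_row_mx p q1 q2 (F : 'rV[R]_n -> 'M[R]_(p, q1))
    (G : 'rV[R]_n -> 'M[R]_(p, q2)) : open U -> smooth_mx U F -> smooth_mx U G ->
  smooth_mx U (fun u => row_mx (F u) (G u)).
Proof.
move=> oU sF sG i j; case: (splitP j) => k jk.
  apply: eq_smooth (sF i k) => // u _; rewrite (_ : j = lshift q2 k) ?row_mxEl//.
  exact: val_inj.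
apply: eq_smooth (sG i k) => // u _; rewrite (_ : j = rshift q1 k) ?row_mxEr//.
exact: val_inj.
Qed.

Lemma dmx_row_mx p q1 q2 k (F : 'rV[R]_n -> 'M[R]_(p, q1))
    (G : 'rV[R]_n -> 'M[R]_(p, q2)) u :
  dmx k (fun u => row_mx (F u) (G u)) u = row_mx (dmx k F u) (dmx k G u).
Proof.
apply/matrixP => i j; rewrite dmxE; case: (splitP j) => l jl.
  have -> : j = lshift q2 l by exact: val_inj.
  by rewrite row_mxEl dmxE; apply: eq_pd => w; rewrite row_mxEl.
have -> : j = rshift q1 l by exact: val_inj.
by rewrite row_mxEr dmxE; apply: eq_pd => w; rewrite row_mxEr.
Qed.

Lemma smooth_id : open U -> smooth_mx U (fun u => u).
Proof.
by move=> oU i j; apply: eq_smooth (smooth_coord _ j) => // u _; rewrite ord1.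
Qed.

Lemma dmx_id k (u : 'rV[R]_n) : dmx k (fun u => u) u = 'e_k.
Proof. by apply/matrixP => i j; rewrite dmxE !ord1 pd_coord mxE eqxx eq_sym. Qed.

Lemma smooth_dotvv : open U -> smooth_on U (fun u : 'rV[R]_n => dotv u u).
Proof. by move=> oU; apply: smooth_dotv => //; exact: smooth_id. Qed.

Lemma pd_dotvv k (u : 'rV[R]_n) : pd k (fun u => dotv u u) u = 2 * u 0 k.
Proof.
have d j : differentiable (fun w : 'rV[R]_n => w 0 j) u.
  exact: differentiable_coord.
rewrite pd_sum => [|j]; last exact: differentiableM.
rewrite (eq_bigr (fun j => (k == j)%:R * (2 * u 0 j))); first exact: sum_delta.
by move=> j _; rewrite pdM// !pd_coord; ring.
Qed.

End BlockDerivatives.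

(* With h = (1 + |u|^2) / 2, the null vector h (1, stereo s u) is quadratic in
   the chart coordinate u; [chart_frame] collects its first derivatives and
   [chart_pole] its (constant) second derivative. *)
Section ChartFrame.
Variables (R : realType) (n : nat) (sg : bool).
Implicit Types u v w : 'rV[R]_n.

Definition half_height u : R := (1 + dotv u u) / 2.

Let e : R := (-1) ^+ sg.
Let ee : e * e = 1. Proof. by rewrite -expr2 sqrr_sign. Qed.

Definition chart_null u : 'rV[R]_n.+2 :=
  lcons (half_height u) (row_mx (e * (half_height u - 1))%:M u).

Definition chart_frame u : 'M[R]_(n, n.+2) :=
  row_mx u^T (row_mx (e *: u^T) 1%:M).

Definition chart_pole : 'rV[R]_n.+2 := lcons 1 (row_mx e%:M 0).

Lemma half_height_gt0 u : 0 < half_height u.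
Proof. by rewrite divr_gt0// ltr_wpDr// dotv_ge0. Qed.

Lemma half_height_neq0 u : half_height u != 0.
Proof. by rewrite gt_eqF// half_height_gt0. Qed.

Lemma dotvv_half_height u : dotv u u = 2 * half_height u - 1.
Proof. by rewrite /half_height; field. Qed.

Lemma mul_chart_frame v u : v *m chart_frame u =
  lcons (dotv v u) (row_mx (e * dotv v u)%:M v).
Proof.
apply: etrans (mul_mx_row v u^T (row_mx (e *: u^T) 1%:M)) _.
by rewrite mul_mx_row mulmx1 -scalemxAr mulmx_dotv scale_scalar_mx.
Qed.

(** This and the next lemmas are the Gram relations of a null frame of the Lorentz space: two null
    vectors with product -1, and an orthonormal frame orthogonal to both. *)
Lemma lor_NN u : lor (chart_null u) (chart_null u) = 0.
Proof.
rewrite lor_lcons dotv_cons dotvv_half_height.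
by rewrite (mulrACA e) ee; ring.
Qed.

Lemma lor_NP u : lor (chart_null u) chart_pole = -1.
Proof.
rewrite lor_lcons dotv_cons dotv0 (mulrC (e * _)) mulrA ee; ring.
Qed.

Lemma lor_PP : lor chart_pole chart_pole = 0.
Proof. rewrite lor_lcons dotv_cons dot0v ee; ring. Qed.

Lemma lor_FF u v w : lor (v *m chart_frame u) (w *m chart_frame u) = dotv v w.
Proof.
rewrite !mul_chart_frame lor_lcons dotv_cons (mulrACA e) ee; ring.
Qed.

Lemma lor_FN u v : lor (v *m chart_frame u) (chart_null u) = 0.
Proof.
rewrite !mul_chart_frame lor_lcons dotv_cons (mulrACA e) ee; ring.
Qed.

Lemma lor_FP u v : lor (v *m chart_frame u) chart_pole = 0.
Proof.
rewrite mul_chart_frame lor_lcons dotv_cons dotv0 (mulrC (e * _)) mulrA ee; ring.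
Qed.

Variable U : set 'rV[R]_n.
Hypothesis oU : open U.

Lemma smooth_half_height : smooth_on U half_height.
Proof.
apply: smoothM => //; last exact: smooth_cst.
by apply: smoothD => //; [exact: smooth_cst|exact: smooth_dotvv].
Qed.

Lemma pd_half_height k u : pd k half_height u = u 0 k.
Proof.
have dd : differentiable (fun u => dotv u u) u.
  exact: (smooth_diff (U := setT) I (smooth_dotvv openT)).
have d1 : differentiable (fun u => 1 + dotv u u) u.
  by apply: differentiableD => //; exact: differentiable_cst.
rewrite (pdM (g := fun=> 2^-1) _ d1); last exact: differentiable_cst.
rewrite pd_cst mulr0 addr0 (pdD (f := fun=> 1)); [|exact: differentiable_cst|exact: dd].
by rewrite pd_cst pd_dotvv; field.
Qed.

Lemma smooth_chart_null : smooth_mx U chart_null.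
Proof.
have s0 : smooth_on U (fun u => e * (half_height u - 1)).
  apply: smoothM => //; first exact: smooth_cst.
  by apply: smoothB => //; [exact: smooth_half_height|exact: smooth_cst].
have s1 : smooth_mx U (fun u => row_mx ((e * (half_height u - 1))%:M : 'rV[R]_1) u).
  by apply: smooth_row_mx => //; [exact: smooth_mx_scalar|exact: smooth_id].
exact: smooth_row_mx oU (smooth_mx_scalar oU smooth_half_height) s1.
Qed.

Lemma smooth_chart_frame : smooth_mx U chart_frame.
Proof.
have st : smooth_mx U (fun u : 'rV[R]_n => u^T).
  by apply: smooth_mx_tr => //; exact: smooth_id.
have s1 : smooth_mx U (fun u : 'rV[R]_n => row_mx (e *: u^T) (1%:M : 'M[R]_n)).
  apply: smooth_row_mx => //; last exact: smooth_mx_cst.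
  by apply: smooth_mxZ => //; exact: smooth_cst.
exact: smooth_row_mx oU st s1.
Qed.

Lemma ddx_chart_null v u : U u -> ddx v chart_null u = v *m chart_frame u.
Proof.
move=> Uu; rewrite {2}(row_sum_delta v) mulmx_suml; apply: eq_bigr => k _.
rewrite -scalemxAl; congr (_ *: _); rewrite mul_chart_frame.
apply: etrans (dmx_row_mx k (fun u => (half_height u)%:M : 'rV[R]_1)
  (fun u => row_mx ((e * (half_height u - 1))%:M : 'rV[R]_1) u) u) _.
rewrite dmx_row_mx dmx_id (dmx_scalar _ _ Uu smooth_half_height) pd_half_height.
have sB : smooth_on U (fun u => e * (half_height u - 1)).
  apply: smoothM => //; first exact: smooth_cst.
  by apply: smoothB => //; [exact: smooth_half_height|exact: smooth_cst].
have dh := smooth_diff Uu smooth_half_height.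
have dc : differentiable (fun=> - 1 : R) u by exact: differentiable_cst.
have dB : differentiable (fun u => half_height u - 1) u.
  by apply: differentiableD.
rewrite (dmx_scalar _ _ Uu sB) (pdM (f := fun=> e) _ _ dB); last first.
  exact: differentiable_cst.
rewrite pd_cst mul0r add0r (pdD (g := fun=> -1) _ dh dc) pd_cst addr0.
by rewrite pd_half_height dotvC dotv_delta.
Qed.

Lemma ddx_chart_frame v u : U u -> ddx v chart_frame u = v^T *m chart_pole.
Proof.
move=> Uu; rewrite {2}(row_sum_delta v) linear_sum /= mulmx_suml; apply: eq_bigr => k _.
rewrite linearZ /= -scalemxAl; congr (_ *: _).
have st : smooth_mx U (fun u : 'rV[R]_n => u^T).
  by apply: smooth_mx_tr => //; exact: smooth_id.
apply: etrans (dmx_row_mx k (fun u : 'rV[R]_n => u^T)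
  (fun u => row_mx (e *: u^T) (1%:M : 'M[R]_n)) u) _.
rewrite dmx_row_mx dmx_cst (dmxZ _ Uu (smooth_cst _ e))// pd_cst scale0r add0r dmx_tr dmx_id.
apply: esym; apply: etrans (mul_mx_row _ (1%:M : 'rV[R]_1) (row_mx (e%:M : 'rV[R]_1) 0)) _.
by rewrite mul_mx_row mulmx0 !mul_mx_scalar scale1r.
Qed.

End ChartFrame.

(** * Stereographic charts and the round metric *)

Section Stereographic.
Variables (R : realType) (n : nat).
Implicit Types (u v w : 'rV[R]_n) (y : 'rV[R]_n.+1) (s : bool).

Definition stereo_null s u : 'rV[R]_n.+1 :=
  row_mx ((-1) ^+ s * (half_height u - 1))%:M u.

Definition stereo_frame s u : 'M[R]_(n, n.+1) :=
  row_mx ((-1) ^+ s *: u^T) 1%:M.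

Let ee s : (-1) ^+ s * (-1) ^+ s = 1 :> R. Proof. by rewrite -expr2 sqrr_sign. Qed.

Lemma stereoE s u : stereo s u = (half_height u)^-1 *: stereo_null s u.
Proof.
rewrite /stereo /stereo_null; have h0 := half_height_neq0 u.
have -> : dotv u u = 2 * half_height u - 1 := dotvv_half_height u.
rewrite (_ : 1 + (2 * half_height u - 1) = 2 * half_height u); last by ring.
apply/rowP => j; rewrite !scalemxE; case: (unliftP ord0 j) => [i ->|->].
  by rewrite !row_consES scalemxE; field.
by rewrite !row_consE0; field.
Qed.

Lemma mul_stereo_frame s v u :
  v *m stereo_frame s u = row_mx ((-1) ^+ s * dotv v u)%:M v.
Proof.
apply: etrans (mul_mx_row v ((-1) ^+ s *: u^T) 1%:M) _.
by rewrite mulmx1 -scalemxAr mulmx_dotv scale_scalar_mx.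
Qed.

Lemma dot_stereo_null s u :
  dotv (stereo_null s u) (stereo_null s u) = half_height u ^+ 2.
Proof. by rewrite dotv_cons (mulrACA (_ ^+ s)) ee dotvv_half_height; ring. Qed.

Lemma dot_stereo_frame_null s v u :
  dotv (v *m stereo_frame s u) (stereo_null s u) = dotv v u * half_height u.
Proof. by rewrite mul_stereo_frame dotv_cons (mulrACA (_ ^+ s)) ee; ring. Qed.

Lemma dot_stereo_frame s v w u :
  dotv (v *m stereo_frame s u) (w *m stereo_frame s u) =
  dotv v u * dotv w u + dotv v w.
Proof. by rewrite !mul_stereo_frame dotv_cons (mulrACA (_ ^+ s)) ee; ring. Qed.

Lemma stereo_sphere s u : sphere (stereo s u).
Proof.
have h0 := half_height_neq0 u.
by rewrite /sphere /= stereoE dotvZl dotvZr dot_stereo_null; field.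
Qed.

Lemma stereoE0 s u : (stereo s u) 0 0 =
  (-1) ^+ s * (half_height u - 1) / half_height u.
Proof.
by rewrite stereoE scalemxE row_consE0 mulrC.
Qed.

Lemma stereoES s u i : (stereo s u) 0 (lift ord0 i) = u 0 i / half_height u.
Proof.
by rewrite stereoE scalemxE row_consES mulrC.
Qed.

Definition stereo_inv s y : 'rV[R]_n :=
  \row_j (y 0 (lift ord0 j) * (1 - (-1) ^+ s * y 0 0)^-1).

Lemma stereo_not_pole s u : 1 - (-1) ^+ s * (stereo s u) 0 0 = (half_height u)^-1.
Proof.
have h0 := half_height_neq0 u.
by rewrite stereoE0 !mulrA ee; field.
Qed.

Lemma stereoK s u : stereo_inv s (stereo s u) = u.
Proof.
apply/rowP => j; rewrite mxE stereo_not_pole invrK stereoES mulfVK//.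
exact: half_height_neq0.
Qed.

Lemma dotv_recl y z : dotv y z = y 0 0 * z 0 0
  + \sum_(j < n) y 0 (lift ord0 j) * z 0 (lift ord0 j).
Proof. by rewrite /dotv big_ord_recl. Qed.

Lemma stereo_invK s y : sphere y -> 1 - (-1) ^+ s * y 0 0 != 0 ->
  stereo s (stereo_inv s y) = y.
Proof.
rewrite /sphere /= => yy; set d := 1 - _ => d0.
have uu : dotv (stereo_inv s y) (stereo_inv s y) = (1 - y 0 0 ^+ 2) / d ^+ 2.
  rewrite /dotv (eq_bigr (fun j => y 0 (lift ord0 j) * y 0 (lift ord0 j) / d ^+ 2)).
    rewrite -mulr_suml; congr (_ / _).
    by apply/eqP; rewrite eq_sym subr_eq -yy dotv_recl expr2 addrC.
  by move=> j _; rewrite !mxE -/d; field.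
have hE : half_height (stereo_inv s y) = d^-1.
  rewrite /half_height uu; have e2 := ee s.
  have -> : 1 - y 0 0 ^+ 2 = d * (2 - d).
    rewrite /d (_ : _ * _ = 1 - ((-1) ^+ s * (-1) ^+ s) * y 0 0 ^+ 2); last by ring.
    by rewrite e2 mul1r.
  by field.
apply/rowP => j; case: (unliftP ord0 j) => [i ->|->].
  by rewrite stereoES hE invrK mxE -/d mulfVK.
rewrite stereoE0 hE invrK -mulrA (_ : (d^-1 - 1) * d = (-1) ^+ s * y 0 0).
  by rewrite mulrA ee mul1r.
by rewrite mulrBl mulVf// mul1r /d opprB addrC subrK.
Qed.

Lemma chart_exists y : sphere y -> exists s u, stereo s u = y.
Proof.
move=> yS; have [y0|y0] := eqVneq (y 0 0) 1.
  exists true, (stereo_inv true y); apply: stereo_invK => //.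
  by rewrite y0 expr1 mulN1r opprK.
exists false, (stereo_inv false y); apply: stereo_invK => //.
by rewrite expr0 mul1r subr_eq0 eq_sym.
Qed.

Variable U : set 'rV[R]_n.
Hypothesis oU : open U.

Lemma smooth_stereo_null s : smooth_mx U (stereo_null s).
Proof.
have s0 : smooth_on U (fun u => (-1) ^+ s * (half_height u - 1)).
  apply: smoothM => //; first exact: smooth_cst.
  by apply: smoothB => //; [exact: smooth_half_height|exact: smooth_cst].
exact: (smooth_row_mx oU (smooth_mx_scalar oU s0) (smooth_id oU)).
Qed.

Lemma smooth_inv_half_height : smooth_on U (fun u => (half_height u)^-1).
Proof.
apply: smoothV => //; last exact: smooth_half_height.
by move=> u _; exact: half_height_neq0.
Qed.

Lemma smooth_stereo s : smooth_mx U (stereo s).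
Proof.
apply: (eq_smooth_mx oU (F := fun u => (half_height u)^-1 *: stereo_null s u)).
  by move=> u _; rewrite stereoE.
apply: smooth_mxZ => //; first exact: smooth_inv_half_height.
exact: smooth_stereo_null.
Qed.

Lemma ddx_stereo_null s v u : U u -> ddx v (stereo_null s) u = v *m stereo_frame s u.
Proof.
move=> Uu; rewrite {2}(row_sum_delta v) mulmx_suml; apply: eq_bigr => k _.
rewrite -scalemxAl; congr (_ *: _); rewrite mul_stereo_frame.
apply: etrans (dmx_row_mx k (fun u => ((-1) ^+ s * (half_height u - 1))%:M : 'rV[R]_1)
  (fun u => u) u) _.
have dh := smooth_diff Uu (smooth_half_height oU).
have sB : smooth_on U (fun u => (-1) ^+ s * (half_height u - 1)).
  apply: smoothM => //; first exact: smooth_cst.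
  by apply: smoothB => //; [exact: smooth_half_height|exact: smooth_cst].
have dc : differentiable (fun=> - 1 : R) u by exact: differentiable_cst.
have dB : differentiable (fun u => half_height u - 1) u.
  by apply: differentiableD.
rewrite dmx_id (dmx_scalar _ _ Uu sB) (pdM (f := fun=> (-1) ^+ s) _ _ dB); last first.
  exact: differentiable_cst.
rewrite pd_cst mul0r add0r (pdD (g := fun=> -1) _ dh dc) pd_cst addr0.
by rewrite pd_half_height dotvC dotv_delta.
Qed.

Lemma pd_inv_half_height k u : pd k (fun u => (half_height u)^-1) u =
  - u 0 k / half_height u ^+ 2.
Proof.
have h0 := half_height_neq0 u.
have dh : differentiable (@half_height R n) u.
  exact: (smooth_diff (U := setT) I (smooth_half_height openT)).
have di : differentiable (fun u => (half_height u)^-1) u.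
  exact: differentiableV.
have : pd k (fun u : 'rV[R]_n => half_height u * (half_height u)^-1) u = 0.
  rewrite -(pd_cst 1 k u); apply: eq_pd => w; rewrite mulfV//.
  exact: half_height_neq0.
rewrite pdM// pd_half_height => /eqP; rewrite addrC addr_eq0 => /eqP e.
apply: (mulfI h0); rewrite e; by field.
Qed.

Lemma ddx_stereo s v u : U u -> ddx v (stereo s) u =
  (half_height u)^-1 *: (v *m stereo_frame s u)
  - (dotv v u / half_height u ^+ 2) *: stereo_null s u.
Proof.
move=> Uu; rewrite (eq_ddx oU v Uu (fun u _ => stereoE s u)).
rewrite (ddxZ _ Uu smooth_inv_half_height (smooth_stereo_null s)) ddx_stereo_null//.
rewrite addrC; congr (_ + _); rewrite -scaleNr; congr (_ *: _).
rewrite (eq_bigr (fun k => (v 0 k * u 0 k) * (- (half_height u ^+ 2)^-1))).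
  by rewrite -mulr_suml mulrN.
by move=> k _; rewrite pd_inv_half_height mulrA mulrN mulNr mulrN.
Qed.

Lemma mul_jac m (F : 'rV[R]_n -> 'rV[R]_m) v u : v *m jac F u = ddx v F u.
Proof.
rewrite {1}(row_sum_delta v) mulmx_suml; apply: eq_bigr => k _.
by rewrite -scalemxAl -rowE row_jac.
Qed.

Lemma dot_jac_stereo s v w u : U u ->
  dotv (v *m jac (stereo s) u) (w *m jac (stereo s) u) = dotv v w / half_height u ^+ 2.
Proof.
move=> Uu; have h0 := half_height_neq0 u.
rewrite !mul_jac !ddx_stereo// !(dotvBl, dotvBr, dotvZl, dotvZr).
rewrite (dotvC (stereo_null s u) (_ *m _)) !dot_stereo_frame_null dot_stereo_null.
by rewrite dot_stereo_frame; field.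
Qed.

Lemma dot_jac_stereo_stereo s v u : U u ->
  dotv (v *m jac (stereo s) u) (stereo s u) = 0.
Proof.
move=> Uu; have h0 := half_height_neq0 u.
rewrite mul_jac ddx_stereo// stereoE !(dotvBl, dotvZl, dotvZr).
by rewrite dot_stereo_frame_null dot_stereo_null; field.
Qed.

End Stereographic.

Section RoundMetric.
Variables (R : realType) (n : nat).
Implicit Types (u : 'rV[R]_n) (s : bool) (rho : 'rV[R]_n.+1 -> R).

Lemma round_metricE s u : round_metric s u = (half_height u ^- 2)%:M.
Proof.
apply/matrixP => i j; transitivity (dotv ('e_i *m jac (stereo s) u) ('e_j *m jac (stereo s) u)).
  rewrite /round_metric -!rowE; move: (jac _ _) => J.
  by rewrite mxE; apply: eq_bigr => k _; rewrite !mxE.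
rewrite (dot_jac_stereo openT)// dotv_delta !mxE eqxx mulr_natl /=.
by rewrite eq_sym; case: (i == j); rewrite ?mul1r ?mul0r.
Qed.

(** The function sigma of the overview: the round metric is [half_height u ^- 2] times the flat
    one. *)
Definition chart_factor rho s u : R := rho (stereo s u) - ln (half_height u).

Lemma conf_metricE rho s :
  conf_metric rho s = fun u => (expR (2 * chart_factor rho s u))%:M.
Proof.
apply/funext => u; rewrite /conf_metric round_metricE scale_scalar_mx; congr _%:M.
rewrite /chart_factor mulrBr expRD expRN (mulr_natl (ln _)) mulr2n expRD.
by rewrite lnK ?posrE ?half_height_gt0// expr2.
Qed.

End RoundMetric.

(** * Change of chart, connectedness, and the gradient on the sphere *)

Section ChartChange.
Variables (R : realType) (n : nat).
Implicit Types (u v w : 'rV[R]_n) (y : 'rV[R]_n.+1) (s : bool).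

Lemma open_preimage m k (F : 'rV[R]_m -> 'rV[R]_k) (O : set 'rV[R]_k) :
  smooth_mx setT F -> open O -> open (F @^-1` O).
Proof.
move=> sF; apply: open_comp => w _.
apply/differentiable_continuous/differentiable_rV => j.
exact: (smooth_diff I (sF 0 j)).
Qed.

Lemma open_coord_neq m (f : 'rV[R]_m -> R) : smooth_on setT f ->
  open [set w | f w != 0].
Proof.
move=> sf; apply: (@open_comp 'rV[R]_m R f [set x : R | x != 0]); last exact: open_neq.
move=> w _; exact/differentiable_continuous/(smooth_diff I sf).
Qed.

(** [D] is the Jacobian matrix of the transition map and is quantified before [f]: one matrix serves
    all functions, in particular the coordinates of the sphere and [rho] at the same time. *)
Lemma chart_change s s' u u' : stereo s u = stereo s' u' ->
  exists D : 'M[R]_n, forall f : 'rV[R]_n.+1 -> R,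
    differentiable (f \o stereo s) u -> forall i,
    pd i (f \o stereo s') u' = \sum_j D i j * pd j (f \o stereo s) u.
Proof.
move=> e.
pose g w : R := 1 - (-1) ^+ s * (stereo s' w) 0 0.
have sst := smooth_stereo (@openT 'rV[R]_n) s'.
have sg : smooth_on setT g.
  apply: smoothB; [exact: openT|exact: smooth_cst|].
  by apply: smoothM; [exact: openT|exact: smooth_cst|exact: sst].
pose O := [set w | g w != 0].
have oO : open O := open_coord_neq sg.
have Ou : O u'.
  by rewrite /O /= /g -e stereo_not_pole invr_eq0 half_height_neq0.
pose tau w := stereo_inv s (stereo s' w).
have stau : smooth_mx O tau.
  move=> i j; apply: (eq_smooth oO (f := fun w =>
      (stereo s' w) 0 (lift ord0 j) * (g w)^-1)).
    by move=> w _; rewrite /tau /stereo_inv [RHS]mxE.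
  apply: smoothM => //; first exact: (smooth_stereo oO).
  apply: smoothV => //.
  apply: smoothB => //; first exact: smooth_cst.
  by apply: smoothM => //; [exact: smooth_cst|exact: (smooth_stereo oO)].
have tauu : tau u' = u by rewrite /tau -e stereoK.
exists (\matrix_(i, j) pd i (fun w => tau w 0 j) u') => f df i.
have E : forall w, O w -> (f \o stereo s') w = (f \o stereo s) (tau w).
  by move=> w Ow; rewrite /= stereo_invK//; exact: stereo_sphere.
rewrite (eq_pd_on i oO Ou E) pd_comp; first last.
- by rewrite tauu.
- by move=> j; exact: smooth_diff Ou (stau 0 j).
by rewrite tauu; apply: eq_bigr => j _; rewrite mxE.
Qed.

(** Continuity of [stereo_inv] away from the omitted pole carries a property valid near a chart
    point to the nearby points of the sphere. *)
Lemma near_stereo_inv y (s : bool) (P : 'rV[R]_n -> Prop) : sphere y ->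
  1 - (-1) ^+ s * y 0 0 != 0 -> (\forall w \near stereo_inv s y, P w) ->
  \forall z \near y, sphere z -> exists2 w, stereo s w = z & P w.
Proof.
move=> yS y0 NP; pose g (z : 'rV[R]_n.+1) : R := 1 - (-1) ^+ s * z 0 0.
have sg : smooth_on setT g.
  apply: smoothB; [exact: openT|exact: smooth_cst|].
  by apply: smoothM; [exact: openT|exact: smooth_cst|exact: smooth_coord].
pose O := [set z | g z != 0].
have oO : open O := open_coord_neq sg.
have ci : {for y, continuous (stereo_inv s)}.
  apply/differentiable_continuous/differentiable_rV => j.
  have : smooth_on O (fun z : 'rV[R]_n.+1 => z 0 (lift ord0 j) * (g z)^-1).
    apply: smoothM => //; first exact: smooth_coord.
    apply: smoothV => //; apply: smoothB => //; first exact: smooth_cst.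
    by apply: smoothM => //; [exact: smooth_cst|exact: smooth_coord].
  move/(smooth_diff (y0 : O y)).
  have -> // : (fun z : 'rV[R]_n.+1 => z 0 (lift ord0 j) * (g z)^-1) = (fun z => stereo_inv s z 0 j).
  by apply/funext => z; rewrite mxE.
have N1 : \forall z \near y, P (stereo_inv s z) := ci _ NP.
have N2 : \forall z \near y, O z by exact: open_nbhs_nbhs.
near=> z => zS.
have Pz : P (stereo_inv s z) by near: z.
have Oz : O z by near: z.
by exists (stereo_inv s z) => //; exact: stereo_invK.
Unshelve. all: by end_near. Qed.

Lemma sphere_domain_open s (Omega : set 'rV[R]_n.+1) :
  sphere_domain Omega -> open [set u | Omega (stereo s u)].
Proof.
case=> -[W oW ->] _ _; rewrite (_ : [set u | _] = stereo s @^-1` W).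
  by apply: open_preimage => //; apply: smooth_stereo; exact: openT.
by apply/seteqP; split=> u /=; [case|split=> //; exact: stereo_sphere].
Qed.

(** Local constancy is an equivalence, so [P] and its complement are both relatively open in the
    connected set [Omega]. This is the passage from local to global used for all focal maps. *)
Lemma sphere_domain_clopen (Omega P : set 'rV[R]_n.+1) : sphere_domain Omega ->
  (forall s u, Omega (stereo s u) ->
    \forall w \near u, P (stereo s w) <-> P (stereo s u)) ->
  forall x y, Omega x -> Omega y -> P x -> P y.
Proof.
move=> [[W oW WE] cO _] loc x y Ox Oy Px.
have subS z : Omega z -> sphere z by rewrite WE => -[].
have {}loc z : Omega z -> \forall t \near z, Omega t -> (P t <-> P z).
  move=> Oz; have zS := subS z Oz.
  have [s s0] : exists s : bool, 1 - (-1) ^+ s * z 0 0 != 0.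
    have [z0|z0] := eqVneq (z 0 0) 1.
      by exists true; rewrite z0 expr1 mulN1r opprK.
    by exists false; rewrite expr0 mul1r subr_eq0 eq_sym.
  have e := stereo_invK zS s0.
  have := loc s (stereo_inv s z); rewrite e => /(_ Oz) H.
  have := near_stereo_inv zS s0 H; apply: filterS => t Ht Ot.
  by have [w <- Pw] := Ht (subS t Ot).
have BE : Omega `&` P = Omega.
  apply: cO; first by exists x.
  (* The implication inside the interior makes points outside [Omega] harmless, so that an open set
     of the ambient space cuts out [P]. *)
  - exists (interior [set t | Omega t -> P t]); first exact: open_interior.
    apply/seteqP; split=> t [Ot Pt]; split=> //.
      by have := loc t Ot; apply: filterS => r Hr Or; apply/(Hr Or).
    by have := interior_subset Pt; exact.
  - exists (~` (interior [set t | Omega t -> ~ P t])).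
      by apply: open_closedC; exact: open_interior.
    apply/seteqP; split=> t [Ot Pt]; split=> //.
      by move=> /interior_subset/(_ Ot).
    apply: contrapT => nP; apply: Pt.
    have := loc t Ot; apply: filterS => r Hr Or Pr; apply: nP; exact/(Hr Or).
by move: Oy; rewrite -BE => -[].
Qed.

(** Stacking [x] and the rows of [h *: J] gives an orthogonal matrix, so a vector orthogonal to all
    of its rows is zero. This yields the uniqueness of the gradient. *)
Lemma orthonormal_frame_spans (x c : 'rV[R]_n.+1) (J : 'M[R]_(n, n.+1)) (h : R) :
  h != 0 -> dotv x x = 1 -> J *m J^T = (h ^- 2)%:M -> J *m x^T = 0 ->
  dotv c x = 0 -> J *m c^T = 0 -> c = 0.
Proof.
move=> h0 x1 JJ Jx cx Jc; pose Q : 'M[R]_(1 + n) := col_mx x (h *: J).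
have xJ : x *m J^T = 0 by rewrite -[LHS]trmxK trmx_mul trmxK Jx trmx0.
have cJ : c *m J^T = 0 by rewrite -[LHS]trmxK trmx_mul trmxK Jc trmx0.
have QQ : Q *m Q^T = 1%:M.
  rewrite tr_col_mx mul_col_row mulmx_dotv x1 linearZ /= -!scalemxAl -!scalemxAr.
  rewrite JJ Jx xJ !scaler0 !scale_scalar_mx (_ : _ * (_ * _) = 1); last by field.
  by rewrite -scalar_mx_block.
have cQ : c *m Q^T = 0.
  rewrite tr_col_mx mul_mx_row mulmx_dotv cx linearZ /= -scalemxAr cJ scaler0.
  by apply/rowP => j; rewrite !mxE; case: splitP => k _; rewrite !mxE ?mul0rn.
by rewrite -[c]mulmx1 -(mulmx1C QQ) mulmxA cQ mul0mx.
Qed.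

(** The factor [half_height u ^+ 2] inverts the round metric. The set in [sphere_grad] refers to all
    charts through the point, so membership needs [chart_change]. *)
Lemma sphere_gradE rho s u : differentiable (rho \o stereo s) u ->
  sphere_grad rho (stereo s u) =
  half_height u ^+ 2 *: (grad_at (rho \o stereo s) u *m jac (stereo s) u).
Proof.
move=> dr; set v := _ *: _; have h0 := half_height_neq0 u.
have vT m : dotv v (m *m jac (stereo s) u) = dotv (grad_at (rho \o stereo s) u) m.
  by rewrite dotvZl (dot_jac_stereo openT)//; field.
have sst := smooth_stereo (@openT 'rV[R]_n) s.
apply: xget_subset1.
  split; first by rewrite dotvZl (dot_jac_stereo_stereo openT)// mulr0.
  move=> s' u' e i; have [D HD] := chart_change (esym e).
  rewrite partialE HD// {1}/dotv.
  rewrite (eq_bigr (fun k => v 0 k * \sum_j D i j * (row j (jac (stereo s) u)) 0 k)).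
    under eq_bigr do rewrite mulr_sumr.
    rewrite exchange_big /=; apply: eq_bigr => j _.
    have := vT 'e_j; rewrite -rowE dotv_delta mxE => <-.
    by rewrite /dotv mulr_sumr; apply: eq_bigr => k _; ring.
  move=> k _; congr (_ * _); rewrite [LHS]mxE [LHS]mxE partialE.
  have := HD (fun x => x 0 k); rewrite /comp => -> //.
    by apply: eq_bigr => j _; rewrite !mxE partialE.
  exact: (smooth_diff I (sst 0 k)).
move=> a b [a0 aP] [b0 bP]; apply/eqP; rewrite -subr_eq0; apply/eqP.
pose c := a - b.
have c0 : dotv c (stereo s u) = 0 by rewrite dotvBl a0 b0 subrr.
have cP m : dotv c (m *m jac (stereo s) u) = 0.
  rewrite {1}(row_sum_delta m) mulmx_suml.
  have -> : dotv c (\sum_i (m 0 i *: 'e_i) *m jac (stereo s) u)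
      = \sum_i m 0 i * dotv c (row i (jac (stereo s) u)).
    rewrite dotvE linear_sum /= mulmx_sumr summxE; apply: eq_bigr => i _.
    by rewrite -scalemxAl -rowE -dotvE dotvZr.
  apply: big1 => i _.
  by rewrite dotvBl (aP s u erefl i) (bP s u erefl i) subrr mulr0.
apply: (orthonormal_frame_spans h0 (stereo_sphere s u) (round_metricE s u)) => //.
  apply/row_matrixP => i; rewrite row_mul row0 mulmx_dotv rowE.
  rewrite (dot_jac_stereo_stereo openT)//.
  by apply/matrixP => k l; rewrite !mxE mul0rn.
apply/row_matrixP => i; rewrite row_mul row0 mulmx_dotv rowE dotvC cP.
by apply/matrixP => k l; rewrite !mxE mul0rn.
Qed.

End ChartChange.

(** * The associated hypersurface *)

(* The associated hypersurface in a chart: phi + eta = e^sigma N is the null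
   vector e^rho (1, x), whose derivative along v is e^sigma (v *m horo_frame). *)
HB.lock Definition horo_null (R : realType) n (sg : bool) (sigma : 'rV[R]_n -> R) u
  : 'rV[R]_n.+2 := expR (sigma u) *: chart_null sg u.

HB.lock Definition horo_frame (R : realType) n (sg : bool) (sigma : 'rV[R]_n -> R) u
  : 'M[R]_(n, n.+2) := chart_frame sg u + (grad_at sigma u)^T *m chart_null sg u.

(** The first summand is the null vector orthogonal to [horo_frame] and with product -1 with
    [horo_null]; adding half of [horo_null] to it gives norm -1. *)
HB.lock Definition horo_map (R : realType) n (sg : bool) (sigma : 'rV[R]_n -> R) u
  : 'rV[R]_n.+2 :=
  expR (- sigma u) *: (chart_pole R n sg + grad_at sigma u *m chart_frame sg u
     + (dotv (grad_at sigma u) (grad_at sigma u) / 2) *: chart_null sg u)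
  + (expR (sigma u) / 2) *: chart_null sg u.

Section HoroChart.
Variables (R : realType) (n : nat) (sg : bool) (U : set 'rV[R]_n).
Variable sigma : 'rV[R]_n -> R.
Hypothesis oU : open U.
Hypothesis ssig : smooth_on U sigma.
Implicit Types u v w : 'rV[R]_n.

Local Notation N := (chart_null sg).
Local Notation F := (chart_frame sg).
Local Notation P := (chart_pole R n sg).
Local Notation g := (grad_at sigma).
Local Notation H := (hess_at sigma).
Local Notation A := (flat_schouten_op sigma).
Local Notation psi := (horo_null sg sigma).
Local Notation Ft := (horo_frame sg sigma).
Local Notation phi := (horo_map sg sigma).

Lemma horo_nullE u : psi u = expR (sigma u) *: N u.
Proof. by rewrite horo_null.unlock. Qed.

Lemma horo_frameE u : Ft u = F u + (g u)^T *m N u.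
Proof. by rewrite horo_frame.unlock. Qed.

Lemma horo_mapE u : phi u = expR (- sigma u) *:
  (P + g u *m F u + (dotv (g u) (g u) / 2) *: N u) + (expR (sigma u) / 2) *: N u.
Proof. by rewrite horo_map.unlock. Qed.

Lemma mul_horo_frame v u : v *m Ft u = v *m F u + dotv v (g u) *: N u.
Proof. by rewrite horo_frameE mulmxDr mulmx_tr_row. Qed.

Let eE u : expR (- sigma u) * expR (sigma u) = 1.
Proof. by rewrite -expRD addNr expR0. Qed.

Lemma lor_frame_frame v w u : lor (v *m Ft u) (w *m Ft u) = dotv v w.
Proof.
rewrite !mul_horo_frame !(lorDl, lorDr, lorZl, lorZr) lor_FF lor_FN lor_NN.
by rewrite lorC lor_FN; ring.
Qed.

Lemma lor_frame_null v u : lor (v *m Ft u) (psi u) = 0.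
Proof.
rewrite mul_horo_frame horo_nullE !(lorDl, lorZl, lorZr) lor_FN lor_NN.
by ring.
Qed.

Lemma lor_null_null u : lor (psi u) (psi u) = 0.
Proof. by rewrite horo_nullE !(lorZl, lorZr) lor_NN !mulr0. Qed.

Lemma lor_null_map u : lor (psi u) (phi u) = -1.
Proof.
rewrite horo_nullE horo_mapE !(lorDr, lorZl, lorZr) lor_NN lor_NP lorC lor_FN.
have := eE u; move: (expR _) (expR _) => a b ab.
transitivity (- (b * a)); last by rewrite ab.
by ring.
Qed.

Lemma lor_map_map u : lor (phi u) (phi u) = -1.
Proof.
rewrite horo_mapE !(lorDr, lorDl, lorZl, lorZr) !(lorC P) lor_NN lor_NP lor_PP lor_FF.
rewrite (lorC (N u)) lor_FN lor_FP.
have := eE u; move: (expR _) (expR _) => a b ab.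
transitivity (- (b * a)); last by rewrite ab.
by field.
Qed.

Lemma lor_frame_map v u : lor (v *m Ft u) (phi u) = 0.
Proof.
rewrite mul_horo_frame horo_mapE !(lorDr, lorDl, lorZl, lorZr).
rewrite lor_FN lor_FP lor_FF lor_NN lor_NP (lorC (N u)) lor_FN.
by ring.
Qed.

Let sE : smooth_on U (fun u => expR (sigma u)). Proof. exact: smooth_expR. Qed.
Let sEN : smooth_on U (fun u => expR (- sigma u)).
Proof. by apply: smooth_expR => //; exact: smoothN. Qed.
Let sN : smooth_mx U N. Proof. exact: smooth_chart_null. Qed.
Let sF : smooth_mx U F. Proof. exact: smooth_chart_frame. Qed.
Let sg_ : smooth_mx U g. Proof. exact: smooth_grad. Qed.
Let sgt : smooth_mx U (fun u => (g u)^T). Proof. exact: smooth_mx_tr. Qed.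
Let sgg : smooth_on U (fun u => dotv (g u) (g u) / 2).
Proof. by apply: smoothM => //; [exact: smooth_dotv|exact: smooth_cst]. Qed.

Let sX : smooth_mx U (fun u => P + g u *m F u + (dotv (g u) (g u) / 2) *: N u).
Proof.
apply: smooth_mxD => //; last exact: smooth_mxZ.
by apply: smooth_mxD => //; [exact: smooth_mx_cst|exact: smooth_mxM].
Qed.

Lemma smooth_horo_null : smooth_mx U psi.
Proof.
apply: (eq_smooth_mx oU (F := fun u => expR (sigma u) *: N u)).
  by move=> u _; rewrite horo_nullE.
exact: smooth_mxZ.
Qed.

Lemma smooth_horo_frame : smooth_mx U Ft.
Proof.
apply: (eq_smooth_mx oU (F := fun u => F u + (g u)^T *m N u)).
  by move=> u _; rewrite horo_frameE.
by apply: smooth_mxD => //; exact: smooth_mxM.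
Qed.

Lemma smooth_horo_map : smooth_mx U phi.
Proof.
apply: (eq_smooth_mx oU (F := fun u => expR (- sigma u) *:
  (P + g u *m F u + (dotv (g u) (g u) / 2) *: N u) + (expR (sigma u) / 2) *: N u)).
  by move=> u _; rewrite horo_mapE.
apply: smooth_mxD => //; first exact: smooth_mxZ.
by apply: smooth_mxZ => //; apply: smoothM => //; exact: smooth_cst.
Qed.

Let dsum_exp v u : U u ->
  \sum_k v 0 k * pd k (fun u => expR (sigma u)) u = expR (sigma u) * dotv v (g u).
Proof.
move=> Uu; rewrite mulr_sumr; apply: eq_bigr => k _.
by rewrite pd_expR ?mxE; [ring|exact: smooth_diff Uu ssig].
Qed.

Let dsum_expN v u : U u ->
  \sum_k v 0 k * pd k (fun u => expR (- sigma u)) u = - expR (- sigma u) * dotv v (g u).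
Proof.
move=> Uu; rewrite mulr_sumr; apply: eq_bigr => k _.
have ds := smooth_diff Uu ssig.
rewrite (pd_expR (f := fun u => - sigma u)); last exact: differentiableN.
by rewrite pdN// mxE; ring.
Qed.

Let dsum_gg v u : U u ->
  \sum_k v 0 k * pd k (fun u => dotv (g u) (g u) / 2) u = dotv (v *m H u) (g u).
Proof.
move=> Uu.
have dj j : differentiable (fun w => g w 0 j) u by exact: smooth_diff Uu (sg_ 0 j).
have dgg : differentiable (fun u => dotv (g u) (g u)) u.
  by apply: differentiable_sumf => j; apply: differentiableM.
rewrite (eq_bigr (fun k => \sum_j v 0 k * H u k j * g u 0 j)); last first.
  move=> k _; rewrite (pdM (g := fun=> 2^-1) _ dgg); last exact: differentiable_cst.
  rewrite pd_cst mulr0 addr0 pd_sum => [|j]; last exact: differentiableM.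
  rewrite mulrA mulr_sumr mulr_suml; apply: eq_bigr => j _; rewrite pdM//.
  by rewrite (eq_pd k u (g := pd j sigma)) ?mxE; [field|move=> w; rewrite mxE].
rewrite exchange_big /=; apply: eq_bigr => j _.
by rewrite -mulr_suml [(_ *m _) 0 j]mxE.
Qed.

Lemma ddx_horo_null v u : U u -> ddx v psi u = expR (sigma u) *: (v *m Ft u).
Proof.
move=> Uu; rewrite (eq_ddx oU v Uu (fun u _ => horo_nullE u)) (ddxZ _ Uu sE sN).
rewrite dsum_exp// (ddx_chart_null _ oU)// mul_horo_frame.
by mx_linear.
Qed.

Lemma ddx_horo_map v u : U u ->
  ddx v phi u = expR (sigma u) *: ((2^-1 *: v - v *m A u) *m Ft u).
Proof.
move=> Uu; rewrite (eq_ddx oU v Uu (fun u _ => horo_mapE u)).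
have sh : smooth_on U (fun u => expR (sigma u) / 2).
  by apply: smoothM => //; exact: smooth_cst.
have dh : \sum_k v 0 k * pd k (fun u => expR (sigma u) / 2) u =
    expR (sigma u) * dotv v (g u) / 2.
  rewrite -dsum_exp// mulr_suml; apply: eq_bigr => k _.
  rewrite (pdM (g := fun=> 2^-1)); [|exact: smooth_diff Uu sE|exact: differentiable_cst].
  by rewrite pd_cst; ring.
rewrite (ddxD _ Uu); [|exact: smooth_mxZ|exact: smooth_mxZ].
rewrite (ddxZ _ Uu sEN sX) (ddxZ _ Uu sh sN) dh dsum_expN//.
have sgF : smooth_mx U (fun u => g u *m F u) by exact: smooth_mxM.
have sggN : smooth_mx U (fun u => (dotv (g u) (g u) / 2) *: N u) by exact: smooth_mxZ.
have sP : smooth_mx U (fun=> P) by exact: smooth_mx_cst.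
have sPgF : smooth_mx U (fun u => P + g u *m F u).
  by apply: smooth_mxD => //; exact: smooth_mx_cst.
rewrite (ddxD _ Uu sPgF sggN) (ddxD _ Uu sP sgF) ddx_cst add0r.
rewrite (ddxM _ Uu sg_ sF) (ddxZ _ Uu sgg sN) dsum_gg//.
rewrite ddx_grad (ddx_chart_null _ oU)// (ddx_chart_frame _ oU)// mulmx_tr_row.
have -> : expR (sigma u) *: ((2^-1 *: v - v *m A u) *m Ft u) =
    expR (sigma u) *: (2^-1 *: (v *m Ft u))
    - expR (- sigma u) *: ((v *m flat_schouten sigma u) *m Ft u).
  rewrite mulmxBl -scalemxAr -!scalemxAl scalerBr [in X in _ - X]scalerA.
  rewrite -expRD (_ : sigma u + _ = - sigma u)//; ring.
rewrite (row_schouten sigma v u) !mulmxBl -!scalemxAl !mul_horo_frame (dotvC (g u) v).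
by apply/matrixP => i j; rewrite !(addmxE, oppmxE, scalemxE); field.
Qed.

(** The structure equation of the moving frame: a tangential part given by the connection, and a
    normal part along the two null vectors phi - psi/2 and psi. *)
Lemma ddx_horo_frame v u : U u -> ddx v Ft u = - (conn sigma v u *m Ft u)
  + expR (sigma u) *: (v^T *m (phi u - 2^-1 *: psi u) - (v *m A u)^T *m psi u).
Proof.
move=> Uu; rewrite (eq_ddx oU v Uu (fun u _ => horo_frameE u)).
have sgN : smooth_mx U (fun u => (g u)^T *m N u) by exact: smooth_mxM.
rewrite (ddxD _ Uu sF sgN) (ddxM _ Uu sgt sN) ddx_tr ddx_grad.
rewrite (ddx_chart_null _ oU)// (ddx_chart_frame _ oU)//.
have -> : conn sigma v u *m Ft u = v^T *m (g u *m Ft u) - (g u)^T *m (v *m Ft u).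
  by rewrite connE wedgeE mulmxBl !mulmxA.
have -> : expR (sigma u) *: (v^T *m (phi u - 2^-1 *: psi u) - (v *m A u)^T *m psi u) =
    v^T *m (expR (sigma u) *: (phi u - 2^-1 *: psi u))
    - (v *m flat_schouten sigma u)^T *m N u.
  rewrite scalerBr scalemxAr horo_nullE; congr (_ - _).
  have vA : v *m A u = expR (- (2 * sigma u)) *: (v *m flat_schouten sigma u).
    by rewrite -scalemxAr.
  rewrite vA [(_ *: _)^T]linearZ /= -scalemxAl -scalemxAr !scalerA -!expRD.
  by rewrite (_ : _ + _ = 0) ?expR0 ?scale1r//; ring.
have -> : expR (sigma u) *: (phi u - 2^-1 *: psi u) = P + g u *m F u
    + (dotv (g u) (g u) / 2) *: N u.
  rewrite horo_mapE horo_nullE [2^-1 *: _]scalerA [2^-1 * _]mulrC addrK scalerA.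
  rewrite [X in X *: _]mulrC eE scale1r.
  by [].
have trE p q (M : 'M[R]_(p, q)) i j : M^T i j = M j i by rewrite mxE.
have -> : (v *m flat_schouten sigma u)^T = dotv v (g u) *: (g u)^T - (v *m H u)^T
    - (dotv (g u) (g u) / 2) *: v^T.
  rewrite (row_schouten sigma v u); apply/matrixP => i j.
  by rewrite !(addmxE, oppmxE, scalemxE, trE).
rewrite !mul_horo_frame !mulmxDr !mulmxBl -!scalemxAr -!scalemxAl.
by apply/matrixP => i j; rewrite !(addmxE, oppmxE, scalemxE); field.
Qed.

End HoroChart.

(** * Focal maps *)

Lemma ddx_delta (R : realType) n p q k (F : 'rV[R]_n -> 'M[R]_(p, q)) u :
  ddx 'e_k F u = dmx k F u.
Proof.
rewrite /ddx (bigD1 k)//= big1 => [|l lk]; last first.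
  by rewrite mxE eqxx (negbTE lk) scale0r.
by rewrite mxE !eqxx scale1r addr0.
Qed.

Section LorentzDerivative.
Variables (R : realType) (n m : nat) (U : set 'rV[R]_n) (F : 'rV[R]_n -> 'rV[R]_m.+2).
Variable z : 'rV[R]_m.+2.
Hypothesis oU : open U.
Hypothesis sF : smooth_mx U F.

Let G w := F w *m (lorentz_form R m *m z^T).

Let lorG w : lor (F w) z = G w 0 0. Proof. by rewrite lorE /G mulmxA. Qed.

Let sc : smooth_mx U (fun=> lorentz_form R m *m z^T). Proof. exact: smooth_mx_cst. Qed.

Lemma smooth_lor : smooth_on U (fun w => lor (F w) z).
Proof.
have sG : smooth_mx U G by exact: smooth_mxM.
by apply: eq_smooth (sG 0 0) => // w _; rewrite lorG.
Qed.

Lemma pd_lor k u : U u -> pd k (fun w => lor (F w) z) u = lor (dmx k F u) z.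
Proof.
move=> Uu; rewrite (eq_pd k u lorG) -dmxE (dmxM _ Uu sF sc) dmx_cst mulmx0 addr0.
by rewrite lorE mulmxA.
Qed.

End LorentzDerivative.

(* Since d phi = (1/2 - A) d psi, this map has differential (lam - A) d psi: it is
   constant along the lam-eigendirections. *)
HB.lock Definition focal_map (R : realType) n (sg : bool) (sigma : 'rV[R]_n -> R)
    (lam : R) u : 'rV[R]_n.+2 :=
  horo_map sg sigma u - (2^-1 - lam) *: horo_null sg sigma u.

Section TwoEigenvalues.
Variables (R : realType) (n : nat) (sg : bool) (U : set 'rV[R]_n).
Variables (sigma : 'rV[R]_n -> R) (lam : R).
Hypothesis oU : open U.
Hypothesis ssig : smooth_on U sigma.
Hypothesis lam0 : lam != 0.
Implicit Types u v w x : 'rV[R]_n.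

Local Notation A := (flat_schouten_op sigma).
Local Notation psi := (horo_null sg sigma).
Local Notation Ft := (horo_frame sg sigma).
Local Notation phi := (horo_map sg sigma).
Local Notation D := (cd sigma).
Local Notation J := (lorentz_form R n).

Hypothesis AA : forall u, U u -> A u *m A u = (lam ^+ 2)%:M.

Let sA : smooth_mx U A := smooth_flat_schouten_op oU ssig.

(* D A exchanges the two eigenspaces while (v, w, x) |-> <w (D_v A), x> is
   totally symmetric, so two of three eigenvectors always kill it. *)
Lemma schouten_parallel v u : U u -> D v A u = 0.
Proof.
move=> Uu; pose t x y z := dotv (y *m D x A u) z.
have tC x y z : t x y z = t y x z by rewrite /t (codazzi oU ssig _ _ Uu).
have Asym := flat_schouten_op_sym oU ssig.
have Dsym x : (D x A u)^T = D x A u by exact: (cd_sym sigma oU _ Uu Asym).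
have ts x y z : t x y z = t x z y by rewrite /t dotv_mulmx Dsym dotvC.
have tA x y z : t x (y *m A u) z = - t x y (z *m A u).
  have := eq_cd sigma oU x Uu AA; rewrite cd_scalar (cdM _ x Uu sA sA) => e.
  apply/eqP; rewrite -addr_eq0 /t -{2}[A u](Asym u Uu) -dotv_mulmx.
  by rewrite -!mulmxA -dotvDl -mulmxDr addrC e mulmx0 dot0v.
(* By total symmetry, A may be moved from any slot of [t] to any other at the price of a sign.
   Moving it from the first slot to the second, from there to the third, or directly to the third
   gives contradictory signs, so the value is 0. As A^2 is a nonzero scalar, every vector is an
   image under A, and [t] vanishes. *)
have t0 x y z : t (x *m A u) y z = 0.
  have e1 : t (x *m A u) y z = - t x y (z *m A u) by rewrite tC tA tC.
  have e2 : t (x *m A u) y z = - t x (y *m A u) z.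
    by rewrite ts tC tA tC (ts x z).
  have e3 := tA x y z; lra.
have t00 x y z : t x y z = 0.
  have := t0 (x *m A u) y z; rewrite -mulmxA AA// mul_mx_scalar tC.
  rewrite /t -scalemxAl dotvZl => /eqP; rewrite mulf_eq0 expf_eq0 /= (negbTE lam0).
  by rewrite -/(t y x z) tC => /eqP.
apply/matrixP => i j; rewrite [RHS]mxE -(t00 v 'e_i 'e_j) /t dotv_delta -rowE.
by rewrite mxE.
Qed.

Local Notation X := (focal_map sg sigma lam).

Lemma focal_mapE u : X u = phi u - (2^-1 - lam) *: psi u.
Proof. by rewrite focal_map.unlock. Qed.

Let B u := lam%:M - A u.

Lemma smooth_focal_map : smooth_mx U X.
Proof.
have s1 := smooth_horo_map sg oU ssig; have s2 := smooth_horo_null sg oU ssig.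
apply: (eq_smooth_mx oU (F := fun u => phi u - (2^-1 - lam) *: psi u)).
  by move=> u _; rewrite focal_mapE.
by apply: smooth_mxB => //; apply: smooth_mxZ => //; exact: smooth_cst.
Qed.

Let sB : smooth_mx U B.
Proof. by apply: smooth_mxB => //; exact: smooth_mx_cst. Qed.

Lemma ddx_focal_map v u : U u ->
  ddx v X u = expR (sigma u) *: (v *m B u *m Ft u).
Proof.
move=> Uu; have s1 := smooth_horo_map sg oU ssig; have s2 := smooth_horo_null sg oU ssig.
have sc : smooth_on U (fun=> 2^-1 - lam) by exact: smooth_cst.
have s3 : smooth_mx U (fun u => (2^-1 - lam) *: psi u) by exact: smooth_mxZ.
rewrite (eq_ddx oU v Uu (fun u _ => focal_mapE u)) (ddxB oU _ Uu s1 s3) (ddxZ _ Uu sc s2) big1 => [|k _]; last first.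
  by rewrite pd_cst mulr0.
rewrite scale0r add0r (ddx_horo_map _ oU ssig)// (ddx_horo_null _ oU ssig)//.
rewrite /B mulmxBr mul_mx_scalar !mulmxBl -!scalemxAl.
by mx_linear.
Qed.

Lemma lor_focal_focal u : lor (X u) (X u) = - 2 * lam.
Proof.
rewrite focal_mapE !(lorBl, lorBr, lorZl, lorZr) lor_map_map lor_null_null lor_null_map.
by rewrite lorC lor_null_map; field.
Qed.

Lemma lor_frame_focal v u : lor (v *m Ft u) (X u) = 0.
Proof. by rewrite focal_mapE lorBr lorZr lor_frame_map lor_frame_null mulr0 subrr. Qed.

(* Up to the factor 2 lam, the Lorentz projector onto the span of the focal map
   and its derivatives. *)
Definition focal_projector u : 'M[R]_n.+2 :=
  (Ft u)^T *m B u *m Ft u - (X u)^T *m X u.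

Local Notation K := focal_projector.

Let sX := smooth_focal_map.
Let sFt : smooth_mx U Ft := smooth_horo_frame sg oU ssig.

Lemma smooth_focal_projector : smooth_mx U K.
Proof.
have sXt := smooth_mx_tr oU sX; have sFtt := smooth_mx_tr oU sFt.
apply: smooth_mxB => //; last exact: smooth_mxM.
by apply: smooth_mxM => //; exact: smooth_mxM.
Qed.

(** Since A is parallel, the derivative of [B] is its commutator with [conn] and cancels the
    tangential part of the derivative of the frame. The normal part, seen through [B], points along
    the focal map and cancels the derivative of the rank one term. *)
Lemma ddx_focal_projector v u : U u -> ddx v K u = 0.
Proof.
move=> Uu; have sXt := smooth_mx_tr oU sX; have sFtt := smooth_mx_tr oU sFt.
have sFB : smooth_mx U (fun u => (Ft u)^T *m B u) by exact: smooth_mxM.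
have s1 : smooth_mx U (fun u => (Ft u)^T *m B u *m Ft u) by exact: smooth_mxM.
have s2 : smooth_mx U (fun u => (X u)^T *m X u) by exact: smooth_mxM.
rewrite (ddxB oU _ Uu s1 s2) (ddxM _ Uu sFB sFt) (ddxM _ Uu sFtt sB) (ddxM _ Uu sXt sX).
rewrite !ddx_tr ddx_focal_map// (ddx_horo_frame _ oU ssig)//.
have dA : ddx v A u = A u *m conn sigma v u - conn sigma v u *m A u.
  have := schouten_parallel v Uu; rewrite cdE => /eqP.
  rewrite addrAC addr_eq0 => /eqP/(canRL (subrK _)) ->.
  by rewrite addrC.
have dB : ddx v B u = conn sigma v u *m A u - A u *m conn sigma v u.
  rewrite (ddxB oU _ Uu (smooth_mx_cst U lam%:M) sA) ddx_cst sub0r dA.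
  by rewrite opprB.
have Asym := flat_schouten_op_sym oU ssig Uu.
have Bsym : (B u)^T = B u by rewrite linearB /= tr_scalar_mx Asym.
have Ct : (conn sigma v u)^T = - conn sigma v u by rewrite connE tr_wedge.
pose E := v^T *m (phi u - 2^-1 *: psi u) - (v *m A u)^T *m psi u.
have BA : B u *m A u = - lam *: B u.
  rewrite /B mulmxBl AA// mul_scalar_mx scalerBr scale_scalar_mx scaleNr.
  by rewrite opprK addrC mulNr expr2 raddfN.
have CAB : conn sigma v u *m A u - A u *m conn sigma v u =
    B u *m conn sigma v u - conn sigma v u *m B u.
  rewrite /B mulmxBl mulmxBr scalar_mxC.
  by mx_linear.
rewrite dB CAB -/E; move: (B u) Bsym BA => b bsym bA.
(* Because [b] times A is -lam times [b], the two null directions in [E] combine to phi - psi/2 +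
   lam psi, which is the focal map. *)
have BE : b *m E = (v *m b)^T *m X u.
  rewrite /E !trmx_mul bsym Asym mulmxBr !mulmxA bA.
  rewrite -scalemxAl -[in LHS]scalemxAl scaleNr opprK scalemxAr -mulmxDr.
  by congr (_ *m _); rewrite focal_mapE; mx_linear.
have EB : E^T *m b = (X u)^T *m (v *m b).
  by rewrite -[LHS]trmxK trmx_mul trmxK bsym BE trmx_mul trmxK.
have -> : (- (conn sigma v u *m Ft u) + expR (sigma u) *: E)^T =
   (Ft u)^T *m conn sigma v u + expR (sigma u) *: E^T.
  rewrite [LHS]linearD /= [(- _)^T]linearN /= [(_ *: _)^T]linearZ /= trmx_mul Ct.
  by rewrite mulmxN opprK.
move: (X u) BE EB => x BE EB; move: (conn sigma v u) (Ft u) E BE EB => C f E BE EB.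
rewrite [(_ *: _)^T]linearZ /= !(mulmxDl, mulmxDr, mulmxBl, mulmxBr, mulmxN, mulNmx).
rewrite -!scalemxAl -!scalemxAr EB -(mulmxA f^T b E) BE !trmx_mul bsym !mulmxA.
by apply/matrixP => i j; rewrite [RHS]mxE !(addmxE, oppmxE, scalemxE); ring.
Qed.

Let Asym : forall u, U u -> (A u)^T = A u := flat_schouten_op_sym oU ssig.

Let BB u : U u -> B u *m B u = (2 * lam) *: B u.
Proof.
move=> Uu; rewrite /B mulmxBl !mulmxBr AA// !mul_scalar_mx !mul_mx_scalar.
by apply/matrixP => i j; rewrite !(addmxE, oppmxE, scalemxE) !mxE; case: (i == j);
  rewrite ?mulr1n ?mulr0n; ring.
Qed.

(* The vectors v *m B u *m Ft u span the image of the differential of X. *)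
Definition focal_orthogonal z u :=
  lor (X u) z = 0 /\ forall v, lor (v *m B u *m Ft u) z = 0.

(** [K] reproduces, up to the nonzero factor [2 * lam], the focal map and the image of its
    differential. Orthogonality thus becomes an equation in [K], which is locally constant. *)
Lemma focal_orthogonalE z u : U u ->
  focal_orthogonal z u <-> K u *m (J *m z^T) = 0.
Proof.
move=> Uu; have row00 (M : 'M[R]_1) : M 0 0 = 0 -> M = 0.
  by move=> M0; apply/matrixP => i j; rewrite !ord1 M0 mxE.
split=> [[Xz Bz]|Kz].
  have XJ : X u *m (J *m z^T) = 0 by apply: row00; rewrite mulmxA -lorE.
  have BFJ : B u *m Ft u *m (J *m z^T) = 0.
    apply/row_matrixP => i; rewrite row0 rowE !mulmxA; apply: row00.
    by rewrite -lorE.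
  rewrite /K mulmxBl -!mulmxA (mulmxA (B u)) BFJ XJ !mulmx0 subr0.
  by [].
have FX : Ft u *m J *m (X u)^T = 0.
  apply/row_matrixP => i; rewrite row0 rowE !mulmxA; apply: row00.
  by rewrite -lorE lor_frame_focal.
have XF : X u *m J *m (Ft u)^T = 0.
  apply/matrixP => i j; rewrite ord1 [RHS]mxE.
  transitivity (lor (X u) ('e_j *m Ft u)); last by rewrite lorC lor_frame_focal.
  by rewrite lorE -rowE tr_row colE mulmxA -colE [in RHS]mxE.
have XX : X u *m J *m (X u)^T = (- 2 * lam)%:M.
  by rewrite [LHS]mx11_scalar -lorE lor_focal_focal.
have FF : Ft u *m J *m (Ft u)^T = 1%:M.
  apply/matrixP => i j; transitivity (lor ('e_i *m Ft u) ('e_j *m Ft u)).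
    rewrite lorE -!rowE tr_row colE mulmxA -colE -row_mul -row_mul.
    by rewrite [in RHS]mxE [in RHS]mxE.
  by rewrite lor_frame_frame dotv_delta !mxE eqxx eq_sym.
split.
  have : X u *m J *m (K u *m (J *m z^T)) = 0 by rewrite Kz mulmx0.
  rewrite /K mulmxBl mulmxBr !mulmxA XF XX !mul0mx sub0r mul_scalar_mx.
  rewrite -!scalemxAl -scaleNr => /matrixP/(_ 0 0); rewrite scalemxE [RHS]mxE -lorE.
  move/eqP; rewrite mulf_eq0 => /orP[|/eqP//].
  by rewrite oppr_eq0 mulf_eq0 oppr_eq0 pnatr_eq0 (negbTE lam0).
have FK : Ft u *m J *m K u = B u *m Ft u.
  rewrite /K; move: (B u) => b.
  by rewrite mulmxBr !mulmxA FF FX mul1mx mul0mx subr0.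
move=> v; have : v *m B u *m (Ft u *m J *m (K u *m (J *m z^T))) = 0.
  by rewrite Kz !mulmx0.
rewrite (mulmxA (Ft u *m J)) FK; move: (B u) (BB Uu) => b bb.
rewrite !mulmxA -(mulmxA v) bb -scalemxAr -!scalemxAl => /matrixP/(_ 0 0).
rewrite scalemxE [RHS]mxE -lorE => /eqP; rewrite mulf_eq0 => /orP[|/eqP//].
by rewrite mulf_eq0 pnatr_eq0 (negbTE lam0).
Qed.

Lemma focal_projector_locally_constant u : U u -> \forall w \near u, K w = K u.
Proof.
move=> Uu.
have sK := smooth_focal_projector.
have E i j : \forall w \near u, K w i j = K u i j.
  apply: locally_constant oU Uu _ => w Uw; split; first exact: smooth_diff Uw (sK i j).
  by move=> k; rewrite partialE -dmxE -ddx_delta ddx_focal_projector// mxE.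
have : \forall w \near u, forall ij : 'I_n.+2 * 'I_n.+2, K w ij.1 ij.2 = K u ij.1 ij.2.
  by apply: (@filter_forall _ _ _ (nbhs u)) => -[i j]; exact: E.
by apply: filterS => w Kw; apply/matrixP => i j; exact: (Kw (i, j)).
Qed.

Lemma focal_orthogonal_locally_constant z u : U u ->
  \forall w \near u, focal_orthogonal z w <-> focal_orthogonal z u.
Proof.
move=> Uu; have N1 := focal_projector_locally_constant Uu.
have N2 : \forall w \near u, U w by exact: open_nbhs_nbhs.
apply: filterS2 N1 N2 => w Kw Uw.
by rewrite !focal_orthogonalE// Kw.
Qed.

(** In this form the condition says that the product of the focal map with [z] vanishes to first
    order at the point, a statement independent of the chart. *)
Lemma focal_orthogonal_pd z u : U u ->
  focal_orthogonal z u <-> lor (X u) z = 0 /\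
    forall k, pd k (fun w => lor (X w) z) u = 0.
Proof.
move=> Uu; have pE k : pd k (fun w => lor (X w) z) u =
    expR (sigma u) * lor ('e_k *m B u *m Ft u) z.
  by rewrite (pd_lor z sX k Uu) -lorZl -ddx_focal_map// ddx_delta.
split=> -[Xz Bz]; split=> //; first by move=> k; rewrite pE Bz mulr0.
move=> v.
rewrite (row_sum_delta v) !mulmx_suml.
have -> : lor (\sum_i (v 0 i *: 'e_i) *m B u *m Ft u) z =
    \sum_i v 0 i * lor ('e_i *m B u *m Ft u) z.
  rewrite lorE !mulmx_suml summxE; apply: eq_bigr => i _.
  by rewrite -lorE -!scalemxAl lorZl.
apply: big1 => i _; have /eqP := Bz i; rewrite pE mulf_eq0.
by rewrite gt_eqF ?expR_gt0//= => /eqP ->; rewrite mulr0.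
Qed.

End TwoEigenvalues.

Section LconsLinear.
Variables (R : realType) (n : nat).
Implicit Types (x y : 'rV[R]_n.+1).

Lemma lconsD (a b : R) x y : lcons a x + lcons b y = lcons (a + b) (x + y).
Proof.
apply/rowP => j; rewrite addmxE /lcons; case: (unliftP ord0 j) => [i ->|->].
  by rewrite !row_consES addmxE.
by rewrite !row_consE0.
Qed.

Lemma lconsZ (k a : R) x : k *: lcons a x = lcons (k * a) (k *: x).
Proof.
apply/rowP => j; rewrite scalemxE /lcons; case: (unliftP ord0 j) => [i ->|->].
  by rewrite !row_consES scalemxE.
by rewrite !row_consE0.
Qed.

End LconsLinear.

Section AssociatedHypersurface.
Variables (R : realType) (n : nat) (Omega : set 'rV[R]_n.+1).
Variable rho : 'rV[R]_n.+1 -> R.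
Hypothesis dOmega : sphere_domain Omega.
Hypothesis srho : sphere_smooth Omega rho.
Implicit Types (u v w : 'rV[R]_n) (s : bool).

Definition chart_domain s : set 'rV[R]_n := [set u | Omega (stereo s u)].

Local Notation V := chart_domain.
Local Notation sig := (chart_factor rho).

Lemma open_chart_domain s : open (V s).
Proof. exact: sphere_domain_open. Qed.

Let oV := open_chart_domain.

Lemma smooth_chart_factor s : smooth_on (V s) (sig s).
Proof.
apply: smoothB => //; first exact: srho.
apply: smooth_ln => //; last exact: smooth_half_height.
by move=> u _; exact: half_height_gt0.
Qed.

Let ssig := smooth_chart_factor.

Lemma grad_chart_factor s u : V s u ->
  grad_at (sig s) u = grad_at (rho \o stereo s) u - (half_height u)^-1 *: u.
Proof.
move=> Vu; apply/rowP => k; rewrite !(addmxE, oppmxE, scalemxE) [LHS]mxE mxE.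
have d1 : differentiable (fun u => rho (stereo s u)) u.
  exact: (smooth_diff Vu (srho s)).
have dh : differentiable (@half_height R n) u.
  by apply: (smooth_diff (U := V s) Vu); exact: smooth_half_height.
have dl : differentiable (fun u : 'rV[R]_n => ln (half_height u)) u.
  apply: (differentiable_comp1 (h := ln (R := R)) dh).
  by have [] := is_derive1_ln (half_height_gt0 u).
rewrite (pdD (f := fun u => rho (stereo s u)) k d1 (differentiableN dl)).
by rewrite (pdN k dl) (pd_ln k dh (half_height_gt0 u)) pd_half_height.
Qed.

Lemma expR_chart_factor s u :
  expR (sig s u) = expR (rho (stereo s u)) / half_height u.
Proof. by rewrite expRD expRN lnK// posrE half_height_gt0. Qed.

Lemma chart_null_lcons s u : chart_null s u = lcons (half_height u) (stereo_null s u).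
Proof. by []. Qed.

Lemma horo_null_chart s u :
  expR (rho (stereo s u)) *: lcons 1 (stereo s u) = horo_null s (sig s) u.
Proof.
have h0 := half_height_neq0 u.
rewrite horo_nullE expR_chart_factor chart_null_lcons !lconsZ stereoE scalerA.
by congr lcons; field.
Qed.

(** The gradient of sigma differs from that of rho by u/h. After everything is written in terms of
    [stereo_null] and [stereo_frame], the two sides agree coefficient by coefficient. *)
Lemma assoc_hyp_chart s u : V s u ->
  assoc_hyp rho (stereo s u) = horo_map s (sig s) u.
Proof.
move=> Vu; have h0 := half_height_neq0 u.
have dr : differentiable (rho \o stereo s) u := smooth_diff Vu (srho s).
rewrite /assoc_hyp (sphere_gradE dr); set r := grad_at (rho \o stereo s) u.
have jE : r *m jac (stereo s) u = (half_height u)^-1 *: (r *m stereo_frame s u)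
    - (dotv r u / half_height u ^+ 2) *: stereo_null s u.
  by rewrite mul_jac (ddx_stereo (@oV s)).
rewrite !(dotvZl, dotvZr) (dot_jac_stereo (@oV s))// jE.
rewrite horo_mapE !expRN expR_chart_factor (grad_chart_factor Vu) -/r.
rewrite mul_chart_frame chart_null_lcons /chart_pole.
have -> : row_mx ((-1 : R) ^+ s * dotv (r - (half_height u)^-1 *: u) u)%:M
    (r - (half_height u)^-1 *: u) = r *m stereo_frame s u
    - (half_height u)^-1 *: (u *m stereo_frame s u) :> 'rV[R]_n.+1.
  by rewrite scalemxAl -mulmxBl mul_stereo_frame.
(* The fixed pole in terms of the moving vectors; it rests on |u|^2 = 2h - 1. *)
have -> : row_mx ((-1 : R) ^+ s)%:M 0 = (half_height u)^-1 *: (u *m stereo_frame s u)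
    - (half_height u)^-1 *: stereo_null s u :> 'rV[R]_n.+1.
  rewrite -scalerBr mul_stereo_frame; apply/rowP => j.
  rewrite !(scalemxE, addmxE, oppmxE); case: (unliftP ord0 j) => [i ->|->].
    by rewrite !row_consES mxE subrr mulr0.
  by rewrite !row_consE0 dotvv_half_height; field.
have eE : expR (2 * rho (stereo s u)) = expR (rho (stereo s u)) ^+ 2.
  by rewrite mulr_natl mulr2n expRD expr2.
rewrite eE; have := expR_gt0 (rho (stereo s u)); move: (expR _) => e e0.
have {}e0 : e != 0 by rewrite gt_eqF.
rewrite stereoE !(lconsZ, lconsD).
rewrite !(dotvBl, dotvBr, dotvZl, dotvZr) (dotvC u r) (dotvv_half_height u).
move: h0 (dotv r r) (dotv r u); move: (half_height u) => h h0 rr ru; congr lcons.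
  by field; rewrite e0 h0.
apply/rowP => j; rewrite !(scalemxE, addmxE, oppmxE).
by field; rewrite e0 h0.
Qed.

End AssociatedHypersurface.

(** * Functions of the Schouten operator and the principal curvatures *)

Section SpectralCalculus.
Variables (R : realType) (n : nat) (Q : 'M[R]_n).
Hypothesis QQ : Q *m Q^T = 1%:M.
Implicit Types f g : 'I_n -> R.

Definition conj_diag f : 'M[R]_n := Q^T *m diag_mx (\row_i f i) *m Q.

Lemma conj_diagM f g : conj_diag f *m conj_diag g = conj_diag (fun i => f i * g i).
Proof.
rewrite /conj_diag !mulmxA -(mulmxA _ Q) QQ mulmx1 -(mulmxA Q^T) mulmx_diag.
by congr (_ *m diag_mx _ *m _); apply/rowP => i; rewrite !mxE.
Qed.

Lemma conj_diagZ c f : c *: conj_diag f = conj_diag (fun i => c * f i).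
Proof.
rewrite /conj_diag scalemxAl scalemxAr; congr (_ *m _ *m _).
by apply/matrixP => i j; rewrite !mxE mulrnAr.
Qed.

Lemma conj_diag_shift c f : c%:M - conj_diag f = conj_diag (fun i => c - f i).
Proof.
have -> : c%:M = Q^T *m c%:M *m Q.
  by rewrite scalar_mxC -mulmxA (mulmx1C QQ) mulmx1.
rewrite /conj_diag -mulmxBl -mulmxBr; congr (_ *m _ *m _).
by apply/matrixP => i j; rewrite !mxE; case: (i == j); rewrite ?mulr1n ?mulr0n ?subr0.
Qed.

Lemma conj_diag_shiftD c f : c%:M + conj_diag f = conj_diag (fun i => c + f i).
Proof.
have -> : conj_diag f = - conj_diag (fun i => - f i).
  rewrite -scaleN1r conj_diagZ; congr conj_diag; apply/funext => i.
  by rewrite mulN1r opprK.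
rewrite conj_diag_shift; congr conj_diag; apply/funext => i.
by rewrite opprK.
Qed.

Lemma conj_diag_cst c : conj_diag (fun=> c) = c%:M.
Proof.
rewrite /conj_diag (_ : diag_mx _ = c%:M); last first.
  by rewrite -diag_const_mx; congr diag_mx; apply/rowP => i; rewrite !mxE.
by rewrite scalar_mxC -mulmxA (mulmx1C QQ) mulmx1.
Qed.

Lemma char_poly_conj_diag f : char_poly (conj_diag f) = \prod_i ('X - (f i)%:P).
Proof. by rewrite char_poly_similar ?(mulmx1C QQ)// char_poly_diag. Qed.

End SpectralCalculus.

Section Isoparametric.
Variables (R : realType) (n : nat) (Omega : set 'rV[R]_n.+1).
Variables (rho : 'rV[R]_n.+1 -> R) (a : 'I_n -> R).
Hypothesis n3 : (3 <= n)%N.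
Hypothesis dOmega : sphere_domain Omega.
Hypothesis srho : sphere_smooth Omega rho.
Hypothesis eigS : forall s u, Omega (stereo s u) ->
  eigenvalues_of (schouten_op (conf_metric rho s) u) a.
Implicit Types (u v w : 'rV[R]_n) (s : bool).

Local Notation V := (chart_domain Omega).
Local Notation sig := (chart_factor rho).
Local Notation A s := (flat_schouten_op (sig s)).

Let oV s : open (V s). Proof. exact: open_chart_domain. Qed.
Let ssig s : smooth_on (V s) (sig s). Proof. exact: smooth_chart_factor. Qed.

Lemma schouten_op_chart s u : V s u ->
  schouten_op (conf_metric rho s) u = A s u.
Proof.
move=> Vu; rewrite conf_metricE.
exact: (schouten_op_conf (@oV s) (@ssig s) n3 Vu).
Qed.

Lemma char_poly_chart s u : V s u -> char_poly (A s u) = \prod_i ('X - (a i)%:P).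
Proof. by move=> Vu; rewrite -schouten_op_chart//; exact: eigS. Qed.

Lemma schouten_chart_sym s u : V s u -> (A s u)^T = A s u.
Proof. exact: (flat_schouten_op_sym (@oV s) (@ssig s)). Qed.

Lemma assoc_normal_chart s u : V s u -> assoc_normal rho (stereo s u) =
  horo_null s (sig s) u - horo_map s (sig s) u.
Proof.
by move=> Vu; rewrite /assoc_normal horo_null_chart (assoc_hyp_chart dOmega srho Vu).
Qed.

Lemma mul_jac_assoc_hyp s v u : V s u ->
  v *m jac (assoc_hyp rho \o stereo s) u =
  expR (sig s u) *: ((2^-1 *: v - v *m A s u) *m horo_frame s (sig s) u).
Proof.
move=> Vu; rewrite mul_jac -(ddx_horo_map s (@oV s) (@ssig s))//.
by apply: (eq_ddx (@oV s) v Vu) => w Vw; exact: (assoc_hyp_chart dOmega srho Vw).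
Qed.

Lemma mul_jac_assoc_normal s v u : V s u ->
  v *m jac (assoc_normal rho \o stereo s) u =
  expR (sig s u) *: ((2^-1 *: v + v *m A s u) *m horo_frame s (sig s) u).
Proof.
move=> Vu; rewrite mul_jac (eq_ddx (@oV s) v Vu (fun w Vw => assoc_normal_chart Vw)).
have s1 := smooth_horo_map s (@oV s) (@ssig s).
have s2 := smooth_horo_null s (@oV s) (@ssig s).
rewrite (ddxB (@oV s) _ Vu s2 s1) (ddx_horo_map s (@oV s) (@ssig s))//.
rewrite (ddx_horo_null s (@oV s) (@ssig s))// mulmxBl mulmxDl -!scalemxAl.
by apply/matrixP => i j; rewrite !(addmxE, oppmxE, scalemxE); field.
Qed.

Lemma assoc_hyp_hyp x : Omega x -> hyp (assoc_hyp rho x).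
Proof.
move=> Ox; have [s [u sx]] : exists s u, stereo s u = x.
  by apply: chart_exists; case: dOmega => -[W _ WE] _ _; move: Ox; rewrite WE => -[].
split.
  have Vu : V s u := eq_ind_r Omega Ox sx.
  by rewrite -sx (assoc_hyp_chart dOmega srho Vu) lor_map_map.
rewrite /assoc_hyp !lconsZ lconsD row_consE0 mulr1 mulr0 addr0.
have := dotv_ge0 (sphere_grad rho x); move: (dotv _ _) => d d0.
rewrite mulr_gt0 ?divr_gt0 ?expR_gt0// ltr_wpDr// mulr_ge0 ?expR_ge0//.
by rewrite addr_ge0.
Qed.

Lemma schouten_spectral s u : V s u ->
  exists2 Q : 'M[R]_n, Q *m Q^T = 1%:M & A s u = conj_diag Q a.
Proof.
move=> Vu.
have [Q QQ QA] := spectral_sym (schouten_chart_sym Vu) (char_poly_chart Vu).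
exists Q => //; rewrite /conj_diag -QA !mulmxA -(mulmxA _ Q^T) (mulmx1C QQ).
by rewrite mulmx1 mul1mx.
Qed.

Hypothesis a_lt : forall i, a i < 2^-1.

Let P s u := (2^-1)%:M - A s u.

Let ah0 i : 2^-1 - a i != 0. Proof. by rewrite subr_eq0 gt_eqF. Qed.

Lemma half_minus_schouten_unit s u : V s u -> P s u \in unitmx.
Proof.
move=> Vu; have [Q QQ AE] := schouten_spectral Vu.
have : P s u *m conj_diag Q (fun i => (2^-1 - a i)^-1) = 1%:M.
  rewrite /P AE (conj_diag_shift QQ) (conj_diagM QQ).
  rewrite /conj_diag (_ : diag_mx _ = 1%:M) ?mulmx1 ?(mulmx1C QQ)//.
  by apply/matrixP => i j; rewrite !mxE mulfV.
by case/mulmx1_unit.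
Qed.

Let PT s u : V s u -> (P s u)^T = P s u.
Proof. by move=> Vu; rewrite linearB /= tr_scalar_mx schouten_chart_sym. Qed.

Let rowP_ s u v : v *m P s u = 2^-1 *: v - v *m A s u.
Proof. by rewrite mulmxBr mul_mx_scalar. Qed.

Lemma assoc_hyp_oriented :
  oriented_hypersurface Omega (assoc_hyp rho) (assoc_normal rho).
Proof.
have inS x : Omega x -> exists s u, stereo s u = x.
  by move=> Ox; apply: chart_exists; case: dOmega => -[W _ WE] _ _; move: Ox; rewrite WE => -[].
split.
- move=> j s; have sm := smooth_horo_map s (@oV s) (@ssig s) 0 j.
  by apply: (eq_smooth (@oV s) _ sm) => u Vu; rewrite /= (assoc_hyp_chart dOmega srho Vu).
- move=> j s; have s1 := smooth_horo_map s (@oV s) (@ssig s).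
  have s2 := smooth_horo_null s (@oV s) (@ssig s).
  apply: (eq_smooth (@oV s) _ (smooth_mxB (@oV s) s2 s1 0 j)) => u Vu.
  by rewrite /= (assoc_normal_chart Vu).
- move=> x Ox; split; first exact: assoc_hyp_hyp.
    have [s [u sx]] := inS x Ox; have Vu : V s u := eq_ind_r Omega Ox sx.
    rewrite -sx (assoc_normal_chart Vu) lorBl !lorBr (lorC (horo_map _ _ _)).
    by rewrite lor_null_null lor_null_map lor_map_map; ring.
  have [s [u sx]] := inS x Ox; have Vu : V s u := eq_ind_r Omega Ox sx.
  rewrite -sx (assoc_normal_chart Vu) (assoc_hyp_chart dOmega srho Vu) lorBl.
  by rewrite lor_null_map lor_map_map subrr.
move=> s u Vu; split.
  have PU := half_minus_schouten_unit Vu.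
  rewrite -kermx_eq0; apply/eqP/row_matrixP => i; rewrite row0.
  set k := row i _.
  have : k *m jac (assoc_hyp rho \o stereo s) u = 0 by rewrite /k -row_mul mulmx_ker row0.
  rewrite (mul_jac_assoc_hyp _ Vu) -rowP_ => e.
  (* The frame is isometric for the Lorentz product, so the squared norm of [k *m P s u] is the
     Lorentz norm of a vector known to vanish. *)
  have kP : k *m P s u = 0.
    apply/eqP; rewrite -dotv_eq0 -(lor_frame_frame s (sig s) _ _ u).
    move/eqP: e; rewrite scaler_eq0 gt_eqF ?expR_gt0//= => /eqP ->.
    by rewrite lor0l.
  by rewrite -[k]mulmx1 -(mulmxV PU) mulmxA kP mul0mx.
move=> i; rewrite rowE (mul_jac_assoc_hyp _ Vu) (assoc_normal_chart Vu).
by rewrite lorBl !lorZr !(lorC (horo_null _ _ _)) !(lorC (horo_map _ _ _)) lor_frame_null lor_frame_map subrr.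
Qed.

(** With P = 1/2 - A the first form is e^(2 sigma) P^2 and the second is - e^(2 sigma) (1/2 + A) P.
    Both are functions of A, so the shape operator is computed entrywise in one eigenbasis. *)
Lemma assoc_hyp_isoparametric :
  isoparametric Omega (assoc_hyp rho) (assoc_normal rho).
Proof.
split; first exact: assoc_hyp_oriented.
exists (fun i => - (2^-1 + a i) / (2^-1 - a i)) => s u Vu.
have [Q QQ AE] := schouten_spectral Vu; have PU := half_minus_schouten_unit Vu.
pose b := expR (sig s u) ^+ 2.
have b0 : b != 0 by rewrite expf_neq0// gt_eqF ?expR_gt0.
have F1 : first_form (assoc_hyp rho) s u = b *: (P s u *m P s u).
  apply/matrixP => i j; rewrite [LHS]mxE !rowE !(mul_jac_assoc_hyp _ Vu) -!rowP_.
  rewrite lorZl lorZr lor_frame_frame mulrA -expr2 scalemxE; congr (_ * _).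
  by rewrite -{2}(PT Vu) -dotv_mulmx dotv_delta -mulmxA -rowE mxE.
have F2 : second_form (assoc_hyp rho) (assoc_normal rho) s u =
    - b *: (((2^-1)%:M + A s u) *m P s u).
  apply/matrixP => i j; rewrite [LHS]mxE scalemxE mulNr; congr (- _).
  rewrite !rowE (mul_jac_assoc_hyp _ Vu) (mul_jac_assoc_normal _ Vu) -rowP_.
  rewrite lorZl lorZr lor_frame_frame mulrA -expr2; congr (_ * _).
  have -> : 2^-1 *: ('e_i : 'rV[R]_n) + 'e_i *m A s u = 'e_i *m ((2^-1)%:M + A s u).
    by rewrite mulmxDr mul_mx_scalar.
  by rewrite -{1}(PT Vu) -dotv_mulmx dotv_delta -mulmxA -rowE mxE.
have F1u : first_form (assoc_hyp rho) s u \in unitmx.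
  by rewrite F1 unitmxZ ?unitfE// unitmx_mul PU.
have -> : shape_op (assoc_hyp rho) (assoc_normal rho) s u =
    conj_diag Q (fun i => - (2^-1 + a i) / (2^-1 - a i)).
  rewrite /shape_op -[RHS](mulKmx F1u) F1 F2; congr (_ *m _).
  rewrite /P AE (conj_diag_shift QQ) (conj_diag_shiftD QQ) !(conj_diagM QQ).
  rewrite -scalemxAl (conj_diagM QQ) scaleNr -scalerN; congr (_ *: _).
  rewrite -scaleN1r conj_diagZ; congr conj_diag; apply/funext => i.
  by move: (ah0 i); move: (2^-1 - a i) (2^-1 + a i) => d e d0; field.
exact: char_poly_conj_diag.
Qed.

End Isoparametric.

(** * Umbilical hypersurfaces and products *)

Section Causality.
Variables (R : realType) (n : nat).
Implicit Types p q : 'rV[R]_n.+2.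

Lemma cauchy_schwarz m (x y : 'rV[R]_m) : dotv x y ^+ 2 <= dotv x x * dotv y y.
Proof.
have [->|y0] := eqVneq y 0; first by rewrite !dotv0 mulr0 expr0n.
have yy : 0 < dotv y y by rewrite dotv_gt0.
have := dotv_ge0 (dotv y y *: x - dotv x y *: y).
rewrite !(dotvBl, dotvBr, dotvZl, dotvZr) (dotvC y x).
set a := dotv x x; set b := dotv y y; set c := dotv x y => h.
rewrite -subr_ge0 -(pmulr_rge0 _ yy) -/b.
by move: h; congr (_ <= _); ring.
Qed.

Let tl p : 'rV[R]_n.+1 := \row_i p 0 (lift ord0 i).

Let lor_tl p q : lor p q = - (p 0 0 * q 0 0) + dotv (tl p) (tl q).
Proof. by congr (_ + _); apply: eq_bigr => i _; rewrite !mxE. Qed.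

(** Cauchy-Schwarz bounds the product of the space parts, and it is strictly dominated by the
    product of the time components because [p] is timelike. *)
Lemma lor_future_lt0 p q : lor p p < 0 -> 0 < p 0 0 -> lor q q <= 0 -> 0 < q 0 0 ->
  lor p q < 0.
Proof.
rewrite !lor_tl => pp p0 qq q0.
have := cauchy_schwarz (tl p) (tl q).
have := dotv_ge0 (tl p); have := dotv_ge0 (tl q).
move: pp qq; move: (dotv (tl p) (tl p)) (dotv (tl q) (tl q)) (dotv (tl p) (tl q)).
move=> P Q c pp qq Q0 P0 cPQ.
rewrite addrC subr_lt0 ltNge; apply/negP => h.
have pq0 : 0 < p 0 0 * q 0 0 by rewrite mulr_gt0.
have h2 : (p 0 0 * q 0 0) ^+ 2 <= c ^+ 2.
  have c0 : 0 <= c := le_trans (ltW pq0) h.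
  by rewrite ler_sqr// nnegrE ltW.
have h3 : P * Q <= P * (q 0 0 * q 0 0) by apply: ler_wpM2l => //; lra.
have h4 : P * (q 0 0 * q 0 0) < (p 0 0 * p 0 0) * (q 0 0 * q 0 0).
  by rewrite ltr_pM2r ?mulr_gt0//; lra.
have : (p 0 0 * q 0 0) ^+ 2 < (p 0 0 * q 0 0) ^+ 2.
  rewrite (le_lt_trans h2)// (le_lt_trans cPQ)// (le_lt_trans h3)//.
  by rewrite (lt_le_trans h4)// expr2 mulrACA.
by rewrite ltxx.
Qed.

(** The sign of the product with a future timelike vector detects the time orientation; the centres
    of hyperspheres and horospheres are recognised as future vectors in this way. *)
Lemma lor_lt0_future p q : lor p p < 0 -> 0 < p 0 0 -> lor q q <= 0 ->
  lor p q < 0 -> 0 < q 0 0.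
Proof.
move=> pp p0 qq pq; rewrite ltNge le_eqVlt; apply/negP => /orP[/eqP q0|q0].
  move: qq pq; rewrite !lor_tl q0 !mulr0 oppr0 !add0r => qq.
  have /eqP : dotv (tl q) (tl q) = 0 by apply/eqP; rewrite eq_le qq dotv_ge0.
  by rewrite dotv_eq0 => /eqP ->; rewrite dotv0 ltxx.
have : lor p (- q) < 0.
  by apply: lor_future_lt0 => //; rewrite ?lorNl ?lorNr ?opprK// mxE oppr_gt0.
by rewrite lorNr oppr_lt0 => /(lt_trans pq); rewrite ltxx.
Qed.

Lemma lor_lt0_hyp p q : hyp p -> lor q q <= 0 -> lor p q < 0 -> 0 < q 0 0.
Proof. by move=> [pp p0]; apply: lor_lt0_future => //; rewrite pp ltrN10. Qed.

(* A level set of <., X> is a hypersphere, a horosphere, a geodesic hyperplane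
   or an equidistant hypersurface according to the sign of <X, X>. *)
Lemma umbilical_level_set (lam : R) (X : 'rV[R]_n.+2) p0 : lam < 2^-1 ->
  lor X X = - 2 * lam -> hyp p0 -> lor p0 X = - (2^-1 + lam) ->
  exists M, totally_umbilical M /\ forall p, hyp p -> lor p X = - (2^-1 + lam) -> M p.
Proof.
move=> lh XX hp0 p0X; have [lneg|lpos|l0] := ltgtP lam 0.
- pose t := Num.sqrt (- 2 * lam).
  have l2 : 0 < - 2 * lam by lra.
  have t0 : 0 < t by rewrite sqrtr_gt0.
  have tt : t ^+ 2 = - 2 * lam by rewrite sqr_sqrtr// ltW.
  pose a := t^-1 *: X.
  have aa : lor a a = 1.
    by rewrite lorZl lorZr XX -tt expr2; field; rewrite gt_eqF.
  have pa p : lor p X = - (2^-1 + lam) -> lor p a = - (2^-1 + lam) / t.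
    by move=> pX; rewrite lorZr pX mulrC.
  have [c0|c0] := eqVneq (2^-1 + lam) 0.
    exists [set p | hyp p /\ lor p a = 0]; split; first by apply: Or43; exists a.
    by move=> p hp /pa; rewrite c0 oppr0 mul0r.
  exists [set p | hyp p /\ lor p a = - (2^-1 + lam) / t]; split.
    apply: Or44; exists a, (- (2^-1 + lam) / t); split=> //.
    by rewrite mulf_neq0 ?oppr_eq0// invr_eq0 gt_eqF.
  by move=> p hp /pa.
- pose t := Num.sqrt (2 * lam).
  have l2 : 0 < 2 * lam by lra.
  have t0 : 0 < t by rewrite sqrtr_gt0.
  have tt : t ^+ 2 = 2 * lam by rewrite sqr_sqrtr// ltW.
  have t1 : t < 1 by rewrite -(ltr_sqr (x := t)) ?nnegrE ?ltW// tt expr1n; lra.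
  pose a := t^-1 *: X.
  have tn0 : t != 0 by rewrite gt_eqF.
  have aa : lor a a = -1.
    rewrite lorZl lorZr XX (_ : - 2 * lam = - t ^+ 2); last by rewrite tt mulNr.
    by field.
  have pa p : lor p X = - (2^-1 + lam) -> lor p a = - ((t^-1 + t) / 2).
    move=> pX; rewrite lorZr pX (_ : lam = t ^+ 2 / 2); first by field.
    by rewrite tt; field.
  have ha : hyp a.
    split=> //; apply: (lor_lt0_hyp hp0); first by rewrite aa lerN10.
    by rewrite (pa _ p0X) oppr_lt0 divr_gt0// addr_gt0// invr_gt0.
  exists [set p | hyp p /\ lor p a = - ((t^-1 + t) / 2)]; split.
    (* The radius is [- ln t], since cosh (- ln t) = (t^-1 + t) / 2; it is positive because lam <
       1/2 forces t < 1. *)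
    apply: Or41; exists a, (- ln t); split=> //.
      by rewrite oppr_gt0 ln_lt0// t0.
    by rewrite opprK expRN lnK.
  by move=> p hp /pa.
(* For lam = 0 the level is -1/2, and doubling the null vector gives the normalised level -1. *)
- pose a := 2 *: X.
  have aa : lor a a = 0 by rewrite lorZl lorZr XX l0 !mulr0.
  have pa p : lor p X = - (2^-1 + lam) -> lor p a = -1.
    by move=> pX; rewrite lorZr pX l0; field.
  exists [set p | hyp p /\ lor p a = -1]; split.
    apply: Or42; exists a; split=> //.
    by apply: (lor_lt0_hyp hp0); rewrite ?aa// (pa _ p0X) ltrN10.
  by move=> p hp /pa.
Qed.

End Causality.

(** * Focal maps over the whole domain *)

Section FocalSphere.
Variables (R : realType) (n : nat) (Omega : set 'rV[R]_n.+1).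
Variable rho : 'rV[R]_n.+1 -> R.
Hypothesis dOmega : sphere_domain Omega.
Hypothesis srho : sphere_smooth Omega rho.
Implicit Types (x : 'rV[R]_n.+1) (u v w : 'rV[R]_n) (s : bool) (lam : R).

Local Notation V := (chart_domain Omega).
Local Notation sig := (chart_factor rho).

Let oV s : open (V s). Proof. exact: open_chart_domain. Qed.
Let ssig s : smooth_on (V s) (sig s). Proof. exact: smooth_chart_factor. Qed.

Lemma domain_chart x : Omega x -> exists s u, stereo s u = x /\ V s u.
Proof.
move=> Ox; have [s [u sx]] : exists s u, stereo s u = x.
  by apply: chart_exists; case: dOmega => -[W _ WE] _ _; move: Ox; rewrite WE => -[].
by exists s, u; split=> //; exact: (eq_ind_r Omega Ox sx).
Qed.

Definition focal lam x : 'rV[R]_n.+2 :=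
  assoc_hyp rho x - (2^-1 - lam) *: (expR (rho x) *: lcons 1 x).

Lemma focal_chart lam s u : V s u ->
  focal lam (stereo s u) = focal_map s (sig s) lam u.
Proof.
by move=> Vu; rewrite focal_mapE /focal horo_null_chart (assoc_hyp_chart dOmega srho Vu).
Qed.

Lemma focal_half x : focal 2^-1 x = assoc_hyp rho x.
Proof. by rewrite /focal subrr scale0r subr0. Qed.

Lemma lor_focal lam mu x : Omega x -> lor (focal lam x) (focal mu x) = - (lam + mu).
Proof.
move=> /domain_chart[s [u [<- Vu]]]; rewrite !focal_chart// !focal_mapE.
rewrite !(lorBl, lorBr, lorZl, lorZr) lor_map_map lor_null_null.
by rewrite lor_null_map lorC lor_null_map; field.
Qed.

Lemma focal_constant lam :
  (forall s u, V s u -> flat_schouten_op (sig s) u = lam%:M) ->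
  forall x y, Omega x -> Omega y -> focal lam y = focal lam x.
Proof.
move=> AE x y Ox Oy; pose P z := focal lam z = focal lam x.
suff : P y by [].
apply: (sphere_domain_clopen dOmega (P := P) _ Ox Oy) => // s u Vu.
have sX := smooth_focal_map s lam (@oV s) (@ssig s).
have E j : \forall w \near u,
    focal_map s (sig s) lam w 0 j = focal_map s (sig s) lam u 0 j.
  apply: (locally_constant (@oV s) Vu) => w Vw; split; first exact: smooth_diff Vw (sX 0 j).
  move=> k; rewrite partialE -dmxE -ddx_delta (ddx_focal_map _ _ (@oV s) (@ssig s))//.
  by rewrite AE// subrr mulmx0 mul0mx scaler0 mxE.
have N1 : \forall w \near u, forall j,
    focal_map s (sig s) lam w 0 j = focal_map s (sig s) lam u 0 j.
  exact: (@filter_forall _ _ _ (nbhs u)).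
have N2 : \forall w \near u, V s w by exact: open_nbhs_nbhs.
apply: filterS2 N1 N2 => w Kw Vw; rewrite /P !focal_chart//.
by rewrite (_ : focal_map s (sig s) lam w = focal_map s (sig s) lam u)//; exact/rowP.
Qed.

(** First-order vanishing of a function on the sphere is read off in either chart, the partial
    derivatives being related by the transition matrix. *)
Lemma focal_orthogonal_chart lam z s s' u u' : V s u -> stereo s u = stereo s' u' ->
  focal_orthogonal s (sig s) lam z u -> focal_orthogonal s' (sig s') lam z u'.
Proof.
move=> Vu e; have Vu' : V s' u' by rewrite /chart_domain /= -e.
pose f x := lor (focal lam x) z.
have fE r w : V r w -> (f \o stereo r) w = lor (focal_map r (sig r) lam w) z.
  by move=> Vw; rewrite /f /= focal_chart.
have sX := smooth_focal_map s lam (@oV s) (@ssig s).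
have df : differentiable (f \o stereo s) u.
  exact: smooth_diff Vu (eq_smooth (@oV s) (fun w Vw => esym (fE s w Vw)) (smooth_lor z (@oV s) sX)).
have [D HD] := chart_change e.
rewrite (focal_orthogonal_pd s lam (@oV s) (@ssig s) z Vu).
rewrite (focal_orthogonal_pd s' lam (@oV s') (@ssig s') z Vu') => -[f0 df0].
split; first by rewrite -fE//= /f -e -[focal _ _]/(focal lam (stereo s u)) focal_chart.
move=> k; rewrite -(eq_pd_on k (@oV s') Vu' (fE s')) HD//.
apply: big1 => j _; rewrite (eq_pd_on j (@oV s) Vu (fE s)) df0 mulr0.
by [].
Qed.

Lemma focal_orthogonal_stays lam z s u x : lam != 0 ->
  (forall s u, V s u ->
     flat_schouten_op (sig s) u *m flat_schouten_op (sig s) u = (lam ^+ 2)%:M) ->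
  V s u -> focal_orthogonal s (sig s) lam z u -> Omega x -> lor (focal lam x) z = 0.
Proof.
move=> lam0 AA Vu zu Ox.
(* Quantifying over all charts through [y] turns the chart condition into a predicate on the sphere,
   to which the connectedness argument applies. *)
pose P y := forall r w, stereo r w = y -> focal_orthogonal r (sig r) lam z w.
have PE r w : V r w -> P (stereo r w) <-> focal_orthogonal r (sig r) lam z w.
  move=> Vw; split; first exact.
  by move=> H t v e; exact: (focal_orthogonal_chart Vw (esym e) H).
have Px : P x.
  have Pu : P (stereo s u) by apply/PE.
  apply: (sphere_domain_clopen (P := P) dOmega _ Vu Ox) => //.
  move=> r w Vw.
  have N1 := focal_orthogonal_locally_constant r (@oV r) (@ssig r) lam0 (AA r) z Vw.
  have N2 : \forall v \near w, V r v by exact: open_nbhs_nbhs.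
  by apply: filterS2 N1 N2 => v H Vv; rewrite !PE.
have [r [w [e Vw]]] := domain_chart Ox.
by have [] := Px r w e; rewrite -focal_chart// e.
Qed.

End FocalSphere.

(** * Lorentz bases and the model products *)

Section LorentzBasis.
Variables (R : realType) (n : nat) (l : 'I_n.+2 -> 'rV[R]_n.+2).
Local Notation J := (lorentz_form R n).
Hypothesis lorl : forall i j, lor (l i) (l j) = J i j.
Hypothesis l_future : 0 < l 0 0 0.
Implicit Types p q y : 'rV[R]_n.+2.

Definition lorentz_basis_mx : 'M[R]_n.+2 := \matrix_(i, j) l i 0 j.
Local Notation L := lorentz_basis_mx.

Lemma lorentz_form_diag i : J i i = if i == 0 then -1 else 1.
Proof. by rewrite !mxE eqxx mulr1n. Qed.

Lemma lorentz_formK : J *m J = 1%:M.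
Proof.
rewrite mulmx_diag; apply/matrixP => i j; rewrite !mxE.
by case: ifP => _; rewrite ?mulrNN mulr1.
Qed.

Let rowL i : row i L = l i. Proof. by apply/rowP => j; rewrite !mxE. Qed.

Let LJL : L *m J *m L^T = J.
Proof.
apply/matrixP => i j; rewrite -lorl lorE -!rowL tr_row -!row_mul.
by rewrite [RHS]mxE colE mulmxA -colE [RHS]mxE.
Qed.

Let LK : J *m L^T *m J *m L = 1%:M.
Proof. by apply: mulmx1C; rewrite !mulmxA LJL lorentz_formK. Qed.

Let lorL p q : lor (p *m L) (q *m L) = lor p q.
Proof. by rewrite !lorE trmx_mul !mulmxA -(mulmxA p) -(mulmxA p) LJL. Qed.

(** Preservation of the sheet comes from the future vector [l 0]: its product with the image of [p]
    is [- p 0 0], which is negative. *)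
Lemma lorentz_basis_isometry : hyp_isometry L.
Proof.
split=> // p [pp p0]; split; first by rewrite lorL.
have e0 : lor (l 0) (p *m L) = - p 0 0.
  rewrite -rowL rowE lorL lorE -rowE mxE (bigD1 0)//= big1 => [|j j0]; last first.
    by rewrite !mxE eq_sym (negbTE j0) mul0r.
  by rewrite !mxE eqxx mulN1r addr0.
apply: (@lor_lt0_future _ _ (l 0)) => //.
- by rewrite lorl lorentz_form_diag ltrN10.
- by rewrite lorL pp lerN10.
- by rewrite e0 oppr_lt0.
Qed.

(** [J *m L^T *m J] is the inverse of [L], as L J L^T = J. *)
Definition lorentz_coord y : 'rV[R]_n.+2 := y *m (J *m L^T *m J).

Lemma lorentz_coordK y : lorentz_coord y *m L = y.
Proof. by rewrite /lorentz_coord -mulmxA LK mulmx1. Qed.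

Lemma lorentz_coordE y i : lorentz_coord y 0 i = J i i * lor y (l i).
Proof.
rewrite /lorentz_coord !mulmxA mul_mx_diag mxE mulrC; congr (_ * _).
  by rewrite [LHS]mxE lorentz_form_diag.
by rewrite lorE -rowL tr_row colE mulmxA -colE [RHS]mxE.
Qed.

Lemma lor_coord y y' : lor (lorentz_coord y) (lorentz_coord y') = lor y y'.
Proof. by rewrite -lorL !lorentz_coordK. Qed.

Lemma lor_sqr p : lor p p = - (p 0 0) ^+ 2 + \sum_(i < n.+2 | (0 < i)%N) p 0 i ^+ 2.
Proof.
rewrite /lor -expr2; congr (_ + _).
by rewrite [RHS]big_mkcond [RHS]big_ord_recl /= add0r; apply: eq_bigr => i _; rewrite expr2.
Qed.

(** The indices up to n - k carry the hyperbolic part [yu], the k + 1 later ones the spherical part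
    [yw]. Only the norm of [yw] is needed: the other equation follows from <y, y> = -1. *)
Lemma model_product_coord (k : nat) (r : R) y yu yw : hyp y -> y = yu + yw ->
  (forall i : 'I_n.+2, (n - k < i)%N -> lor yu (l i) = 0) ->
  (forall i : 'I_n.+2, (i <= n - k)%N -> lor yw (l i) = 0) ->
  lor yw yw = r ^+ 2 ->
  [set p *m L | p in model_product k r] y.
Proof.
move=> [yy y0] yE yu0 yw0 ywr; exists (lorentz_coord y); last exact: lorentz_coordK.
set p := lorentz_coord y; have sw : \sum_(i < n.+2 | (n - k < i)%N) p 0 i ^+ 2 = r ^+ 2.
  rewrite -ywr -lor_coord lor_sqr lorentz_coordE yw0// mulr0 expr0n oppr0 add0r.
  rewrite [RHS](bigID (fun i : 'I_n.+2 => (n - k < i)%N)) /= [X in _ + X]big1 => [|i].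
    rewrite addr0; apply: eq_big => [i|i ki].
      by rewrite andb_idl//; exact: leq_trans.
    by rewrite !lorentz_coordE yE lorDl yu0// add0r.
  by rewrite -leqNgt => /andP[_ ik]; rewrite lorentz_coordE yw0// mulr0 expr0n.
split=> //.
  rewrite lorentz_coordE lorentz_form_diag eqxx mulN1r oppr_gt0 lorC.
  by apply: lor_future_lt0; rewrite ?lorl ?lorentz_form_diag ?ltrN10 ?yy ?lerN10.
have : lor p p = -1 by rewrite lor_coord.
rewrite lor_sqr (bigID (fun i : 'I_n.+2 => (i <= n - k)%N)) /=.
rewrite [X in _ + (_ + X)](_ : _ = r ^+ 2); last first.
  rewrite -sw; apply: eq_bigl => i; rewrite -ltnNge andb_idl//; exact: leq_trans.
by move: (\sum_(i < _ | _) _) => t; lra.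
Qed.

End LorentzBasis.

(** * Classification *)

Lemma card_ord_lt n m : (m <= n)%N -> #|[pred i : 'I_n | (i < m)%N]| = m.
Proof.
move=> mn; rewrite -sum1_card -[in RHS](card_ord m) -[in RHS]sum1_card.
exact: (esym (big_ord_widen n (fun=> 1%N) mn)).
Qed.

(** Reorders the eigenvalues so that [y] comes first and [x] last. With y = - lam and x = lam this
    matches the model, whose hyperbolic coordinates precede the spherical ones. *)
Lemma prod_sort_two_values (R S : comNzRingType) n (a : 'I_n -> R) (x y : R) (g : R -> S) :
  (forall i, a i = x \/ a i = y) ->
  \prod_i g (a i) =
  \prod_(i < n) g (if (i < n - #|[pred i | a i == x]|)%N then y else x).
Proof.
move=> axy; set k := #|_|; have kn : (k <= n)%N by rewrite (leq_trans (max_card _))// card_ord.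
have pc (P : pred 'I_n) c : \prod_(i | P i) c = c ^+ #|P| :> S := prodr_const P c.
have cC (P : pred 'I_n) : #|[pred i | ~~ P i]| = (n - #|P|)%N.
  by rewrite -[LHS](addKn #|P|) (cardC P) card_ord.
rewrite [LHS](bigID (fun i => a i == x)) [RHS](bigID (fun i : 'I_n => (i < n - k)%N)) /=.
rewrite (eq_bigr (fun=> g x)) => [|i /eqP -> //].
rewrite [X in _ * X = _](eq_bigr (fun=> g y)) => [|i]; last first.
  by case: (axy i) => ->; rewrite ?eqxx.
rewrite [X in _ = X * _](eq_bigr (fun=> g y)) => [|i -> //].
rewrite [X in _ = _ * X](eq_bigr (fun=> g x)) => [|i /negbTE -> //].
rewrite !pc mulrC; congr (_ ^+ _ * _ ^+ _).
  by rewrite (card_ord_lt (leq_subr _ _)); exact: cC.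
by rewrite (cC (fun i : 'I_n => (i < n - k)%N)) (card_ord_lt (leq_subr _ _)) subKn.
Qed.

Section Classification.
Variables (R : realType) (n : nat) (Omega : set 'rV[R]_n.+1).
Variables (rho : 'rV[R]_n.+1 -> R) (a : 'I_n -> R) (lam : R).
Hypothesis n3 : (3 <= n)%N.
Hypothesis dOmega : sphere_domain Omega.
Hypothesis srho : sphere_smooth Omega rho.
Hypothesis eigS : forall s u, Omega (stereo s u) ->
  eigenvalues_of (schouten_op (conf_metric rho s) u) a.
Hypothesis lam_lt : lam < 2^-1.
Implicit Types (x : 'rV[R]_n.+1) (u v w : 'rV[R]_n) (s : bool).

Local Notation V := (chart_domain Omega).
Local Notation sig := (chart_factor rho).
Local Notation A s := (flat_schouten_op (sig s)).
Local Notation X := (focal rho).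
Local Notation phi := (assoc_hyp rho).

Let lorX mu nu x : Omega x -> lor (X mu x) (X nu x) = - (mu + nu).
Proof. exact: lor_focal. Qed.

Let lorphi mu x : Omega x -> lor (phi x) (X mu x) = - (2^-1 + mu).
Proof. by move=> Ox; rewrite -focal_half lorX. Qed.

Let hphi x : Omega x -> hyp (phi x). Proof. exact: assoc_hyp_hyp. Qed.

Lemma umbilical_piece : (forall i, a i = lam) ->
  exists M : set 'rV[R]_n.+2, totally_umbilical M /\ piece_of Omega phi M.
Proof.
move=> alam; have [_ _ [x0 Ox0]] := dOmega.
have XX := focal_constant dOmega srho.
have AE s u : V s u -> A s u = lam%:M.
  move=> Vu; have [Q QQ ->] := schouten_spectral n3 dOmega srho eigS Vu.
  by rewrite (funext alam) conj_diag_cst.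
have [|M [MU MP]] := umbilical_level_set lam_lt _ (hphi Ox0) (lorphi lam Ox0).
  by rewrite lorX// -mulr2n mulNr mulr_natl.
exists M; split=> // _ [x Ox <-]; apply: MP; first exact: hphi.
by rewrite -(lorphi lam Ox) (XX lam AE _ _ Ox Ox0).
Qed.

Hypothesis lam_gt0 : 0 < lam.
Hypothesis a_pm : forall i, a i = lam \/ a i = - lam.

Let AA s u : V s u -> A s u *m A s u = (lam ^+ 2)%:M.
Proof.
move=> Vu; have [Q QQ ->] := schouten_spectral n3 dOmega srho eigS Vu.
rewrite (conj_diagM QQ) -(conj_diag_cst QQ); congr conj_diag; apply/funext => i.
by case: (a_pm i) => ->; rewrite ?mulrNN expr2.
Qed.

Let k := #|[pred i | a i == lam]|.
Let b (i : 'I_n) := if (i < n - k)%N then - lam else lam.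
(** The spherical part of phi is - (1/2 - lam) / (2 lam) X_(- lam), and X_(- lam) has Lorentz norm 2
    lam. *)
Let r := (2^-1 - lam) / Num.sqrt (2 * lam).

Lemma product_piece : exists M : set 'rV[R]_n.+2, standard_product k M /\ piece_of Omega phi M.
Proof.
have [_ _ [x0 Ox0]] := dOmega; have [s [u [sx0 Vu]]] := domain_chart dOmega Ox0.
have [Q QQ QA] : exists2 Q : 'M[R]_n, Q *m Q^T = 1%:M &
    Q *m A s u *m Q^T = diag_mx (\row_i b i).
  apply: spectral_sym; first exact: (schouten_chart_sym dOmega srho Vu).
  rewrite (char_poly_chart n3 dOmega srho eigS Vu).
  have := prod_sort_two_values (fun x : R => 'X - x%:P : {poly R}) a_pm.
  exact.
pose E i := row i Q *m horo_frame s (sig s) u.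
have EE i j : lor (E i) (E j) = (i == j)%:R.
  rewrite lor_frame_frame dotvE.
  by rewrite tr_row colE mulmxA -colE [LHS]mxE -row_mul QQ !mxE.
have EX i mu : lor (E i) (X mu x0) = 0.
  by rewrite -sx0 (focal_chart dOmega srho)// lor_frame_focal.
have t2 : 0 < 2 * lam by rewrite mulr_gt0.
pose t := Num.sqrt (2 * lam); have t0 : 0 < t by rewrite sqrtr_gt0.
have tt : t ^+ 2 = 2 * lam by rewrite sqr_sqrtr// ltW.
have tn0 : t != 0 by rewrite gt_eqF.
have l0 : lam != 0 by rewrite gt_eqF.
(* The timelike normalised X_lam takes slot 0, the spacelike X_(- lam) the last slot, and the
   tangent vector [E m] slot m + 1. The vectors with eigenvalue - lam thus fill slots 1 to n - k,
   next to X_lam. *)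
pose l (i : 'I_n.+2) := oapp (fun j : 'I_n.+1 =>
  oapp E (t^-1 *: X (- lam) x0) (unlift ord_max j)) (t^-1 *: X lam x0) (unlift ord0 i).
have lE0 : l ord0 = t^-1 *: X lam x0 by rewrite /l unlift_none.
have lEm : l (lift ord0 ord_max) = t^-1 *: X (- lam) x0.
  by rewrite /l liftK /= unlift_none.
have lEi m : l (lift ord0 (lift ord_max m)) = E m by rewrite /l liftK /= liftK.
have lP (i : 'I_n.+2) : [\/ i = ord0, i = lift ord0 ord_max |
    exists m : 'I_n, i = lift ord0 (lift ord_max m)].
  have [j ->|->] := unliftP ord0 i; last exact: Or31.
  have [m ->|->] := unliftP ord_max j; last exact: Or32.
  by apply: Or33; exists m.
have lorXX mu nu : lor (t^-1 *: X mu x0) (t^-1 *: X nu x0) = - (mu + nu) / (2 * lam).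
  by rewrite lorZl lorZr lorX// -tt; field.
have ll : (lam + lam) / (2 * lam) = 1 by field.
have Jne i j : i != j -> lorentz_form R n i j = 0.
  by move=> ij; rewrite [LHS]mxE (negbTE ij) mulr0n.
have lorl i j : lor (l i) (l j) = lorentz_form R n i j.
  case: (lP i) => [->|->|[m ->]]; case: (lP j) => [->|->|[p ->]].
  - by rewrite lE0 lorXX lorentz_form_diag eqxx mulNr ll.
  - by rewrite lE0 lEm lorXX subrr oppr0 mul0r Jne.
  - by rewrite lE0 lEi lorC lorZr EX mulr0 Jne.
  - by rewrite lE0 lEm lorXX addNr oppr0 mul0r Jne.
  - by rewrite lEm lorXX lorentz_form_diag opprD !opprK ll.
  - by rewrite lEm lEi lorC lorZr EX mulr0 Jne// (inj_eq lift_inj) neq_lift.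
  - by rewrite lE0 lEi lorZr EX mulr0 Jne// lift_eqF.
  - by rewrite lEm lEi lorZr EX mulr0 Jne// (inj_eq lift_inj) lift_eqF.
  have [->|mp] := eqVneq m p; first by rewrite lEi EE eqxx lorentz_form_diag lift_eqF.
  by rewrite !lEi EE (negbTE mp) Jne// !(inj_eq lift_inj).
have l_future : 0 < l 0 0 0.
  have hp := hphi Ox0; apply: (lor_lt0_hyp hp).
    by rewrite lorl lorentz_form_diag lerN10.
  rewrite lE0 lorZr lorphi// mulrN oppr_lt0 mulr_gt0 ?invr_gt0//.
  by rewrite addr_gt0// invr_gt0.
have r0 : 0 < r by rewrite divr_gt0// subr_gt0.
exists [set p *m lorentz_basis_mx l | p in model_product k r]; split.
  by exists r, (lorentz_basis_mx l); split=> //; exact: lorentz_basis_isometry.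
move=> _ [x Ox <-].
have XE : phi x = (2^-1 + lam) / (2 * lam) *: X lam x
    - (2^-1 - lam) / (2 * lam) *: X (- lam) x.
  rewrite /focal; apply/rowP => j; rewrite !(addmxE, oppmxE, scalemxE).
  by field.
have rowA i : row i Q *m A s u = b i *: row i Q.
  have QA' : Q *m A s u = diag_mx (\row_i b i) *m Q.
    by rewrite -QA -(mulmxA _ Q^T) (mulmx1C QQ) mulmx1.
  by rewrite -row_mul QA' row_mul row_diag_mx mxE -scalemxAl -rowE.
have stays mu z : mu ^+ 2 = lam ^+ 2 -> focal_orthogonal s (sig s) mu z u ->
    lor (X mu x) z = 0.
  move=> mu2 zu; apply: (focal_orthogonal_stays dOmega srho _ _ Vu zu Ox).
    by rewrite -sqrf_eq0 mu2 sqrf_eq0.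
  by move=> s' u'; rewrite mu2; exact: AA.
(* The eigenvector with eigenvalue [b i] is annihilated by b i - A, hence orthogonal to the image of
   the differential of X_(b i). *)
have FE i : focal_orthogonal s (sig s) (b i) (E i) u.
  split; first by rewrite lorC lor_frame_focal.
  move=> v; rewrite lor_frame_frame dotv_mulmx linearB /= tr_scalar_mx.
  rewrite (schouten_chart_sym dOmega srho Vu) mulmxBr mul_mx_scalar rowA subrr.
  by rewrite dotv0.
(* The product of X_mu and X_(- mu) is - (mu - mu) = 0, and the tangent frame is orthogonal to every
   focal map at the same point. Fixed at [x0], the vector stays orthogonal everywhere by [stays]. *)
have FX mu : focal_orthogonal s (sig s) mu (X (- mu) x0) u.
  split; first by rewrite -(focal_chart dOmega srho)// sx0 lorX// subrr oppr0.
  by move=> v; rewrite -sx0 (focal_chart dOmega srho)// lor_frame_focal.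
apply: (model_product_coord lorl l_future (hphi Ox) XE).
- move=> i; case: (lP i) => [->//|->|[m ->]] ki; rewrite lorZl.
    by rewrite lEm lorZr stays// !mulr0.
  move: ki; rewrite lift0 lift_max ltnS leqNgt => /negbTE km.
  by have := FE m; rewrite /b km lEi => /stays ->//; rewrite mulr0.
- move=> i; case: (lP i) => [->|->|[m ->]] ki; rewrite lorNl lorZl.
  + rewrite lE0 lorZr stays ?sqrrN ?mulr0 ?oppr0//.
    by have := FX (- lam); rewrite opprK.
  + by move: ki; rewrite lift0 /= leqNgt ltnS leq_subr.
  + move: ki; rewrite lift0 lift_max => km.
    by have := FE m; rewrite /b km lEi => /stays ->; rewrite ?sqrrN ?mulr0 ?oppr0.
rewrite lorNl lorNr opprK lorZl lorZr lorX// /r expr_div_n tt.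
by field.
Qed.

Lemma multiplicity_bounds : (exists i, a i = lam) -> (exists i, a i = - lam) ->
  (1 <= k <= n - 1)%N.
Proof.
move=> [i ai] [j aj]; have kE := cardC [pred i | a i == lam].
rewrite card_ord -/k in kE; apply/andP; split.
  by apply/card_gt0P; exists i; rewrite inE ai.
rewrite -kE -addnBA ?leq_addr//; apply/card_gt0P; exists j.
by rewrite !inE aj -subr_eq0 -opprD oppr_eq0 gt_eqF ?addr_gt0.
Qed.

End Classification.

(** * Dilations and the conclusion *)

Lemma flat_schouten_op_shift (R : realType) n (U : set 'rV[R]_n) sigma (c : R) u :
  open U -> smooth_on U sigma -> U u ->
  flat_schouten_op (fun w => sigma w + c) u = expR (- (2 * c)) *: flat_schouten_op sigma u.
Proof.
move=> oU ssig Uu; pose sc := fun w : 'rV[R]_n => sigma w + c.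
have pdE i w : U w -> pd i sc w = pd i sigma w.
  move=> Uw; rewrite (pdD i (smooth_diff Uw ssig) (differentiable_cst c w)).
  by rewrite pd_cst addr0.
have gE : grad_at sc u = grad_at sigma u.
  by apply/rowP => j; rewrite !mxE pdE.
have hE : hess_at sc u = hess_at sigma u.
  apply/matrixP => i j; rewrite !mxE.
  by apply: (eq_pd_on _ oU Uu) => w Uw; exact: pdE.
rewrite /flat_schouten_op !flat_schoutenE gE hE scalerA; congr (_ *: _).
by rewrite -expRD mulrDr opprD addrC.
Qed.

Section Dilation.
Variables (R : realType) (n : nat) (Omega : set 'rV[R]_n.+1).
Variables (rho : 'rV[R]_n.+1 -> R) (a : 'I_n -> R) (t : R).
Hypothesis n3 : (3 <= n)%N.
Hypothesis dOmega : sphere_domain Omega.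
Hypothesis srho : sphere_smooth Omega rho.
Hypothesis eigS : forall s u, Omega (stereo s u) ->
  eigenvalues_of (schouten_op (conf_metric rho s) u) a.

Lemma sphere_smooth_dilate : sphere_smooth Omega (dilate t rho).
Proof.
move=> s; have oV := @open_chart_domain _ _ _ dOmega s.
by apply: (smoothD oV); [exact: srho|exact: smooth_cst].
Qed.

Lemma schouten_dilate s u : Omega (stereo s u) ->
  eigenvalues_of (schouten_op (conf_metric (dilate t rho) s) u)
    (fun i => expR (- t) * a i).
Proof.
move=> Vu; have oV := @open_chart_domain _ _ _ dOmega s.
rewrite (schouten_op_chart n3 dOmega sphere_smooth_dilate Vu).
have [Q QQ QA] := schouten_spectral n3 dOmega srho eigS Vu.
have -> : chart_factor (dilate t rho) s = fun w => chart_factor rho s w + t / 2.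
  by apply/funext => w; rewrite /chart_factor /dilate addrAC.
rewrite (flat_schouten_op_shift _ oV (@smooth_chart_factor _ _ _ _ dOmega srho s) Vu) QA.
rewrite mulrC divfK// conj_diagZ; exact: char_poly_conj_diag.
Qed.

Lemma schouten_lt_half_dilate :
  schouten_lt_half Omega (dilate t rho) <-> forall i, expR (- t) * a i < 2^-1.
Proof.
split=> [H i|H s u Vu e].
  have [_ _ [x /(domain_chart dOmega)[s [u [_ Vu]]]]] := dOmega.
  apply: (H s u Vu); rewrite eigenvalue_root_char (schouten_dilate Vu).
  by rewrite /root horner_prod (bigD1 i)//= !hornerE subrr mul0r.
rewrite eigenvalue_root_char (schouten_dilate Vu) /root horner_prod.
by move=> /prodf_eq0[i _]; rewrite !hornerE subr_eq0 => /eqP ->.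
Qed.

End Dilation.

Theorem mainTheorem4 (R : realType) (n : nat) (hn : (3 <= n)%N)
    (Omega : set 'rV[R]_n.+1) (rho : 'rV[R]_n.+1 -> R)
    (hOmega : sphere_domain Omega) (hrho : sphere_smooth Omega rho)
    (hSch : schouten_constant Omega rho) :
  (exists t : R, 0 <= t /\ schouten_lt_half Omega (dilate t rho)) /\
  (forall t : R, 0 <= t -> schouten_lt_half Omega (dilate t rho) ->
    isoparametric Omega (assoc_hyp (dilate t rho))
                        (assoc_normal (dilate t rho)) /\
    ((exists M : set 'rV[R]_n.+2, totally_umbilical M /\
        piece_of Omega (assoc_hyp (dilate t rho)) M) \/
     (exists k : nat, (1 <= k <= n - 1)%N /\
        exists M : set 'rV[R]_n.+2, standard_product k M /\
          piece_of Omega (assoc_hyp (dilate t rho)) M))).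
Proof.
have [a eigS] := hSch; split.
  (* With this value 2 a_i <= t < 1 + t <= e^t for every i, which is the required bound. *)
  pose t := \sum_i 2 * `|a i|; exists t.
  have t0 : 0 <= t by apply: sumr_ge0 => i _; rewrite mulr_ge0.
  split=> //; apply/(schouten_lt_half_dilate t hn hOmega hrho eigS) => i.
  have at_ : 2 * a i <= t.
    have s0 : 0 <= \sum_(j | j != i) 2 * `|a j| by apply: sumr_ge0 => j _; rewrite mulr_ge0.
    rewrite /t (bigD1 i)//=; have := ler_norm (a i); lra.
  have te := expR_ge1Dx t; rewrite expRN -ltr_pdivlMl ?invr_gt0 ?expR_gt0// invrK.
  rewrite -ltr_pdivrMr ?invr_gt0// invrK; lra.
move=> t t0 /(schouten_lt_half_dilate t hn hOmega hrho eigS) lt.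
have eigT := schouten_dilate t hn hOmega hrho eigS.
have srT := sphere_smooth_dilate t hOmega hrho.
split; first exact: (assoc_hyp_isoparametric hn hOmega srT eigT lt).
have [_ _ [x /(domain_chart hOmega)[s [u [_ Vu]]]]] := hOmega.
(* The list of eigenvalues is the same on the whole domain, so one chart around one point decides
   between the two cases. *)
have eigA w := @char_poly_chart _ _ _ _ _ hn hOmega srT eigT s w.
have n0 : (0 < n)%N := ltn_trans (isT : 0 < 2)%N hn.
have [[lam al]|[lam [lam0 apm [i ai] ex]]] := eigenvalues_opposite
    (@open_chart_domain _ _ _ hOmega s) (@smooth_chart_factor _ _ _ _ hOmega srT s) eigA Vu n0.
  left; apply: (umbilical_piece hn hOmega srT eigT _ al).
  by rewrite -(al (Ordinal n0)) lt.
have lamh : lam < 2^-1 by rewrite -ai lt.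
right; eexists; split; last exact: (product_piece hn hOmega srT eigT lamh lam0 apm).
by apply: multiplicity_bounds ex => //; exists i.
Qed.
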